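(* Let $-1<q<1$. Let $(\mathcal{K}_{\mathbb{R}},(\mathsf{U}_t)_{t\in\mathbb{R}})$ and $(\mathcal{H}_{\mathbb{R}},(\mathsf{V}_t)_{t\in\mathbb{R}})$ be separable real Hilbert spaces equipped with strongly continuous one-parameter groups of orthogonal transformations, and let $\mathcal{K}$, $\mathcal{H}$ be the associated complex Hilbert spaces (deformed completions of the complexifications $\mathcal{K}_{\mathbb{C}}$, $\mathcal{H}_{\mathbb{C}}$). Let $I$ be the conjugation on $\mathcal{K}_{\mathbb{C}}$ and $J$ the conjugation on $\mathcal{H}_{\mathbb{C}}$. Suppose that $T:\mathcal{K}\to\mathcal{H}$ is a (linear) contraction such that $T=JTI$, meaning that $T(\mathcal{K}_{\mathbb{R}})\subset\mathcal{H}_{\mathbb{R}}$ (equivalently, $T(\mathcal{K}_{\mathbb{C}})\subset\mathcal{H}_{\mathbb{C}}$ and $JTIx=Tx$ for all $x\in\mathcal{K}_{\mathbb{C}}$). Then the assignment $$W(e_1\otimes\dots\otimes e_n)\mapsto W(Te_1\otimes\dots\otimes Te_n)\qquad (n\geqslant 0,\ e_1,\dots,e_n\in\mathcal{K}_{\mathbb{C}})$$ extends to a normal unital completely positive map $\Gamma_q(T):\Gamma_q(\mathcal{K})\to\Gamma_q(\mathcal{H})$ that preserves the vacuum state, i.e. $\langle\Omega,\Gamma_q(T)(x)\Omega\rangle=\langle\Omega,x\Omega\rangle$ for all $x\in\Gamma_q(\mathcal{K})$.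
   Context: Inner products are linear in the second variable. **The deformed Hilbert space.** Given a real Hilbert space $\mathcal{H}_{\mathbb{R}}$ with a strongly continuous one-parameter group $(\mathsf{U}_t)_{t\in\mathbb{R}}$ of orthogonal transformations, let $\mathcal{H}_{\mathbb{C}}$ be its complexification. The group extends to a unitary group on $\mathcal{H}_{\mathbb{C}}$ of the form $\mathsf{U}_t=A^{it}$ for a positive injective (possibly unbounded) operator $A$. Define $\langle x,y\rangle_{\mathsf{U}}:=\langle \frac{2A}{1+A}x,y\rangle$ on $\mathcal{H}_{\mathbb{C}}$, and let $\mathcal{H}$ be the completion of $\mathcal{H}_{\mathbb{C}}$ with respect to $\langle\cdot,\cdot\rangle_{\mathsf{U}}$. The conjugation on $\mathcal{H}_{\mathbb{C}}$, $x+iy\mapsto x-iy$ for $x,y\in\mathcal{H}_{\mathbb{R}}$, is viewed as a (generally unbounded) closed antilinear operator on $\mathcal{H}$ with domain $\mathcal{H}_{\mathbb{C}}$. The space $\mathcal{K}$ is built in the same way from $(\mathcal{K}_{\mathbb{R}},(\mathsf{U}_t))$, and $\mathcal{H}$ from $(\mathcal{H}_{\mathbb{R}},(\mathsf{V}_t))$. **$q$-Fock space.** For a complex Hilbert space $\mathcal{H}$, $\mathcal{F}_q(\mathcal{H})$ is the completion of the algebraic direct sum $\bigoplus_{n\geqslant 0}\mathcal{H}^{\otimes n}$ (algebraic tensor powers, $\mathcal{H}^{\otimes 0}=\mathbb{C}\Omega$ with $\Omega$ the unit vacuum vector) with respect to the inner product $$\langle v_1\otimes\dots\otimes v_n, w_1\otimes\dots\otimes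 w_m\rangle_q=\delta_{n,m}\sum_{\sigma\in S_n}q^{\mathrm{inv}(\sigma)}\prod_{i=1}^n\langle v_i,w_{\sigma(i)}\rangle,$$ where $\mathrm{inv}(\sigma)$ is the number of inversions of $\sigma$. The creation operator $a_q^{\ast}(h)$, $h\in\mathcal{H}$, is the bounded operator given by $a_q^{\ast}(h)\Omega=h$ and $a_q^{\ast}(h)(v_1\otimes\dots\otimes v_n)=h\otimes v_1\otimes\dots\otimes v_n$; the annihilation operator $a_q(h)$ is its adjoint. **$q$-Araki-Woods algebra.** $\Gamma_q(\mathcal{H})$ is the von Neumann algebra on $\mathcal{F}_q(\mathcal{H})$ generated by the operators $s_q(h)=a_q^{\ast}(h)+a_q(h)$, $h\in\mathcal{H}_{\mathbb{R}}$; similarly for $\Gamma_q(\mathcal{K})$. The vector $\Omega$ is cyclic and separating for it; the vacuum state is $x\mapsto\langle\Omega,x\Omega\rangle$. **Wick words.** If $\xi\in\mathcal{F}_q(\mathcal{H})$ and there is $x\in\Gamma_q(\mathcal{H})$ with $x\Omega=\xi$, then $x$ is unique and is denoted $W(\xi)$. It is known that $W(e_1\otimes\dots\otimes e_n)$ exists for all $e_1,\dots,e_n\in\mathcal{H}_{\mathbb{C}}$ (for $n=0$, $W(\Omega)=1$). *)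

(* Defs.v *)
From HB Require Import structures.
From mathcomp Require Import all_boot all_order all_algebra fingroup perm.
From mathcomp Require Import all_classical all_reals all_analysis.
From mathcomp Require Import complex.

Set Implicit Arguments.
Unset Strict Implicit.
Unset Printing Implicit Defensive.

Import Order.TTheory GRing.Theory Num.Theory.
Import numFieldNormedType.Exports.

Local Open Scope classical_set_scope.
Local Open Scope ring_scope.
Local Open Scope complex_scope.

(* [{dot V for theta}] is linear in its first variable, whereas inner products
   are linear in the second variable here: hence the swap in [ip]. *)
Record hilbert (K : numFieldType) (theta : K -> K) := Hilbert {
  hilbert_sort :> completeNormedModType K ;
  hilbert_form : {dot hilbert_sort for theta} ;
  hilbert_formE : forall x, hilbert_form x x = `|x| ^+ 2 }.

Notation realHilbert R := (@hilbert R idfun).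
Notation complexHilbert R := (@hilbert (complex R) conjc).

Definition ip (K : numFieldType) (theta : K -> K) (H : hilbert theta)
  (x y : H) : K := hilbert_form H y x.

Definition separable (T : topologicalType) : Prop :=
  exists2 D : set T, countable D & dense D.

Record orthogonal_group (R : realType) (HR : realHilbert R)
    (U : R -> HR -> HR) : Prop := OrthogonalGroup {
  og_linear : forall t, linear (U t) ;
  og_ip : forall t x y, ip (U t x) (U t y) = ip x y ;
  og0 : forall x, U 0 x = x ;
  ogD : forall s t x, U (s + t) x = U s (U t x) ;
  og_continuous : forall x, continuous (fun t => U t x) }.

(* The pair [(x, y)] stands for x + iy. *)
Definition complexification (R : realType) (V : lmodType R) : Type :=
  (V * V)%type.

Section Complexification.
Context {R : realType} {V : lmodType R}.
Local Notation VC := (complexification V).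

HB.instance Definition _ := GRing.Zmodule.copy VC (V * V)%type.

Definition cscale (a : R[i]) (z : VC) : VC :=
  (complex.Re a *: z.1 - complex.Im a *: z.2,
   complex.Im a *: z.1 + complex.Re a *: z.2).

Lemma cscaleA a b z : cscale a (cscale b z) = cscale (a * b) z.
Proof.
case: a b z => [a1 a2] [b1 b2] [x y]; congr pair => /=;
  rewrite !scalerBl !scalerDl !scalerBr !scalerDr !scalerA.
- by rewrite !opprD addrACA.
- by rewrite addrACA; congr (_ + _); rewrite addrC.
Qed.

Lemma cscale1 : left_id 1 cscale.
Proof. by case=> x y; rewrite /cscale /= !scale1r !scale0r subr0 add0r. Qed.

Lemma cscaleDr : right_distributive cscale +%R.
Proof.
case=> a b [x y] [x' y']; congr pair => /=; rewrite !scalerDr ?opprD;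
  by rewrite addrACA.
Qed.

Lemma cscaleDl z : {morph cscale^~ z : a b / a + b}.
Proof.
case: z => x y [a1 a2] [b1 b2]; congr pair => /=; rewrite !scalerDl ?opprD;
  by rewrite addrACA.
Qed.

HB.instance Definition _ := GRing.Zmodule_isLmodule.Build R[i] VC
  cscaleA cscale1 cscaleDr cscaleDl.

Definition of_real (x : V) : VC := (x, 0).

Definition cmap (f : V -> V) (z : VC) : VC := (f z.1, f z.2).

End Complexification.

Definition cip (R : realType) (HR : realHilbert R)
    (z w : complexification HR) : R[i] :=
  (ip z.1 w.1 + ip z.2 w.2) +i* (ip z.1 w.2 - ip z.2 w.1).

Section SpectralTheory.
Context {R : realType} {HR : realHilbert R}.
Local Notation HC := (complexification HR).

(* A possibly unbounded operator is given by its graph. *)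
Definition operator := HC -> HC -> Prop.

(* A is single-valued and its graph is that of its adjoint; since the adjoint
   relation is single-valued only when the domain is dense, A is then densely
   defined, and being an adjoint it is linear and closed. *)
Definition self_adjoint (A : operator) : Prop :=
  (forall x y y', A x y -> A x y' -> y = y') /\
  (forall z w, A z w <-> forall x y, A x y -> cip z y = cip w x).

Definition positive_operator (A : operator) : Prop :=
  forall x y, A x y -> 0 <= cip x y.

Definition injective_operator (A : operator) : Prop :=
  forall x, A x 0 -> x = 0.

Record spectral_measure := SpectralMeasure {
  sproj : set (measurableTypeR R) -> HC -> HC ;
  sproj_linear : forall B, measurable B -> linear (sproj B) ;
  sproj_sym : forall B, measurable B ->
    forall x y, cip (sproj B x) y = cip x (sproj B y) ;
  sprojT : forall x, sproj setT x = x ;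
  sprojI : forall B C, measurable B -> measurable C ->
    forall x, sproj (B `&` C) x = sproj B (sproj C x) ;
  smeas : HC -> {measure set (measurableTypeR R) -> \bar R} ;
  smeasE : forall x B, measurable B ->
    smeas x B = (complex.Re (cip x (sproj B x)))%:E }.

Definition spectral_integral (E : spectral_measure) (f : R -> R[i]) (x : HC)
    : R[i] :=
  (\int[smeas E x]_l complex.Re (f l)) +i* (\int[smeas E x]_l complex.Im (f l)).

(* E is the spectral measure of A, i.e. A is the integral of l dE(l). A
   self-adjoint operator is determined by its domain and quadratic form. *)
Definition is_spectral_measure_of (A : operator) (E : spectral_measure)
    : Prop :=
  (forall x, (exists y, A x y) <->
     (\int[smeas E x]_l ((l : R) ^+ 2)%:E < +oo)%E) /\
  (forall x y, A x y -> cip x y = spectral_integral E (fun l => l%:C) x).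

(* B = f(A) for A with spectral measure E and f a Borel function that is
   bounded outside an E-null set; the quadratic form determines B. *)
Definition borel_calculus (E : spectral_measure) (f : R -> R[i])
    (B : HC -> HC) : Prop :=
  linear B /\ forall x, cip x (B x) = spectral_integral E f x.

End SpectralTheory.
Arguments operator {R} HR.
Arguments spectral_measure {R} HR.

(* l ^ (it) for l > 0. The values at l <= 0 are irrelevant in the sequel, as
   the spectral measure of a positive injective operator ignores ]-oo, 0]. *)
Definition ipow (R : realType) (t l : R) : R[i] :=
  cos (t * ln l) +i* sin (t * ln l).

(* A realization of the deformed space: a completion of the complexification
   for <x, y>_U = <(2A / (1 + A)) x, y>, where U_t = A ^ (it). *)
Record deformed_space (R : realType) (HR : realHilbert R)
    (U : R -> HR -> HR) := DeformedSpace {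
  generator : operator HR ;
  generator_sa : self_adjoint generator ;
  generator_pos : positive_operator generator ;
  generator_inj : injective_operator generator ;
  generator_spec : spectral_measure HR ;
  generator_specP : is_spectral_measure_of generator generator_spec ;
  generator_ipow : forall t, borel_calculus generator_spec (ipow t) (cmap (U t)) ;
  deformation : complexification HR -> complexification HR ;
  deformationP :
    borel_calculus generator_spec (fun l => (2 * l / (1 + l))%:C) deformation ;
  deformed_sort :> complexHilbert R ;
  deformed_emb : {linear complexification HR -> deformed_sort} ;
  deformed_ip : forall x y,
    ip (deformed_emb x) (deformed_emb y) = cip (deformation x) y ;
  deformed_dense : dense (range deformed_emb) }.

Definition inversions (n : nat) (s : 'S_n) : nat :=
  #|[set ij : 'I_n * 'I_n | (ij.1 < ij.2)%N && (s ij.2 < s ij.1)%N]%SET|.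

Definition qform (R : realType) (q : R) (H : complexHilbert R) (v w : seq H)
    : R[i] :=
  if size v == size w then
    \sum_(s : 'S_(size v)) (q ^+ inversions s)%:C *
      \prod_(i < size v) ip (nth 0 v i) (nth 0 w (s i))
  else 0.

(* A realization of the q-Fock space; [tens [:: v1; ...; vn]] is the elementary
   tensor of v1, ..., vn. Multilinearity of [tens] follows from [tens_ip], whose
   right-hand side is conjugate multilinear in v and multilinear in w. *)
Record q_fock_space (R : realType) (q : R) (H : complexHilbert R) := QFock {
  fock_sort :> complexHilbert R ;
  tens : seq H -> fock_sort ;
  tens_ip : forall v w, ip (tens v) (tens w) = qform q v w ;
  tens_dense : dense [set x | exists n (c : 'I_n -> R[i]) (v : 'I_n -> seq H),
                               x = \sum_(i < n) c i *: tens (v i)] }.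

Definition vacuum (R : realType) (q : R) (H : complexHilbert R)
  (F : q_fock_space q H) : F := tens F [::].

Section Operators.
Context {R : realType} {F : complexHilbert R}.
Implicit Types (x y : F -> F) (M S D : set (F -> F)).

Definition bounded_op x : Prop := linear x /\ continuous x.

Definition is_adjoint x y : Prop := forall u v, ip (x u) v = ip u (y v).

Definition commutant S : set (F -> F) :=
  [set x | bounded_op x /\ forall s, S s -> x \o s = s \o x].

Definition von_neumann_algebra M : Prop :=
  (forall x y, M x -> is_adjoint x y -> M y) /\
  commutant (commutant M) = M.

Definition op_le x y : Prop := forall u, 0 <= ip u (y u - x u).

Definition directed D : Prop :=
  D !=set0 /\
  forall x y, D x -> D y -> exists z, [/\ D z, op_le x z & op_le y z].

Definition op_sup M D x : Prop :=
  [/\ M x, forall d, D d -> op_le d x &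
      forall y, M y -> (forall d, D d -> op_le d y) -> op_le x y].

Definition positive_matrix n (X : 'I_n -> 'I_n -> F -> F) : Prop :=
  forall u : 'I_n -> F, 0 <= \sum_i \sum_j ip (u i) (X i j (u j)).

End Operators.

Section Maps.
Context {R : realType} {F G : complexHilbert R}.
Variables (M : set (F -> F)) (N : set (G -> G)) (Phi : (F -> F) -> (G -> G)).

Definition linear_on : Prop :=
  forall (a : R[i]) x y, M x -> M y -> Phi (a *: x + y) = a *: Phi x + Phi y.

Definition completely_positive : Prop :=
  forall n (X : 'I_n -> 'I_n -> F -> F), (forall i j, M (X i j)) ->
    positive_matrix X -> positive_matrix (fun i j => Phi (X i j)).

(* Phi preserves suprema of bounded directed families of self-adjoint
   elements; such a family is bounded exactly when it has a supremum in M. *)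
Definition normal_map : Prop :=
  forall (D : set (F -> F)) x,
    D `<=` [set d | M d /\ is_adjoint d d] -> directed D -> op_sup M D x ->
    op_sup N (Phi @` D) (Phi x).

End Maps.

Section QArakiWoods.
Context {R : realType} {q : R} {HR : realHilbert R} {U : R -> HR -> HR}.
Context {H : deformed_space U} (F : q_fock_space q H).

Definition is_creation (h : H) (a : F -> F) : Prop :=
  bounded_op a /\ forall v, a (tens F v) = tens F (h :: v).

(* The operators a + a', a being the creation operator of a vector of H_R and
   a' the annihilation operator. *)
Definition field_operators : set (F -> F) :=
  [set s | exists (h : HR) (a a' : F -> F),
     [/\ is_creation (deformed_emb H (of_real h)) a, is_adjoint a a' &
         s = a + a']].

Definition araki_woods : set (F -> F) :=
  smallest von_neumann_algebra field_operators.

(* W(xi); the value is arbitrary when xi is not of the form x Omega. *)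
Definition wick (xi : F) : F -> F :=
  xget (idfun : F -> F) [set x | araki_woods x /\ x (vacuum F) = xi].

End QArakiWoods.
Arguments araki_woods {R q HR U H} F _.

(* Main.v *)
(** Equip the sum of K and H with the form for which <k, h> = <T k, h>; it is positive
    because T is a contraction. Its q-Fock space L contains F_q(H) through an isometry J,
    and by a Wold decomposition L is spanned by copies of F_q(K), one for each vector
    killed by the annihilation operators of K. Let an operator x on F_q(K) act on all the
    copies at once, as [dilate x]. Then [phi x = J^* (dilate x) J] is completely positive
    and normal, and it sends a normally ordered product of creation and annihilation
    operators of vectors k to that of the vectors T k; expanding Wick words into such
    products, it sends W(e) to W(T e). Von Neumann's density argument in L extends the
    inclusion of phi(M) in N from the algebra generated by the fields to its bicommutant M.

    A Wick word is determined by its vacuum vector because the vacuum is separating: right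
    fields of vectors h such that <e, h> is real for every e in H_R commute with the
    algebra, and these h are total as soon as H_R is closed in H. The latter means that
    |x|_U^2 >= c |x|^2 for real x. The spectral measure of such an x integrates each
    sin (t ln l) to 0, and so do the odd trigonometric polynomials of ln l obtained by
    iterating y |-> y (3 - y^2) / 2 on a sine; as these approximate the sign function,
    the spectral measure cannot be concentrated near 0. *)

From HB Require Import structures.
From mathcomp Require Import all_boot all_order all_algebra fingroup perm.
From mathcomp Require Import all_classical all_reals all_analysis.
From mathcomp Require Import complex measurable_realfun ring lra zify.
Require Import Defs.

Set Implicit Arguments.
Unset Strict Implicit.
Unset Printing Implicit Defensive.

Import Order.TTheory GRing.Theory Num.Theory.
Import numFieldNormedType.Exports Normc.

Local Open Scope classical_set_scope.
Local Open Scope ring_scope.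
Local Open Scope complex_scope.

Local Notation "x ^*" := (conjc x) : ring_scope.

(** The customary construction dilates T to an isometry followed by an orthogonal projection,
    between real spaces that carry orthogonal groups, and lets a larger q-Araki-Woods algebra do the
    rest. Here T need not intertwine the groups of K and H, so the sum of K and H carries no evident
    group. The space L is therefore only a Fock space, without an algebra of its own, and x acts on
    it as x tensored with the identity. This makes sense for every bounded x and separates the
    issues: complete positivity, the vacuum state and strong continuity on bounded sets hold for all
    bounded operators, whereas the real structures enter only through phi(M) in N and through Wick
    words.

    The Fock spaces of the statement are known through their inner products alone, so each operator
    is obtained by an estimate on combinations of words, followed by an extension by density.
    Moreover W(xi) is a chosen operator with vacuum vector xi; its uniqueness is part of what must
    be proved, and this is what calls for the spectral analysis of A. *)

Lemma ler_mulD1 (R : realType) (b a : R) : 0 <= a -> b * a <= (b + 1) * a.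
Proof. by move=> a0; rewrite ler_wpM2r// lerDl. Qed.

(** * Positive semidefinite Hermitian forms: Cauchy-Schwarz and orthogonal projection *)

Section HermitianForms.
Context {R : realType}.
Local Notation C := R[i].
Local Notation Re := (@complex.Re R).
Local Notation Im := (@complex.Im R).

(** Semidefinite on purpose: the same theory serves spans before completion, the defect of a
    contraction and the forms <u, p v> of positive operators. Symmetry makes the diagonal real, so
    positivity is asked of the real part only. *)
Record hform (E : lmodType C) := HForm {
  hf :> E -> E -> C ;
  hf_linear : forall x a u v, hf x (a *: u + v) = a * hf x u + hf x v ;
  hf_sym : forall x y, hf y x = (hf x y)^* ;
  hf_ge0 : forall x, 0 <= Re (hf x x) }.

Lemma ReM_real (a : R) (z : C) : Re (a%:C * z) = a * Re z.
Proof. by case: z => x y /=; rewrite mul0r subr0. Qed.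

Lemma ReD (z w : C) : Re (z + w) = Re z + Re w.
Proof. by case: z w => ? ? []. Qed.

Lemma ReN (z : C) : Re (- z) = - Re z.
Proof. by case: z. Qed.

Lemma ReB (z w : C) : Re (z - w) = Re z - Re w.
Proof. by rewrite ReD ReN. Qed.

Lemma Re_conjc (z : C) : Re z^* = Re z.
Proof. by case: z. Qed.

Lemma Im_conjc (z : C) : Im z^* = - Im z.
Proof. by case: z. Qed.

Lemma Re_sum (I : Type) (r : seq I) (P : pred I) (f : I -> C) :
  Re (\sum_(i <- r | P i) f i) = \sum_(i <- r | P i) Re (f i).
Proof. by apply: big_morph => //; exact: ReD. Qed.

Lemma Re_iM (z : C) : Re ('i * z) = - Im z.
Proof. by case: z => x y /=; rewrite mul0r mul1r sub0r. Qed.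

Lemma Im_iM (z : C) : Im ('i * z) = Re z.
Proof. by case: z => x y /=; rewrite mul0r mul1r add0r. Qed.

Lemma complex_ext (z w : C) : Re z = Re w -> Im z = Im w -> z = w.
Proof. by case: z w => ? ? [? ?] /= -> ->. Qed.

Lemma complex_ge0P (z : C) : 0 <= z <-> Im z = 0 /\ 0 <= Re z.
Proof. by rewrite lecE; split => [/andP[/eqP]|[-> ->]] /=; rewrite ?eqxx. Qed.

Lemma real_of_ge0 (z : C) : 0 <= z -> z = (Re z)%:C.
Proof. by move=> /complex_ge0P[h _]; apply: complex_ext. Qed.

Lemma normc_ge0 (z : C) : 0 <= normc z.
Proof. by case: z => a b; exact: sqrtr_ge0. Qed.

Lemma normc_conj (z : C) : normc z^* = normc z.
Proof. by case: z => a b /=; rewrite sqrrN. Qed.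

Lemma mulc_conj (z : C) : z^* * z = (normc z ^+ 2)%:C.
Proof.
case: z => a b; apply: complex_ext => /=.
  by rewrite sqr_sqrtr ?addr_ge0 ?sqr_ge0// !expr2 mulNr opprK.
by rewrite mulrC mulNr subrr.
Qed.

Lemma normcR (a : R) : normc a%:C = `|a|.
Proof. by rewrite /= expr0n /= addr0 sqrtr_sqr. Qed.

Lemma Re_le_normc (z : C) : `|Re z| <= normc z.
Proof.
case: z => a b /=; rewrite -sqrtr_sqr ler_sqrt ?addr_ge0 ?sqr_ge0//.
by rewrite lerDl sqr_ge0.
Qed.

Lemma Im_le_normc (z : C) : `|Im z| <= normc z.
Proof.
case: z => a b /=; rewrite -sqrtr_sqr ler_sqrt ?addr_ge0 ?sqr_ge0//.
by rewrite lerDr sqr_ge0.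
Qed.

Section Form.
Context {E : lmodType C}.
Variable B : hform E.
Implicit Types (x y z : E) (a : C).

Lemma hfDr x y z : B x (y + z) = B x y + B x z.
Proof. by rewrite -[y]scale1r hf_linear mul1r scale1r. Qed.

Lemma hf0r x : B x 0 = 0.
Proof. by apply: (@addrI _ (B x 0)); rewrite -hfDr !addr0. Qed.

Lemma hfZr x a y : B x (a *: y) = a * B x y.
Proof. by rewrite -[a *: y]addr0 hf_linear hf0r addr0. Qed.

Lemma hfNr x y : B x (- y) = - B x y.
Proof. by rewrite -scaleN1r hfZr mulN1r. Qed.

Lemma hfBr x y z : B x (y - z) = B x y - B x z.
Proof. by rewrite hfDr hfNr. Qed.

Lemma hfDl x y z : B (y + z) x = B y x + B z x.
Proof. by rewrite hf_sym hfDr rmorphD /= -!hf_sym. Qed.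

Lemma hf0l x : B 0 x = 0.
Proof. by rewrite hf_sym hf0r conjc0. Qed.

Lemma hfZl x a y : B (a *: y) x = a^* * B y x.
Proof. by rewrite hf_sym hfZr rmorphM /= -hf_sym. Qed.

Lemma hfNl x y : B (- y) x = - B y x.
Proof. by rewrite hf_sym hfNr rmorphN /= -hf_sym. Qed.

Lemma hfBl x y z : B (y - z) x = B y x - B z x.
Proof. by rewrite hfDl hfNl. Qed.

Lemma hf_sumr x (I : Type) (r : seq I) (P : pred I) (f : I -> E) :
  B x (\sum_(i <- r | P i) f i) = \sum_(i <- r | P i) B x (f i).
Proof. by apply: big_morph => [y z|]; [exact: hfDr|exact: hf0r]. Qed.

Lemma hf_suml x (I : Type) (r : seq I) (P : pred I) (f : I -> E) :
  B (\sum_(i <- r | P i) f i) x = \sum_(i <- r | P i) B (f i) x.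
Proof. by apply: (big_morph (B^~ x)) => [y z|]; [exact: hfDl|exact: hf0l]. Qed.

Lemma Im_hfxx x : Im (B x x) = 0.
Proof. by have := hf_sym B x x => /(congr1 Im); rewrite Im_conjc; lra. Qed.

Lemma Re_hf_sym x y : Re (B x y) = Re (B y x).
Proof. by rewrite hf_sym Re_conjc. Qed.

Definition hnorm x : R := Num.sqrt (Re (B x x)).

Lemma hnorm_ge0 x : 0 <= hnorm x. Proof. exact: sqrtr_ge0. Qed.

Lemma hnorm_sqr x : hnorm x ^+ 2 = Re (B x x).
Proof. by rewrite sqr_sqrtr ?hf_ge0. Qed.

Lemma hfxx x : B x x = (hnorm x ^+ 2)%:C.
Proof. by apply: complex_ext; rewrite ?Im_hfxx ?hnorm_sqr. Qed.

Lemma hnormZ a x : hnorm (a *: x) = normc a * hnorm x.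
Proof.
apply/eqP; rewrite -(@eqrXn2 _ 2)// ?mulr_ge0 ?normc_ge0 ?hnorm_ge0//.
rewrite exprMn !hnorm_sqr hfZl hfZr mulrA mulc_conj.
by rewrite ReM_real.
Qed.

Lemma hnorm0 : hnorm 0 = 0.
Proof. by rewrite /hnorm hf0r sqrtr0. Qed.

Lemma hnormN x : hnorm (- x) = hnorm x.
Proof. by rewrite /hnorm hfNr hfNl opprK. Qed.

Lemma hnormB x y : hnorm (x - y) = hnorm (y - x).
Proof. by rewrite -hnormN opprB. Qed.

Lemma hnormD_sqr x y :
  hnorm (x + y) ^+ 2 = hnorm x ^+ 2 + 2 * Re (B x y) + hnorm y ^+ 2.
Proof.
rewrite !hnorm_sqr hfDl !hfDr !ReD (Re_hf_sym y x).
by ring.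
Qed.

Lemma hnormB_sqr x y :
  hnorm (x - y) ^+ 2 = hnorm x ^+ 2 - 2 * Re (B x y) + hnorm y ^+ 2.
Proof. by rewrite hnormD_sqr hnormN hfNr ReN mulrN. Qed.

Lemma Re_cauchy_schwarz_sqr x y : Re (B x y) ^+ 2 <= hnorm x ^+ 2 * hnorm y ^+ 2.
Proof.
have key (t : R) : 0 <= hnorm x ^+ 2 + 2 * t * Re (B x y) + t ^+ 2 * hnorm y ^+ 2.
  have := sqr_ge0 (hnorm (x + t%:C *: y)).
  rewrite hnormD_sqr hfZr ReM_real hnormZ normcR exprMn real_normK ?num_real//.
  by rewrite mulrA.
set a := hnorm x ^+ 2 in key *; set b := Re _ in key *.
set c := hnorm y ^+ 2 in key *.
have c0 : 0 <= c by exact: sqr_ge0.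
have a0 : 0 <= a by exact: sqr_ge0.
have [c00|cn0] := eqVneq c 0.
  have [->|b0] := eqVneq b 0; first by rewrite expr0n mulr_ge0.
  (* At this t the polynomial, affine since c = 0, takes the value -1. *)
  have := key (- (a + 1) / (2 * b)); rewrite c00 mulr0 addr0.
  have -> : 2 * (- (a + 1) / (2 * b)) * b = - (a + 1) by field.
  by lra.
have := key (- b / c).
have -> : a + 2 * (- b / c) * b + (- b / c) ^+ 2 * c = (a * c - b ^+ 2) / c.
  by field.
by rewrite pmulr_lge0 ?invr_gt0 ?lt_neqAle 1?eq_sym ?cn0// subr_ge0.
Qed.

Lemma Re_cauchy_schwarz x y : `|Re (B x y)| <= hnorm x * hnorm y.
Proof.
rewrite -(@ler_pXn2r _ 2)// ?nnegrE ?mulr_ge0 ?hnorm_ge0//.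
by rewrite exprMn real_normK ?num_real// Re_cauchy_schwarz_sqr.
Qed.

(** The inequality for real parts, applied to y multiplied by the conjugate of B x y, which makes
    the value of the form real. *)
Lemma cauchy_schwarz x y : normc (B x y) <= hnorm x * hnorm y.
Proof.
have [->|n0] := eqVneq (normc (B x y)) 0.
  by rewrite mulr_ge0 ?hnorm_ge0.
have np : 0 < normc (B x y) by rewrite lt_neqAle eq_sym n0 normc_ge0.
have := Re_cauchy_schwarz x ((B x y)^* *: y).
rewrite hfZr mulc_conj /= hnormZ normc_conj ger0_norm ?sqr_ge0//.
by rewrite expr2 mulrCA ler_pM2l.
Qed.

Lemma hnorm_triangle x y : hnorm (x + y) <= hnorm x + hnorm y.
Proof.
rewrite -(@ler_pXn2r _ 2)// ?nnegrE ?addr_ge0 ?hnorm_ge0//.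
have := Re_cauchy_schwarz x y; rewrite ler_norml => /andP[_ h].
by rewrite hnormD_sqr sqrrD; lra.
Qed.

Lemma hnorm_triangleB x y z : hnorm (x - z) <= hnorm (x - y) + hnorm (y - z).
Proof. by apply: le_trans (hnorm_triangle _ _); rewrite addrA subrK. Qed.

Lemma hnorm_sum (I : Type) (r : seq I) (P : pred I) (f : I -> E) :
  hnorm (\sum_(i <- r | P i) f i) <= \sum_(i <- r | P i) hnorm (f i).
Proof.
elim/big_ind2 : _ => [|x1 x2 y1 y2 h1 h2|//]; first by rewrite hnorm0.
by apply: le_trans (hnorm_triangle _ _) _; exact: lerD.
Qed.

Definition hlim (u : nat -> E) x :=
  forall e : R, 0 < e -> exists N, forall n, (N <= n)%N -> hnorm (u n - x) < e.

Definition hcauchy (u : nat -> E) :=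
  forall e : R, 0 < e -> exists N, forall m n, (N <= m)%N -> (N <= n)%N ->
    hnorm (u m - u n) < e.

Definition hcomplete (S : set E) :=
  forall u, (forall n, S (u n)) -> hcauchy u -> exists2 x, S x & hlim u x.

Lemma hlim_cauchy u x : hlim u x -> hcauchy u.
Proof.
move=> h e e0; have [|N hN] := h (e / 2); first by lra.
exists N => m n hm hn; have h1 := hN _ hm; have h2 := hN _ hn.
have := hnorm_triangleB (u m) x (u n); rewrite (hnormB x).
by lra.
Qed.

Lemma le_eps (a b : R) : (forall e : R, 0 < e -> a <= b + e) -> a <= b.
Proof. by move=> h; apply/ler_addgt0Pr. Qed.

Lemma natS_inv_lt (e : R) : 0 < e ->
  exists N, forall n, (N <= n)%N -> n.+1%:R^-1 < e.
Proof.
move=> e0; have [N _ hN] := near_infty_natSinv_lt (PosNum e0).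
by exists N => n /hN.
Qed.

(** S is stable under real multiples only, because it is to be a real subspace such as H_R;
    orthogonality is then that of real parts. For complex subspaces the imaginary part follows by
    testing against ['i *: s]. *)
Lemma orthogonal_projection (S : set E) x : S 0 ->
  (forall y z, S y -> S z -> S (y + z)) ->
  (forall (r : R) y, S y -> S (r%:C *: y)) ->
  hcomplete S ->
  exists2 p, S p & forall s, S s -> Re (B (x - p) s) = 0.
Proof.
move=> S0 SD SZ Sc.
pose D := [set hnorm (x - s) ^+ 2 | s in S].
have Dlb : lbound D 0 by move=> _ [s _ <-]; exact: sqr_ge0.
have Di : has_inf D by split; [exists (hnorm (x - 0) ^+ 2); exists 0|exists 0].
set m := inf D.
have mle s : S s -> m <= hnorm (x - s) ^+ 2.
  by move=> Ss; apply: ge_inf; [exists 0|exists s].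
have : forall n : nat, exists s, S s /\ hnorm (x - s) ^+ 2 < m + n.+1%:R^-1.
  move=> n; have [] := @inf_adherent _ D n.+1%:R^-1; rewrite ?invr_gt0//.
  by move=> _ [s Ss <-] h; exists s.
move=> /choice[u hu].
have Su n : S (u n) by case: (hu n).
have ux n : hnorm (x - u n) ^+ 2 < m + n.+1%:R^-1 by case: (hu n).
(* Parallelogram law: half the sum of two near-minimizers is again in S, hence at squared distance
   at least m from x. *)
have par i j : hnorm (u i - u j) ^+ 2 <= 2 * (i.+1%:R^-1 + j.+1%:R^-1).
  have h := mle _ (SZ 2^-1 _ (SD _ _ (Su i) (Su j))).
  have e : x - (2^-1)%:C *: (u i + u j)
      = (2^-1)%:C *: ((x - u i) + (x - u j)).
    rewrite addrACA -opprD scalerBr; congr (_ - _).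
    rewrite scalerDr -scalerDl -rmorphD /= (_ : 2^-1 + 2^-1 = 1) ?scale1r//.
    by field.
  rewrite e hnormZ normcR exprMn real_normK ?num_real// in h.
  have e2 : u i - u j = (x - u j) - (x - u i).
    by rewrite opprB [RHS]addrC subrKA.
  have hi := ux i; have hj := ux j.
  rewrite hnormD_sqr in h.
  rewrite e2 hnormB_sqr (Re_hf_sym (x - u j)).
  move: (i.+1%:R^-1) (j.+1%:R^-1) hi hj => a b hi hj; lra.
have [p Sp up] : exists2 p, S p & hlim u p.
  apply: Sc => // e e0.
  have [N hN] := natS_inv_lt (divr_gt0 (exprn_gt0 2 e0) (ltr0Sn _ 3)).
  exists N => i j hi hj.
  rewrite -(@ltr_pXn2r _ 2)// ?nnegrE ?hnorm_ge0 ?ltW//.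
  have := hN _ hi; have := hN _ hj; have := par i j.
  by move: (i.+1%:R^-1) (j.+1%:R^-1) => a b; lra.
exists p => // s Ss.
set b := Re (B (x - p) s).
(* Minimality of m, tested at u n + t s; the errors |x - u n|^2 - m and |u n - p| are absorbed in
   e. *)
have key (t : R) : 2 * t * b <= t ^+ 2 * hnorm s ^+ 2.
  apply: le_eps => e e0.
  have e1 : 0 < e / 2 / (2 * `|t| * hnorm s + 1).
    rewrite divr_gt0 ?divr_gt0// ltr_wpDl// !mulr_ge0 ?hnorm_ge0//.
  have [N1 hN1] := up _ e1.
  have [N2 hN2] := natS_inv_lt (divr_gt0 e0 (ltr0Sn _ 1)).
  have hn1 := hN1 _ (leq_maxl N1 N2); have hn2 := hN2 _ (leq_maxr N1 N2).
  set n := maxn N1 N2 in hn1 hn2.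
  have h := mle _ (SD _ _ (Su n) (SZ t _ Ss)).
  rewrite opprD addrA hnormB_sqr hfZr ReM_real hnormZ normcR exprMn in h.
  rewrite real_normK ?num_real// in h.
  have hb : `|Re (B (x - u n) s) - b| <= hnorm (u n - p) * hnorm s.
    rewrite /b -ReB -hfBl opprB addrC subrKA hnormB.
    exact: Re_cauchy_schwarz.
  have h3 : 2 * `|t| * `|Re (B (x - u n) s) - b| <= e / 2.
    apply: (@le_trans _ _ (2 * `|t| * (hnorm (u n - p) * hnorm s))).
      by rewrite ler_wpM2l ?mulr_ge0.
    rewrite mulrCA.
    have : hnorm (u n - p) * (2 * `|t| * hnorm s + 1) <= e / 2.
      by rewrite -ler_pdivlMr ?ltW// ltr_wpDl// !mulr_ge0 ?hnorm_ge0.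
    by apply: le_trans; rewrite ler_wpM2l ?hnorm_ge0// lerDl.
  have h4 : t * (b - Re (B (x - u n) s)) <= `|t| * `|Re (B (x - u n) s) - b|.
    by rewrite -normrM -normrN -mulrN opprB; exact: ler_norm.
  by have := ux n; move: (n.+1%:R^-1) hn2 => a hn2; lra.
apply/eqP; case: (eqVneq b 0) => // b0.
(* Up to the factor b^2 / (c + 1)^2, the inequality reads 2 (c + 1) <= c for c = |s|^2; the
   denominator is c + 1 because s may be null. *)
have := key (b / (hnorm s ^+ 2 + 1)).
set c := hnorm s ^+ 2.
have c0 : 0 <= c by exact: sqr_ge0.
have b2 : 0 < b ^+ 2 by rewrite exprn_even_gt0.
rewrite [X in X <= _](_ : _ = b ^+ 2 * (2 * (c + 1)) / (c + 1) ^+ 2); last first.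
  by field; lra.
rewrite [X in _ <= X](_ : _ = b ^+ 2 * c / (c + 1) ^+ 2); last by field; lra.
by rewrite ler_pM2r ?invr_gt0 ?exprn_gt0 ?ltr_wpDl// ler_pM2l//; lra.
Qed.

End Form.
End HermitianForms.

(** * Bounded operators between Hilbert spaces: extension by density, Riesz, adjoints *)

Section HilbertForm.
Context {R : realType}.
Local Notation C := R[i].
Implicit Types F G H : complexHilbert R.

Lemma ip_linear F (x : F) (a : C) (u v : F) :
  ip x (a *: u + v) = a * ip x u + ip x v.
Proof. by rewrite /ip linearPl. Qed.

Lemma ip_conj F (x y : F) : ip y x = (ip x y)^*.
Proof. by rewrite /ip (hermC (hilbert_form F)) /= expr0 mul1r. Qed.

Lemma ipxx F (x : F) : ip x x = `|x| ^+ 2.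
Proof. exact: hilbert_formE. Qed.

Lemma Re_ip_ge0 F (x : F) : 0 <= complex.Re (ip x x).
Proof.
have : 0 <= ip x x by rewrite ipxx exprn_ge0.
by move=> /complex_ge0P[].
Qed.

Definition ip_form F : hform F := HForm (@ip_linear F) (@ip_conj F) (@Re_ip_ge0 F).
Canonical ip_form.

Local Notation nrm := (hnorm (ip_form _)).

Lemma normE F (x : F) : `|x| = (nrm x)%:C.
Proof.
apply/eqP; rewrite -(@eqrXn2 _ 2)//; last first.
  by rewrite ler0c hnorm_ge0.
by rewrite -ipxx -rmorphXn /= -hfxx.
Qed.

Lemma nrm_eq0 F (x : F) : nrm x = 0 -> x = 0.
Proof. by move=> h; apply: normr0_eq0; rewrite normE h. Qed.

Lemma norm_ltE F (x : F) (e : R) : (`|x| < e%:C) = (nrm x < e).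
Proof. by rewrite normE ltcR. Qed.

Lemma complex_gt0P (z : C) : 0 < z -> exists2 r : R, 0 < r & z = r%:C.
Proof.
move=> z0; exists (complex.Re z); last exact/real_of_ge0/ltW.
by move: z0; rewrite ltcE => /andP[].
Qed.

Lemma ip_ext F (x y : F) : (forall z, ip z x = ip z y) -> x = y.
Proof.
move=> h; apply/eqP; rewrite -subr_eq0; apply/eqP/nrm_eq0.
by rewrite /hnorm hfBr /= h subrr sqrtr0.
Qed.

Lemma hilbert_complete F : hcomplete (ip_form F) setT.
Proof.
move=> u _ uc.
have cv : cvg (u @ \oo).
  apply: cauchy_cvg; apply/cauchy_ballP => e /complex_gt0P[r r0 ->].
  have [N hN] := uc _ r0.
  exists ([set u n | n in [set n | (N <= n)%N]], [set u n | n in [set n | (N <= n)%N]]).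
    by split; exists N => // n /= hn; exists n.
  move=> [_ _] [[m hm <-] [n hn <-]] /=.
  by rewrite -ball_normE /ball_ /= norm_ltE; exact: hN.
exists (lim (u @ \oo)) => // e e0.
have [|N _ hN] := (cvgrPdist_lt _ _).1 cv e%:C; first by rewrite ltcR.
exists N => n hn; have := hN n hn; rewrite /= norm_ltE.
by rewrite hnormB.
Qed.

Lemma dense_approx F (S : set F) : dense S ->
  forall x (e : R), 0 < e -> exists2 y, S y & nrm (x - y) < e.
Proof.
move=> Sd x e e0.
have [|y []] := Sd (ball x e%:C) _ (ball_open _ _).
- by exists x; apply: ballxx; rewrite ltcR.
- by rewrite -ball_normE /= norm_ltE => ? ?; exists y.
Qed.

Section LinearMaps.
Context {E E' : lmodType C}.
Variable f : E -> E'.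
Hypothesis fl : linear f.

Lemma lin0 : f 0 = 0.
Proof.
have := fl 1 0 0; rewrite !scale1r !addr0 => h.
by apply: (addrI (f 0)); rewrite addr0.
Qed.

Lemma linD u v : f (u + v) = f u + f v.
Proof. by have := fl 1 u v; rewrite !scale1r. Qed.

Lemma linZ a u : f (a *: u) = a *: f u.
Proof. by have := fl a u 0; rewrite !addr0 lin0 addr0. Qed.

Lemma linN u : f (- u) = - f u.
Proof. by rewrite -scaleN1r linZ scaleN1r. Qed.

Lemma linB u v : f (u - v) = f u - f v.
Proof. by rewrite linD linN. Qed.

Lemma lin_sum (I : Type) (r : seq I) (P : pred I) (g : I -> E) :
  f (\sum_(i <- r | P i) g i) = \sum_(i <- r | P i) f (g i).
Proof. by apply: big_morph; [exact: linD|exact: lin0]. Qed.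

End LinearMaps.

Lemma lin_comp (E E' E'' : lmodType C) (f : E' -> E'') (g : E -> E') :
  linear f -> linear g -> linear (f \o g).
Proof. by move=> fl gl a u v; rewrite /= gl fl. Qed.

Definition bounded_by F G (K : R) (f : F -> G) :=
  linear f /\ forall u, nrm (f u) <= K * nrm u.

Definition bounded F G (f : F -> G) := exists2 K, 0 <= K & bounded_by K f.

Lemma bounded_lin F G (f : F -> G) : bounded f -> linear f.
Proof. by case=> K _ []. Qed.

Lemma bounded_opP F (f : F -> F) : bounded_op f <-> bounded f.
Proof.
split=> [[fl fc]|[K K0 [fl fK]]]; last first.
  split=> // x; apply/(@cvgrPdist_lt _ _ _ (nbhs x)) => e /complex_gt0P[r r0 ->].
  (* K may vanish, so epsilon is divided by K + 1, here and in the later estimates; [ler_mulD1]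
     absorbs the difference. *)
  have K1 : 0 < K + 1 by rewrite ltr_wpDl.
  apply/nbhs_ballP; exists (r / (K + 1))%:C; first by rewrite /= ltcR divr_gt0.
  move=> y; rewrite -ball_normE /ball_ /= !norm_ltE -(linB fl) => h.
  apply: le_lt_trans (fK _) _; apply: le_lt_trans (ler_mulD1 _ (hnorm_ge0 _ _)) _.
  by rewrite mulrC -ltr_pdivlMr.
have := (@cvgrPdist_lt _ _ _ (nbhs (0 : F)) (nbhs_filter (0 : F)) f (f 0)).1 (fc 0) 1 ltr01.
move=> /nbhs_ballP[e /complex_gt0P[r r0 ->]] h.
(* Continuity at 0 gives |f v| < 1 for |v| < r; u is rescaled to the norm r / 2. *)
exists (2 / r); first by rewrite divr_ge0 ?ltW.
split=> // u; have [->|u0] := eqVneq u 0.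
  by rewrite (lin0 fl) !hnorm0 mulr0.
have nu : 0 < nrm u.
  by rewrite lt_neqAle hnorm_ge0 andbT eq_sym; apply/eqP => /nrm_eq0/eqP; apply/negP.
set c := r / 2 / nrm u; have c0 : 0 < c by rewrite !divr_gt0.
have cu : c * nrm u = r / 2 by rewrite /c divfK ?gt_eqF.
have := h (c%:C *: u).
rewrite -ball_normE /ball_ /= sub0r normrN norm_ltE hnormZ normcR gtr0_norm//.
rewrite cu; have r2 : r / 2 < r by lra.
move=> /(_ r2); rewrite (lin0 fl) sub0r normrN linZ// -[1]/(1%:C) norm_ltE.
rewrite hnormZ normcR gtr0_norm// -ltr_pdivlMl// mulr1 => /ltW h2.
apply: le_trans h2 _; rewrite -(@ler_pM2l _ c)// mulfV ?gt_eqF//.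
by rewrite mulrCA [X in _ * X]cu (_ : 2 / r * (r / 2) = 1)//; field; rewrite gt_eqF.
Qed.

Lemma bounded_id F : bounded (@idfun F).
Proof. by exists 1 => //; split => // u; rewrite mul1r. Qed.

Lemma bounded_comp F G H (f : G -> H) (g : F -> G) :
  bounded f -> bounded g -> bounded (f \o g).
Proof.
move=> [K K0 [fl fK]] [L L0 [gl gL]]; exists (K * L); first exact: mulr_ge0.
split; first exact: lin_comp.
by move=> u /=; apply: le_trans (fK _) _; rewrite -mulrA ler_wpM2l.
Qed.

Lemma bounded_add F G (f g : F -> G) :
  bounded f -> bounded g -> bounded (fun u => f u + g u).
Proof.
move=> [K K0 [fl fK]] [L L0 [gl gL]]; exists (K + L); first exact: addr_ge0.
split; first by move=> a u v; rewrite fl gl scalerDr addrACA.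
move=> u; apply: le_trans (hnorm_triangle _ _ _) _.
by rewrite mulrDl lerD ?fK ?gL.
Qed.

Lemma bounded_scale F G (f : F -> G) (a : C) :
  bounded f -> bounded (fun u => a *: f u).
Proof.
move=> [K K0 [fl fK]]; exists (normc a * K); first by rewrite mulr_ge0 ?normc_ge0.
split; first by move=> b u v; rewrite fl scalerDr !scalerA mulrC.
by move=> u; rewrite hnormZ -mulrA ler_wpM2l ?normc_ge0 ?fK.
Qed.

(** Kept as a list of coefficients and indices, so that one combination can be evaluated on two
    families: [extension] compares the two values without any linear independence. *)
Definition comb (I : Type) (E : lmodType C) (t : I -> E) (l : seq (C * I)) : E :=
  \sum_(p <- l) p.1 *: t p.2.

Definition total (I : Type) F (t : I -> F) :=
  forall x (e : R), 0 < e -> exists l, nrm (x - comb t l) < e.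

Section Combinations.
Context {I : Type} {E : lmodType C}.
Variable t : I -> E.

Lemma comb_nil : comb t [::] = 0. Proof. exact: big_nil. Qed.

Lemma comb_cons a i l : comb t ((a, i) :: l) = a *: t i + comb t l.
Proof. exact: big_cons. Qed.

Lemma comb_cat l l' : comb t (l ++ l') = comb t l + comb t l'.
Proof. exact: big_cat. Qed.

Lemma comb_scale a l : comb t [seq (a * p.1, p.2) | p <- l] = a *: comb t l.
Proof.
rewrite /comb big_map scaler_sumr; apply: eq_bigr => p _.
by rewrite scalerA.
Qed.

Lemma comb1 i : comb t [:: (1, i)] = t i.
Proof. by rewrite comb_cons comb_nil scale1r addr0. Qed.

Lemma lin_comb (E' : lmodType C) (f : E -> E') l :
  linear f -> f (comb t l) = comb (f \o t) l.
Proof. by move=> fl; rewrite /comb lin_sum//; apply: eq_bigr => p _; rewrite linZ. Qed.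

End Combinations.

Lemma eq0_of_le_eps (a : R) : 0 <= a -> (forall e : R, 0 < e -> a <= e) -> a = 0.
Proof.
move=> a0 h; apply/eqP; rewrite eq_le a0 andbT.
by apply: le_eps => e /h; rewrite add0r.
Qed.

Section Extension.
Context {I : Type} {F G : complexHilbert R}.
Variables (t : I -> F) (s : I -> G) (K : R).
Hypotheses (tt : total t) (K0 : 0 <= K).
Hypothesis st : forall l, nrm (comb s l) <= K * nrm (comb t l).

(** The closure of the graph of comb t l |-> comb s l. The bound [st] makes it single-valued, and
    completeness of G makes it everywhere defined. *)
Let rel u v := forall e : R, 0 < e ->
  exists l, nrm (u - comb t l) < e /\ nrm (v - comb s l) < e.

Let rel_bound u v : rel u v -> nrm v <= K * nrm u.
Proof.
move=> h; apply: le_eps => e e0.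
have K1 : 0 < K + 1 by rewrite ltr_wpDl.
have [l [h1 h2]] := h _ (divr_gt0 e0 K1).
have dE : e / (K + 1) * (K + 1) = e by rewrite divfK ?gt_eqF.
have h3 := hnorm_triangleB (ip_form _) v (comb s l) 0; rewrite !subr0 in h3.
have h4 := hnorm_triangleB (ip_form _) (comb t l) u 0; rewrite !subr0 hnormB in h4.
have h5 := ler_wpM2l K0 h4; have h6 := ler_wpM2l K0 (ltW h1).
have := st l. by move: (e / (K + 1)) dE h1 h2 h3 h4 h5 h6 => d dE; lra.
Qed.

Let rel_linear a u v u' v' : rel u v -> rel u' v' -> rel (a *: u + u') (a *: v + v').
Proof.
move=> h h' e e0.
have A0 : 0 < normc a + 1 by rewrite ltr_wpDl ?normc_ge0.
have [l [h1 h2]] := h _ (divr_gt0 e0 (mulr_gt0 (ltr0Sn _ 1) A0)).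
have [|l' [h1' h2']] := h' (e / 2); first by lra.
exists ([seq (a * p.1, p.2) | p <- l] ++ l').
have est (F' : complexHilbert R) (x y x' y' : F') :
    nrm (x - y) < e / (2 * (normc a + 1)) -> nrm (x' - y') < e / 2 ->
    nrm (a *: x + x' - (a *: y + y')) < e.
  rewrite opprD addrACA -scalerBr => k1 k2.
  apply: le_lt_trans (hnorm_triangle _ _ _) _; rewrite hnormZ.
  have : normc a * nrm (x - y) <= e / 2.
    apply: le_trans (ler_mulD1 _ (hnorm_ge0 _ _)) _.
    rewrite mulrC -ler_pdivlMr//; apply: le_trans (ltW k1) _.
    by rewrite invfM mulrA.
  by lra.
by rewrite !comb_cat !comb_scale; split; apply: est.
Qed.

Let rel_ex u : exists v, rel u v.
Proof.
have /choice[l hl] : forall n : nat, exists l, nrm (u - comb t l) < n.+1%:R^-1.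
  by move=> n; apply: tt; rewrite invr_gt0.
have near (e : R) : 0 < e -> exists N, forall n, (N <= n)%N ->
    nrm (u - comb t (l n)) < e.
  move=> e0; have [N hN] := natS_inv_lt e0.
  by exists N => n /hN; exact: lt_trans (hl n).
have [|v _ hv] := @hilbert_complete G (fun n => comb s (l n)) (fun=> Logic.I).
  move=> e e0.
  have K1 : 0 < K + 1 by rewrite ltr_wpDl.
  have [|N hN] := near (e / 2 / (K + 1)); first by rewrite !divr_gt0.
  exists N => m n hm hn.
  have -> : comb s (l m) - comb s (l n)
      = comb s (l m ++ [seq (-1 * p.1, p.2) | p <- l n]).
    by rewrite comb_cat comb_scale scaleN1r.
  apply: le_lt_trans (st _) _; rewrite comb_cat comb_scale scaleN1r.
  have h := hnorm_triangleB (ip_form _) (comb t (l m)) u (comb t (l n)).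
  rewrite (hnormB _ (comb t (l m)) u) in h.
  have h1 := hN _ hm; have h2 := hN _ hn.
  apply: (@le_lt_trans _ _ (K * (nrm (u - comb t (l m)) + nrm (u - comb t (l n))))).
    by rewrite ler_wpM2l.
  have dE : e / 2 / (K + 1) * (K + 1) = e / 2 by rewrite divfK ?gt_eqF.
  have h3 := ler_wpM2l K0 (ltW h1); have h4 := ler_wpM2l K0 (ltW h2).
  have d0 : 0 < e / 2 / (K + 1) by rewrite !divr_gt0.
  by rewrite mulrDr; move: (e / 2 / (K + 1)) dE d0 h3 h4 => d dE; lra.
exists v => e e0; have [N hN] := near _ e0; have [M hM] := hv _ e0.
exists (l (maxn N M)); split; first exact/hN/leq_maxl.
by rewrite hnormB; exact/hM/leq_maxr.
Qed.

Let rel_fun u v v' : rel u v -> rel u v' -> v = v'.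
Proof.
move=> h h'; have := rel_linear (-1) h h'; rewrite !scaleN1r addNr.
move=> /rel_bound; rewrite hnorm0 mulr0 => h0.
apply/eqP; rewrite eq_sym -subr_eq0 addrC; apply/eqP/nrm_eq0.
by apply/eqP; rewrite eq_le h0 hnorm_ge0.
Qed.

Lemma extension : exists2 f : F -> G, bounded_by K f & forall i, f (t i) = s i.
Proof.
have [f hf] := choice rel_ex.
exists f; last first.
  move=> i; apply: (rel_fun (hf _)) => e e0; exists [:: (1, i)].
  by rewrite !comb1 !subrr !hnorm0.
split; last by move=> u; exact: rel_bound.
by move=> a u v; apply: (rel_fun (hf _)); exact: rel_linear.
Qed.

End Extension.

Lemma total_orth (I : Type) F (t : I -> F) y :
  total t -> (forall i, ip (t i) y = 0) -> y = 0.
Proof.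
move=> tt h; apply: nrm_eq0; apply: eq0_of_le_eps (hnorm_ge0 _ _) _ => e e0.
have [l hl] := tt y e e0.
have [->|y0] := eqVneq (nrm y) 0; first exact: ltW.
have yp : 0 < nrm y by rewrite lt_neqAle eq_sym y0 hnorm_ge0.
have o : ip (comb t l) y = 0.
  by rewrite hf_suml big1// => p _; rewrite hfZl /= h mulr0.
have := Re_cauchy_schwarz (ip_form F) (y - comb t l) y.
rewrite hfBl /= o subr0 -[ip y y]/(ip_form F y y) -hnorm_sqr.
rewrite ger0_norm ?sqr_ge0// expr2 ler_pM2r// => k.
by apply: le_trans k _; exact: ltW.
Qed.

Lemma bounded_by_eq_on (I : Type) F G (t : I -> F) (f g : F -> G) :
  total t -> bounded f -> bounded g -> (forall i, f (t i) = g (t i)) -> f =1 g.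
Proof.
move=> tt bf bg fg u.
have [K K0 [dl dK]] : bounded (fun u => f u + -1 *: g u).
  exact/bounded_add/bounded_scale.
apply/eqP; rewrite -subr_eq0 -scaleN1r; apply/eqP/nrm_eq0.
apply: eq0_of_le_eps (hnorm_ge0 _ _) _ => e e0.
have K1 : 0 < K + 1 by rewrite ltr_wpDl.
have [l hl] := tt u _ (divr_gt0 e0 K1).
have z : f (comb t l) + -1 *: g (comb t l) = 0.
  rewrite (lin_comb _ _ dl) /comb big1// => p _ /=.
  by rewrite fg scaleN1r subrr scaler0.
have := dK (u - comb t l); rewrite (linB dl) z subr0 => /le_trans; apply.
apply: le_trans (ler_mulD1 _ (hnorm_ge0 _ _)) _.
by rewrite mulrC -ler_pdivlMr// ltW.
Qed.

Definition adjoint F G (f : F -> G) (g : G -> F) :=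
  forall u v, ip (f u) v = ip u (g v).

Lemma adjoint_sym F G (f : F -> G) g : adjoint f g -> adjoint g f.
Proof. by move=> h u v; rewrite ip_conj -h -ip_conj. Qed.

(** The kernel of phi is closed. The component r of x orthogonal to it spans its orthogonal
    complement, since u - (phi u / phi r) r always lies in the kernel. *)
Lemma riesz F (phi : F -> C) (K : R) :
  (forall a u v, phi (a *: u + v) = a * phi u + phi v) ->
  (forall u, normc (phi u) <= K * nrm u) ->
  exists y, forall u, phi u = ip y u.
Proof.
move=> pl pK.
have p0 : phi 0 = 0.
  have := pl 1 0 0; rewrite scale1r mul1r !addr0 => h.
  by apply: (addrI (phi 0)); rewrite addr0.
have pZ a u : phi (a *: u) = a * phi u.
  by have := pl a u 0; rewrite !addr0 p0 addr0.
have pD u v : phi (u + v) = phi u + phi v.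
  by have := pl 1 u v; rewrite scale1r mul1r.
have [pz|] := pselect (forall u, phi u = 0).
  by exists 0 => u; rewrite pz [RHS]hf0l.
move=> /existsNP[x px].
have [] := @orthogonal_projection _ _ (ip_form F) [set u | phi u = 0] x.
- exact: p0.
- by move=> y z /= h h'; rewrite pD h h' addr0.
- by move=> r y /= h; rewrite pZ h mulr0.
- move=> u Su uc; have [y _ uy] := hilbert_complete (fun=> Logic.I) uc.
  exists y => //=; apply: Normc.eq0_normc.
  apply: eq0_of_le_eps (normc_ge0 _) _ => e e0.
  have [K0|K0] := leP K 0.
    apply: le_trans (pK _) _; apply: le_trans (ltW e0).
    by rewrite mulr_le0_ge0 ?hnorm_ge0.
  have [N hN] := uy _ (divr_gt0 e0 K0).
  have := hN N (leqnn N); rewrite hnormB => h.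
  have -> : phi y = phi (y - u N) by rewrite -scaleN1r addrC pl Su mulr0 add0r.
  by apply: le_trans (pK _) _; rewrite mulrC -ler_pdivlMr// ltW.
move=> p /= pp orth; set r := x - p in orth.
have pr : phi r = phi x by rewrite /r -scaleN1r addrC pl pp mulr0 add0r.
have orthC s : phi s = 0 -> ip r s = 0.
  move=> s0; apply: complex_ext; first exact: orth.
  have /orth : phi ('i *: s) = 0 by rewrite pZ s0 mulr0.
  by rewrite hfZr Re_iM => /eqP; rewrite oppr_eq0 => /eqP.
have r0 : nrm r != 0.
  apply/eqP => /nrm_eq0 h; apply: px; rewrite -pr h; exact: p0.
have pr0 : phi r != 0 by rewrite pr; apply/eqP.
have rr : ip r r = (nrm r ^+ 2)%:C by exact: (hfxx (ip_form F)).
have rr0 : ip r r != 0.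
  by rewrite rr (inj_eq (@complexI R) _ 0) expf_neq0.
exists ((phi r / ip r r)^* *: r) => u.
have h : ip r (u - (phi u / phi r) *: r) = 0.
  by apply: orthC; rewrite -scaleN1r scalerA addrC pl mulN1r mulNr divfK// addNr.
move: h; rewrite hfBr hfZr /= => /eqP; rewrite subr_eq0 => /eqP h.
rewrite (hfZl (ip_form F)) conjcK -[ip_form F r u]/(ip r u) h.
by field; rewrite pr0 rr0.
Qed.

Lemma adjoint_exists F G (f : F -> G) : bounded f -> exists g, adjoint f g.
Proof.
move=> [K K0 [fl fK]].
have : forall v, exists w, forall u, ip v (f u) = ip w u.
  move=> v; apply: (@riesz F (fun u => ip v (f u)) (nrm v * K)).
    by move=> a u u'; rewrite fl hfDr hfZr.
  move=> u; apply: le_trans (cauchy_schwarz (ip_form G) v (f u)) _.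
  by rewrite -mulrA ler_wpM2l ?hnorm_ge0.
move=> /choice[g hg]; exists g => u v.
by rewrite ip_conj hg -ip_conj.
Qed.

Lemma adjoint_bounded_by F G (f : F -> G) g K :
  0 <= K -> bounded_by K f -> adjoint f g -> bounded_by K g.
Proof.
move=> K0 [fl fK] fg; split.
  move=> a u v; apply: ip_ext => z.
  by rewrite -fg !hfDr !hfZr /= -!fg.
move=> v; have [->|n0] := eqVneq (nrm (g v)) 0; first by rewrite mulr_ge0 ?hnorm_ge0.
have np : 0 < nrm (g v) by rewrite lt_neqAle eq_sym n0 hnorm_ge0.
have := Re_cauchy_schwarz (ip_form G) (f (g v)) v.
rewrite /= fg -[ip (g v) (g v)]/(ip_form F _ _) -hnorm_sqr ger0_norm ?sqr_ge0//.
move=> h; rewrite -(@ler_pM2l _ (nrm (g v)))// -expr2; apply: le_trans h _.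
by rewrite mulrCA mulrA ler_wpM2r ?hnorm_ge0// fK.
Qed.

Lemma adjoint_bounded F G (f : F -> G) g : bounded f -> adjoint f g -> bounded g.
Proof. by move=> [K K0 bf] fg; exists K => //; exact: adjoint_bounded_by bf fg. Qed.

Lemma adjoint_uniq F G (f : F -> G) g g' : adjoint f g -> adjoint f g' -> g = g'.
Proof. by move=> h h'; apply/funext => v; apply: ip_ext => u; rewrite -h -h'. Qed.

Lemma adjoint_comp F G H (f : G -> H) f' (g : F -> G) g' :
  adjoint f f' -> adjoint g g' -> adjoint (f \o g) (g' \o f').
Proof. by move=> h h' u v; rewrite /= h h'. Qed.

End HilbertForm.

Notation nrm := (hnorm (ip_form _)).

(** * The Hilbert space of a complete definite form *)

Section HilbertOfForm.
Context {R : realType}.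
Local Notation C := R[i].
Context {V : lmodType C}.
Variable D : hform V.
Hypothesis D_pos : forall x, hnorm D x = 0 -> x = 0.
Hypothesis D_complete : hcomplete D setT.

(** The two properties are arguments of the type, so that the instances declared on it, which rely
    on them, can be found from the type alone. *)
Definition normed_of_form (_ : forall x, hnorm D x = 0 -> x = 0)
  (_ : hcomplete D setT) : Type := V.
Local Notation W := (normed_of_form D_pos D_complete).

HB.instance Definition _ := GRing.Lmodule.on W.

Let wnorm (x : W) : C := (hnorm D x)%:C.

Let wnormD (x y : W) : wnorm (x + y) <= wnorm x + wnorm y.
Proof. by rewrite /wnorm -rmorphD lecR; exact: hnorm_triangle. Qed.

Let wnormZ (a : C) (x : W) : wnorm (a *: x) = `|a| * wnorm x.
Proof. by rewrite /wnorm hnormZ rmorphM /=; case: a. Qed.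

Let wnorm0 (x : W) : wnorm x = 0 -> x = 0.
Proof. by move=> /complexI/D_pos. Qed.

HB.instance Definition _ := Lmodule_isNormed.Build C W wnormD wnormZ wnorm0.

Let wcomplete (F : set_system W) : ProperFilter F -> cauchy F -> cvg F.
Proof.
move=> FF /cauchy_ballP Fc.
have A0 (n : nat) : exists x, \forall y \near F, `|x - y| < (n.+1%:R^-1 : R)%:C.
  have /cauchy_ballP/cauchyP/(_ (n.+1%:R^-1 : R)%:C) := Fc.
  rewrite ltcR invr_gt0 ltr0Sn => /(_ isT)[x hx]; exists x.
  by rewrite -ball_normE in hx.
have [u hu] := choice A0.
have norm_ltE (x y : W) (e : R) : (`|x - y| < e%:C) = (hnorm D ((x : V) - y) < e).
  by rewrite -ltcR.
have uc : hcauchy D u.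
  move=> e e0; have [|N hN] := @natS_inv_lt R (e / 2); first by lra.
  exists N => m n hm hn.
  near F => y.
  have hmy : `|u m - y| < (m.+1%:R^-1 : R)%:C by near: y; exact: hu.
  have hny : `|u n - y| < (n.+1%:R^-1 : R)%:C by near: y; exact: hu.
  rewrite norm_ltE in hmy; rewrite norm_ltE in hny.
  have := hnorm_triangleB D (u m) y (u n); rewrite (hnormB D y).
  have := hN m hm; have := hN n hn.
  by move: (n.+1%:R^-1) (m.+1%:R^-1) hmy hny => a b; lra.
have [x _ ux] := D_complete (fun=> Logic.I) uc.
apply/cvg_ex; exists (x : W); apply/cvgrPdist_lt => e /complex_gt0P[r r0 ->].
have [|N hN] := ux (r / 2); first by lra.
have [|M hM] := @natS_inv_lt R (r / 2); first by lra.
have h1 := hN _ (leq_maxl N M); have h2 := hM _ (leq_maxr N M).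
near=> y.
have hy : `|u (maxn N M) - y| < ((maxn N M).+1%:R^-1 : R)%:C.
  by near: y; exact: hu.
rewrite norm_ltE in hy; rewrite norm_ltE.
have := hnorm_triangleB D x (u (maxn N M)) y.
rewrite (hnormB D x (u (maxn N M))).
by move: ((maxn N M).+1%:R^-1) h2 hy => a; lra.
Unshelve. all: by end_near. Qed.

HB.instance Definition _ := Uniform_isComplete.Build W wcomplete.

Definition form_op (x y : W) : C := D y x.

Let form_addl y : zmod_morphism (form_op^~ y).
Proof. by move=> x z; exact: hfBr. Qed.

Let form_addr x : zmod_morphism (form_op x).
Proof. by move=> y z; exact: hfBl. Qed.

Let form_scalel y : scalable_for *%R (form_op^~ y).
Proof. by move=> a x; exact: hfZr. Qed.

Let form_scaler x : scalable_for (conjc \; *%R) (form_op x).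
Proof. by move=> a y; exact: hfZl. Qed.

HB.instance Definition _ := isBilinear.Build C W W C ( *%R ) (conjc \; *%R) form_op
  form_addl form_addr form_scalel form_scaler.

Let form_herm (x y : W) : form_op x y = (-1) ^+ false * (form_op y x)^*.
Proof. by rewrite expr0 mul1r -hf_sym. Qed.

HB.instance Definition _ := isHermitianSesquilinear.Build C W false conjc form_op
  form_herm.

Let form_pos (x : W) : x != 0 -> 0 < form_op x x.
Proof.
move=> x0; rewrite /form_op hfxx -[0]/(0%:C) ltcR exprn_gt0// lt_neqAle hnorm_ge0.
by rewrite andbT eq_sym; apply/eqP => /D_pos/eqP; apply/negP.
Qed.

HB.instance Definition _ := isDotProduct.Build C W form_op form_pos.

Let form_opE (x : W) : form_op x x = `|x| ^+ 2.
Proof. by rewrite /form_op hfxx rmorphXn. Qed.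

Definition hilbert_of_form : complexHilbert R :=
  @Hilbert C conjc W form_op form_opE.

End HilbertOfForm.

(** * Completion of a space with a semidefinite form *)

Section Completion.
Context {R : realType}.
Local Notation C := R[i].

Definition clim (z : nat -> C) (l : C) :=
  forall e : R, 0 < e -> exists N, forall n, (N <= n)%N -> normc (z n - l) < e.

Lemma normc_distC (z w : C) : normc (z - w) = normc (w - z).
Proof.
by rewrite -opprB; case: (w - z) => a b /=; rewrite !sqrrN.
Qed.

Lemma normc_triangleB (x y z : C) : normc (x - z) <= normc (x - y) + normc (y - z).
Proof. by apply: le_trans (le_normcD _ _); rewrite addrA subrK. Qed.

Lemma clim_uniq z l l' : clim z l -> clim z l' -> l = l'.
Proof.
move=> h h'; apply/eqP; rewrite -subr_eq0; apply/eqP/eq0_normc.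
apply: eq0_of_le_eps (normc_ge0 _) _ => e e0.
have [|N hN] := h (e / 2); first by lra.
have [|M hM] := h' (e / 2); first by lra.
have := normc_triangleB l (z (maxn N M)) l'; rewrite (normc_distC l (z _)).
by have := hN _ (leq_maxl N M); have := hM _ (leq_maxr N M); lra.
Qed.

Lemma clim_cst l : clim (fun=> l) l.
Proof. by move=> e e0; exists 0 => n _; rewrite subrr normc0. Qed.

Lemma clim_lin (a : C) z z' l l' :
  clim z l -> clim z' l' -> clim (fun n => a * z n + z' n) (a * l + l').
Proof.
move=> h h' e e0; have A0 : 0 < normc a + 1 by rewrite ltr_wpDl ?normc_ge0.
have [|N hN] := h (e / 2 / (normc a + 1)); first by rewrite !divr_gt0.
have [|M hM] := h' (e / 2); first by lra.
exists (maxn N M) => n; rewrite geq_max => /andP[/hN h1 /hM h2].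
have -> : a * z n + z' n - (a * l + l') = a * (z n - l) + (z' n - l') by ring.
apply: le_lt_trans (le_normcD _ _) _; rewrite normcM.
rewrite ltr_pdivlMr// in h1.
have := normc_ge0 (z n - l); have := normc_ge0 a.
by move: (normc a) (normc (z n - l)) h1 => x y; nra.
Qed.

Lemma clim_conj z l : clim z l -> clim (fun n => (z n)^*) l^*.
Proof. by move=> h e /h[N hN]; exists N => n /hN; rewrite -rmorphB normc_conj. Qed.

Lemma real_cauchy_lim (x : nat -> R) :
  (forall e, 0 < e -> exists N, forall m n, (N <= m)%N -> (N <= n)%N ->
    `|x m - x n| < e) ->
  exists l, forall e, 0 < e -> exists N, forall n, (N <= n)%N -> `|x n - l| < e.
Proof.
move=> h; have cv : cvg (x @ \oo).
  apply: cauchy_cvg; apply/cauchy_ballP => e e0.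
  have [N hN] := h _ e0.
  exists ([set x n | n in [set n | (N <= n)%N]], [set x n | n in [set n | (N <= n)%N]]).
    by split; exists N => // n /= hn; exists n.
  move=> [_ _] [[m hm <-] [n hn <-]] /=.
  by rewrite /ball /=; exact: hN.
exists (lim (x @ \oo)) => e e0.
have [N _ hN] := (cvgrPdist_lt _ _).1 cv e e0.
by exists N => n hn; have := hN n hn; rewrite /= distrC.
Qed.

Lemma normc_le_ReIm (z : C) : normc z <= `|complex.Re z| + `|complex.Im z|.
Proof.
case: z => a b /=; rewrite -(@ler_pXn2r _ 2)// ?nnegrE ?addr_ge0 ?sqrtr_ge0//.
rewrite sqr_sqrtr ?addr_ge0 ?sqr_ge0// sqrrD !real_normK ?num_real//.
by have := mulr_ge0 (normr_ge0 a) (normr_ge0 b); lra.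
Qed.

Lemma clim_cauchy z :
  (forall e, 0 < e -> exists N, forall m n, (N <= m)%N -> (N <= n)%N ->
    normc (z m - z n) < e) -> exists l, clim z l.
Proof.
move=> h.
have [|a ha] := @real_cauchy_lim (fun n => complex.Re (z n)).
  move=> e /h[N hN]; exists N => m n hm hn.
  by rewrite -ReB; apply: le_lt_trans (Re_le_normc _) _; exact: hN.
have [|b hb] := @real_cauchy_lim (fun n => complex.Im (z n)).
  move=> e /h[N hN]; exists N => m n hm hn.
  have -> : complex.Im (z m) - complex.Im (z n) = complex.Im (z m - z n).
    by case: (z m) (z n) => ? ? [].
  by apply: le_lt_trans (Im_le_normc _) _; exact: hN.
exists (a +i* b) => e e0.
have [|N hN] := ha (e / 2); first by lra.
have [|M hM] := hb (e / 2); first by lra.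
exists (maxn N M) => n; rewrite geq_max => /andP[/hN h1 /hM h2].
apply: le_lt_trans (normc_le_ReIm _) _.
by case: (z n) h1 h2 => x y /=; lra.
Qed.

Context {E : lmodType C}.
Variable B : hform E.

(** A point of the completion is encoded as the functional x |-> lim B(x, u n) given by a Cauchy
    sequence u. Unlike classes of sequences, these functionals form a subspace of a module of
    functions, with equality of functions. *)
Definition represents (u : nat -> E) (f : E -> C^o) :=
  hcauchy B u /\ forall x, clim (fun n => B x (u n)) (f x).

Lemma hcauchy_lin (a : C) u v :
  hcauchy B u -> hcauchy B v -> hcauchy B (fun n => a *: u n + v n).
Proof.
move=> h h' e e0; have A0 : 0 < normc a + 1 by rewrite ltr_wpDl ?normc_ge0.
have [|N hN] := h (e / 2 / (normc a + 1)); first by rewrite !divr_gt0.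
have [|M hM] := h' (e / 2); first by lra.
exists (maxn N M) => m n; rewrite !geq_max => /andP[hm hm'] /andP[hn hn'].
rewrite opprD addrACA -scalerBr; apply: le_lt_trans (hnorm_triangle _ _ _) _.
rewrite hnormZ; have h1 := hN _ _ hm hn; have h2 := hM _ _ hm' hn'.
rewrite ltr_pdivlMr// in h1.
have := hnorm_ge0 B (u m - u n); have := normc_ge0 a.
by move: (normc a) (hnorm B (u m - u n)) h1 => x y; nra.
Qed.

Lemma hcauchy_bounded u : hcauchy B u -> exists2 K, 0 <= K & forall n, hnorm B (u n) <= K.
Proof.
move=> /(_ 1 ltr01)[N hN].
exists (\sum_(i < N) hnorm B (u i) + (hnorm B (u N) + 1)).
  by rewrite !addr_ge0 ?hnorm_ge0// sumr_ge0// => i _; exact: hnorm_ge0.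
move=> n; have [nN|Nn] := ltnP n N.
  rewrite (bigD1 (Ordinal nN))//= -addrA lerDl addr_ge0 ?addr_ge0 ?hnorm_ge0//.
  by rewrite sumr_ge0// => i _; exact: hnorm_ge0.
have := hN n N Nn (leqnn _); have := hnorm_triangle B (u n - u N) (u N).
rewrite subrK; have : 0 <= \sum_(i < N) hnorm B (u i).
  by rewrite sumr_ge0// => i _; exact: hnorm_ge0.
by move: (\sum_(i < N) _) => s; lra.
Qed.

Lemma represents_lin a u v f g :
  represents u f -> represents v g -> represents (fun n => a *: u n + v n) (a *: f + g).
Proof.
move=> [uc uf] [vc vg]; split; first exact: hcauchy_lin.
move=> x; have := clim_lin a (uf x) (vg x).
by congr clim; apply/funext => n; rewrite hf_linear.
Qed.

(** |u n|^2 = B(u n - u N, u n) + B(u N, u n): the first term is small by the Cauchy property, the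
    second by weak convergence. Hence a functional determines its Cauchy sequence up to a null
    sequence, which makes [compl_form] well defined. *)
Lemma hcauchy_weak0 u :
  hcauchy B u -> (forall x, clim (fun n => B x (u n)) 0) -> hlim B u 0.
Proof.
move=> uc uw e e0; have [K K0 hK] := hcauchy_bounded uc.
have e2 : 0 < e ^+ 2 / 2 by rewrite divr_gt0 ?exprn_gt0.
have K1 : 0 < K + 1 by rewrite ltr_wpDl.
have [N hN] := uc _ (divr_gt0 e2 K1).
have [M hM] := uw (u N) _ e2.
exists (maxn N M) => n; rewrite geq_max => /andP[nN nM]; rewrite subr0.
rewrite -(@ltr_pXn2r _ 2)// ?nnegrE ?hnorm_ge0 ?ltW// hnorm_sqr.
have -> : B (u n) (u n) = B (u n - u N) (u n) + B (u N) (u n) by rewrite hfBl subrK.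
rewrite ReD.
have h1 := Re_le_normc (B (u N) (u n)); have h2 := hM _ nM; rewrite subr0 in h2.
have h3 := Re_cauchy_schwarz B (u n - u N) (u n).
have h4 := hN n N nN (leqnn _); rewrite ltr_pdivlMr// in h4.
have h5 := hK n; have h6 := hnorm_ge0 B (u n - u N); have h7 := hnorm_ge0 B (u n).
rewrite !ler_norml in h1 h3.
move: h1 h3 => /andP[_ h1] /andP[_ h3].
have h8 : hnorm B (u n - u N) * hnorm B (u n) <= hnorm B (u n - u N) * K.
  exact: ler_wpM2l.
by lra.
Qed.

Lemma represents_uniq u v f : represents u f -> represents v f ->
  hlim B (fun n => u n - v n) 0.
Proof.
move=> hu hv; have [c w] := represents_lin (-1) hv hu.
have e : (fun n => u n - v n) = (fun n => -1 *: v n + u n).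
  by apply/funext => n; rewrite scaleN1r addrC.
rewrite e; apply: hcauchy_weak0 => // x; have := w x.
by rewrite scaleN1r addNr.
Qed.

Lemma clim_form u v f g : represents u f -> represents v g ->
  exists l, clim (fun n => B (u n) (v n)) l.
Proof.
move=> [uc _] [vc _]; apply: clim_cauchy => e e0.
have [K K0 hK] := hcauchy_bounded uc; have [L L0 hL] := hcauchy_bounded vc.
have K1 : 0 < K + 1 by rewrite ltr_wpDl.
have L1 : 0 < L + 1 by rewrite ltr_wpDl.
have [|N hN] := uc (e / 2 / (L + 1)); first by rewrite !divr_gt0.
have [|M hM] := vc (e / 2 / (K + 1)); first by rewrite !divr_gt0.
exists (maxn N M) => m n; rewrite !geq_max => /andP[mN mM] /andP[nN nM].
have -> : B (u m) (v m) - B (u n) (v n) =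
    B (u m - u n) (v m) + B (u n) (v m - v n).
  by rewrite hfBl hfBr addrA subrK.
apply: le_lt_trans (le_normcD _ _) _.
have h1 := hN _ _ mN nN; have h2 := hM _ _ mM nM.
rewrite ltr_pdivlMr// in h1; rewrite ltr_pdivlMr// in h2.
have c1 := cauchy_schwarz B (u m - u n) (v m).
have c2 := cauchy_schwarz B (u n) (v m - v n).
have k1 := ler_wpM2l (hnorm_ge0 B (u m - u n)) (hL m).
have k2 := ler_wpM2r (hnorm_ge0 B (v m - v n)) (hK n).
have := hnorm_ge0 B (u m - u n); have := hnorm_ge0 B (v m - v n).
by lra.
Qed.

Lemma clim_form_uniq u u' v v' f g l :
  represents u f -> represents u' f -> represents v g -> represents v' g ->
  clim (fun n => B (u n) (v n)) l -> clim (fun n => B (u' n) (v' n)) l.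
Proof.
move=> hu hu' hv hv' h.
have d1 := represents_uniq hu' hu; have d2 := represents_uniq hv' hv.
have [K K0 hK] := hcauchy_bounded hu'.1; have [L L0 hL] := hcauchy_bounded hv.1.
move=> e e0.
have K1 : 0 < K + 1 by rewrite ltr_wpDl.
have L1 : 0 < L + 1 by rewrite ltr_wpDl.
have [|N hN] := d1 (e / 3 / (L + 1)); first by rewrite !divr_gt0.
have [|M hM] := d2 (e / 3 / (K + 1)); first by rewrite !divr_gt0.
have [|P hP] := h (e / 3); first by rewrite divr_gt0.
exists (maxn N (maxn M P)) => n; rewrite !geq_max => /and3P[nN nM nP].
have -> : B (u' n) (v' n) - l =
    B (u' n - u n) (v n) + (B (u' n) (v' n - v n) + (B (u n) (v n) - l)).
  by rewrite hfBl hfBr; ring.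
apply: le_lt_trans (le_normcD _ _) _.
have h0 := le_normcD (B (u' n) (v' n - v n)) (B (u n) (v n) - l).
have h1 := hN _ nN; have h2 := hM _ nM; have h3 := hP _ nP.
rewrite !subr0 in h1 h2.
rewrite ltr_pdivlMr// in h1; rewrite ltr_pdivlMr// in h2.
have c1 := cauchy_schwarz B (u' n - u n) (v n).
have c2 := cauchy_schwarz B (u' n) (v' n - v n).
have k1 := ler_wpM2l (hnorm_ge0 B (u' n - u n)) (hL n).
have k2 := ler_wpM2r (hnorm_ge0 B (v' n - v n)) (hK n).
have := hnorm_ge0 B (u' n - u n); have := hnorm_ge0 B (v' n - v n).
by lra.
Qed.

Definition representable (f : E -> C^o) : bool := `[< exists u, represents u f >].

Lemma representable_submod : submod_closed representable.
Proof.
split; first by apply/asboolP; exists (fun=> 0); split => [e e0|x]; [exists 0|] => [m n _ _|];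
  rewrite ?subrr ?hnorm0//; rewrite (_ : (fun=> _) = fun=> 0) ?hf0r//; exact: clim_cst.
move=> a f g /asboolP[u uf] /asboolP[v vg]; apply/asboolP.
by exists (fun n => a *: u n + v n); exact: represents_lin.
Qed.

HB.instance Definition _ :=
  GRing.isSubmodClosed.Build C (E -> C^o) representable representable_submod.

Record compl := Compl { compl_val : E -> C^o ; _ : compl_val \in representable }.

HB.instance Definition _ := [isSub for compl_val].
HB.instance Definition _ := [Choice of compl by <:].
HB.instance Definition _ := [SubChoice_isSubLmodule of compl by <:].

Lemma compl_repr_ex (f : compl) : exists u, represents u (val f).
Proof. by case: f => f /= /asboolP. Qed.

Definition compl_repr (f : compl) : nat -> E := sval (cid (compl_repr_ex f)).

Lemma compl_reprP f : represents (compl_repr f) (val f).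
Proof. exact: (svalP (cid (compl_repr_ex f))). Qed.

Definition compl_form (f g : compl) : C :=
  sval (cid (clim_form (compl_reprP f) (compl_reprP g))).

Lemma compl_formP f g u v : represents u (val f) -> represents v (val g) ->
  clim (fun n => B (u n) (v n)) (compl_form f g).
Proof.
move=> uf vg; apply: (clim_form_uniq (compl_reprP f) uf (compl_reprP g) vg).
exact: (svalP (cid (clim_form (compl_reprP f) (compl_reprP g)))).
Qed.

Lemma represents_compl a u v (f g : compl) : represents u (val f) -> represents v (val g) ->
  represents (fun n => a *: u n + v n) (val (a *: f + g)).
Proof. by rewrite linearP; exact: represents_lin. Qed.

Lemma compl_form_linear f a g h :
  compl_form f (a *: g + h) = a * compl_form f g + compl_form f h.
Proof.
have hf := compl_reprP f; have hg := compl_reprP g; have hh := compl_reprP h.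
have hgh : represents (fun n => a *: compl_repr g n + compl_repr h n) (val (a *: g + h)).
  exact: represents_compl.
apply: clim_uniq (compl_formP hf hgh) _.
have := clim_lin a (compl_formP hf hg) (compl_formP hf hh).
by congr clim; apply/funext => n; rewrite hf_linear.
Qed.

Lemma compl_form_sym f g : compl_form g f = (compl_form f g)^*.
Proof.
have hf := compl_reprP f; have hg := compl_reprP g.
apply: clim_uniq (compl_formP hg hf) _.
have := clim_conj (compl_formP hf hg).
by congr clim; apply/funext => n; rewrite -hf_sym.
Qed.

Lemma compl_form_ge0 f : 0 <= complex.Re (compl_form f f).
Proof.
have hf := compl_reprP f; rewrite leNgt; apply/negP => h.
have [|N /(_ N (leqnn N)) hN] := compl_formP hf hf (e := - complex.Re (compl_form f f)).
  by lra.
have := Re_le_normc (B (compl_repr f N) (compl_repr f N) - compl_form f f).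
rewrite ReB ler_norml => /andP[_]; have := hf_ge0 B (compl_repr f N).
by lra.
Qed.

Definition compl_hform := HForm compl_form_linear compl_form_sym compl_form_ge0.

Lemma compl_hnorm_lt f u (K : R) : represents u (val f) ->
  (exists N, forall n, (N <= n)%N -> hnorm B (u n) <= K) -> hnorm compl_hform f <= K.
Proof.
move=> uf [N hN].
have K0 : 0 <= K by apply: le_trans (hnorm_ge0 B (u N)) (hN N (leqnn N)).
rewrite -(@ler_pXn2r _ 2)// ?nnegrE ?hnorm_ge0// hnorm_sqr /=.
apply: le_eps => e e0; have [M hM] := compl_formP uf uf e0.
have := hM _ (leq_maxr N M); have := hN _ (leq_maxl N M).
set n := maxn N M => h1 h2.
have := Re_le_normc (B (u n) (u n) - compl_form f f).
rewrite ReB ler_norml -hnorm_sqr => /andP[h3 _].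
have h4 : hnorm B (u n) ^+ 2 <= K ^+ 2 by rewrite ler_pXn2r ?nnegrE ?hnorm_ge0.
by lra.
Qed.

Lemma compl_hnorm_pos f : hnorm compl_hform f = 0 -> f = 0.
Proof.
move=> h; apply/val_inj/funext => x /=; have uf := compl_reprP f.
apply: clim_uniq (uf.2 x) _ => e e0.
have x1 : 0 < hnorm B x + 1 by rewrite ltr_wpDl ?hnorm_ge0.
have e1 : 0 < (e / (hnorm B x + 1)) ^+ 2 by rewrite exprn_gt0 ?divr_gt0.
have [N hN] := compl_formP uf uf e1.
exists N => n /hN h1; rewrite subr0.
apply: le_lt_trans (cauchy_schwarz B x _) _.
have z : compl_form f f = 0.
  by have := hfxx compl_hform f; rewrite h expr0n.
rewrite z subr0 in h1.
have h2 : hnorm B (compl_repr f n) < e / (hnorm B x + 1).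
  rewrite -(@ltr_pXn2r _ 2)// ?nnegrE ?hnorm_ge0 ?ltW ?divr_gt0// hnorm_sqr.
  apply: le_lt_trans _ h1; apply: le_trans (ler_norm _) (Re_le_normc _).
apply: le_lt_trans (ler_mulD1 _ (hnorm_ge0 _ _)) _.
by rewrite mulrC -ltr_pdivlMr.
Qed.

Lemma represents_cst x : represents (fun=> x) (fun y => B y x).
Proof.
split=> [e e0|y]; last exact: clim_cst.
by exists 0 => m n _ _; rewrite subrr hnorm0.
Qed.

Lemma embed_representable x : (fun y => B y x : C^o) \in representable.
Proof. by apply/asboolP; exists (fun=> x); exact: represents_cst. Qed.

Definition embed x : compl := Compl (embed_representable x).

Lemma embed_linear : linear embed.
Proof.
move=> a x y; apply/val_inj/funext => z /=.
by rewrite hf_linear.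
Qed.

Lemma compl_form_embed x y : compl_form (embed x) (embed y) = B x y.
Proof.
apply: clim_uniq (@clim_cst _).
exact: (@compl_formP (embed x) (embed y) _ _ (represents_cst x) (represents_cst y)).
Qed.

Lemma compl_hnorm_embed x : hnorm compl_hform (embed x) = hnorm B x.
Proof. by rewrite /hnorm /= compl_form_embed. Qed.

Lemma embed_cvg f u : represents u (val f) -> hlim compl_hform (embed \o u) f.
Proof.
move=> uf e e0; have [|N hN] := uf.1 (e / 2); first by lra.
exists N => n Nn; apply: (@le_lt_trans _ _ (e / 2)); last by lra.
have h : represents (fun m => -1 *: u m + u n) (val (-1 *: f + embed (u n))).
  apply: represents_compl uf _; exact: represents_cst.
have -> : (embed \o u) n - f = -1 *: f + embed (u n) by rewrite scaleN1r addrC.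
apply: compl_hnorm_lt h _; exists N => m Nm.
by rewrite scaleN1r addrC ltW// hN.
Qed.

Lemma embed_approx f e : 0 < e -> exists x, hnorm compl_hform (f - embed x) < e.
Proof.
move=> e0; have [N hN] := embed_cvg (compl_reprP f) e0.
by exists (compl_repr f N); rewrite hnormB; exact: hN.
Qed.

(** Points embed (u n) chosen at distance less than 1 / (n + 1) from f n give a Cauchy sequence u in
    E, whose functional is the limit. *)
Lemma compl_complete : hcomplete compl_hform setT.
Proof.
move=> f _ fc.
have /choice[u hu] : forall n : nat, exists x,
    hnorm compl_hform (f n - embed x) < n.+1%:R^-1.
  by move=> n; apply: embed_approx; rewrite invr_gt0.
have uc : hcauchy B u.
  move=> e e0.
  have [|N hN] := fc (e / 2); first by lra.
  have [|M hM] := @natS_inv_lt R (e / 4); first by lra.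
  exists (maxn N M) => m n; rewrite !geq_max => /andP[mN mM] /andP[nN nM].
  rewrite -compl_hnorm_embed (linB embed_linear).
  have h1 := hnorm_triangleB compl_hform (embed (u m)) (f m) (embed (u n)).
  have h2 := hnorm_triangleB compl_hform (f m) (f n) (embed (u n)).
  rewrite (hnormB compl_hform (embed (u m)) (f m)) in h1.
  have := hu m; have := hu n; have := hM m mM; have := hM n nM; have := hN m n mN nN.
  move: h1 h2; move: (hnorm _ (embed _ - _)) (hnorm _ (f m - embed _)) => x1 x2.
  move: (hnorm _ (f m - embed _)) (hnorm _ (f m - f n)) (hnorm _ (f n - _)) => x3 x4 x5.
  by move: (m.+1%:R^-1) (n.+1%:R^-1) => a b; lra.
have wl x : exists l, clim (fun n => B x (u n)) l.
  apply: clim_cauchy => e e0; have x1 : 0 < hnorm B x + 1 by rewrite ltr_wpDl ?hnorm_ge0.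
  have [N hN] := uc _ (divr_gt0 e0 x1); exists N => m n hm hn.
  rewrite -hfBr; apply: le_lt_trans (cauchy_schwarz B x _) _.
  have := hN m n hm hn; rewrite ltr_pdivlMr//.
  by have := hnorm_ge0 B (u m - u n); lra.
have [g hg] := choice wl.
have gr : (g : E -> C^o) \in representable by apply/asboolP; exists u.
have ug : represents u (val (Compl gr)) by [].
exists (Compl gr) => // e e0.
have [|N hN] := embed_cvg ug (e := e / 2); first by lra.
have [|M hM] := @natS_inv_lt R (e / 2); first by lra.
exists (maxn N M) => n; rewrite geq_max => /andP[/hN h1 /hM h2].
have := hnorm_triangleB compl_hform (f n) (embed (u n)) (Compl gr).
have := hu n; rewrite /= in h1.
move: (hnorm _ (f n - Compl gr)) (hnorm _ (f n - embed _)) (hnorm _ (embed _ - _)) h1.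
by move: (n.+1%:R^-1) h2 => a h2 x1 x2 x3; lra.
Qed.

Definition completion : complexHilbert R := hilbert_of_form compl_hnorm_pos compl_complete.

End Completion.

(** When B is degenerate j has a kernel: the completion also divides by the null vectors. *)
Lemma completion_exists (R : realType) (E : lmodType R[i]) (B : hform E) :
  exists (H : complexHilbert R) (j : E -> H), [/\ linear j,
    forall x y, ip (j x) (j y) = B x y &
    forall h e, 0 < e -> exists x, nrm (h - j x) < e].
Proof.
exists (completion B), (@embed _ _ B); split; first exact: embed_linear.
- by move=> x y; exact: compl_form_embed.
- move=> h e e0; have [x hx] := embed_approx h e0; exists x.
  exact: hx.
Qed.

(** * Positive semidefinite kernels, Schur products and reproducing kernel spaces *)

Section Kernels.
Context {R : realType}.
Local Notation C := R[i].

Lemma conjM (x y : C) : (x * y)^* = x^* * y^*.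
Proof. exact: rmorphM. Qed.

Lemma conjR (a : R) : (a%:C)^* = a%:C.
Proof. exact: conjc_real. Qed.

Definition qsum (Y : Type) (k : Y -> Y -> C) (l l' : seq (C * Y)) : C :=
  \sum_(p <- l) \sum_(p' <- l') p.1^* * p'.1 * k p.2 p'.2.

Definition hermitian_kernel (Y : Type) (k : Y -> Y -> C) :=
  forall x y, k y x = (k x y)^*.

Definition psd_kernel (Y : Type) (k : Y -> Y -> C) :=
  hermitian_kernel k /\ forall l, 0 <= complex.Re (qsum k l l).

Lemma qsum_map (Y Z : Type) (f : Z -> Y) (k : Y -> Y -> C) l l' :
  qsum (fun x y => k (f x) (f y)) l l' =
  qsum k [seq (p.1, f p.2) | p <- l] [seq (p.1, f p.2) | p <- l'].
Proof. by rewrite /qsum big_map; apply: eq_bigr => p _; rewrite big_map. Qed.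

Lemma qsum_ip (Y : Type) (E : lmodType C) (B : hform E) (t : Y -> E) l l' :
  qsum (fun x y => B (t x) (t y)) l l' = B (comb t l) (comb t l').
Proof.
rewrite /qsum /comb hf_suml; apply: eq_bigr => p _.
rewrite hf_sumr; apply: eq_bigr => p' _; rewrite hfZl hfZr.
by rewrite mulrA.
Qed.

Lemma psd_hform (Y : Type) (E : lmodType C) (B : hform E) (t : Y -> E) :
  psd_kernel (fun x y => B (t x) (t y)).
Proof. by split=> [x y|l]; [exact: hf_sym|rewrite qsum_ip hf_ge0]. Qed.

Lemma psd_comp (Y Z : Type) (f : Z -> Y) k :
  psd_kernel k -> psd_kernel (fun x y => k (f x) (f y)).
Proof. by move=> [h p]; split=> [x y|l]; [exact: h|rewrite qsum_map]. Qed.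

Lemma psd_add (Y : Type) (k k' : Y -> Y -> C) : psd_kernel k -> psd_kernel k' ->
  psd_kernel (fun x y => k x y + k' x y).
Proof.
move=> [h p] [h' p']; split=> [x y|l]; first by rewrite h h' rmorphD.
have -> : qsum (fun x y => k x y + k' x y) l l = qsum k l l + qsum k' l l.
  rewrite /qsum -big_split; apply: eq_bigr => u _; rewrite -big_split.
  by apply: eq_bigr => v _; rewrite mulrDr.
by rewrite ReD addr_ge0.
Qed.

Lemma psd_rank1 (Y : Type) (a : R) (f : Y -> C) :
  0 <= a -> psd_kernel (fun x y => a%:C * ((f x)^* * f y)).
Proof.
move=> a0; split=> [x y|l].
  by rewrite conjM conjR conjM conjcK [f x * _]mulrC.
set s := \sum_(p <- l) p.1 * f p.2.
have -> : qsum (fun x y => a%:C * ((f x)^* * f y)) l l = a%:C * (s^* * s).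
  rewrite /s rmorph_sum /= big_distrl mulr_sumr; apply: eq_bigr => p _ /=.
  rewrite big_distrr mulr_sumr; apply: eq_bigr => p' _ /=.
  by rewrite conjM; ring.
by rewrite mulc_conj -rmorphM /= mulr_ge0 ?sqr_ge0.
Qed.

Lemma psd1 (Y : Type) : psd_kernel (fun _ _ : Y => 1 : C).
Proof.
have := @psd_rank1 Y 1 (fun=> 1) ler01.
by rewrite conjc1 !mul1r.
Qed.

Definition psd_on n (G : nat -> nat -> C) :=
  (forall i j, (i < n)%N -> (j < n)%N -> G j i = (G i j)^*) /\
  forall a : nat -> C,
    0 <= complex.Re (\sum_(i < n) \sum_(j < n) (a i)^* * a j * G i j).

Section FiniteForm.
Variables (n : nat) (G : nat -> nat -> C).
Hypothesis Gp : psd_on n G.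

Definition finite_form (a b : nat -> C^o) : C :=
  \sum_(i < n) \sum_(j < n) (a i)^* * b j * G i j.

Let finite_form_linear a b (x : C) (c : nat -> C^o) :
  finite_form a (x *: b + c) = x * finite_form a b + finite_form a c.
Proof.
rewrite /finite_form mulr_sumr -big_split; apply: eq_bigr => i _ /=.
rewrite mulr_sumr -big_split; apply: eq_bigr => j _ /=.
have -> : (x *: b + c) j = x * b j + c j by [].
by ring.
Qed.

Let finite_form_sym a b : finite_form b a = (finite_form a b)^*.
Proof.
rewrite /finite_form exchange_big rmorph_sum; apply: eq_bigr => i _ /=.
rewrite rmorph_sum; apply: eq_bigr => j _ /=.
by rewrite (Gp.1 i j)// !conjM conjcK [a i * _]mulrC.
Qed.

Let finite_form_ge0 a : 0 <= complex.Re (finite_form a a).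
Proof. exact: Gp.2. Qed.

Definition finite_hform : hform (nat -> C^o) :=
  @HForm R _ finite_form (fun a x b c => finite_form_linear a b x c) finite_form_sym
    finite_form_ge0.

Definition fdelta (i : nat) : nat -> C^o := fun j => (j == i)%:R.

Lemma finite_form_delta i b : (i < n)%N ->
  finite_form (fdelta i) b = \sum_(j < n) b j * G i j.
Proof.
move=> ni; rewrite /finite_form (bigD1 (Ordinal ni))//= /fdelta eqxx conjc1.
rewrite [X in _ + X]big1 ?addr0; first by apply: eq_bigr => j _; rewrite mul1r.
move=> j ji; rewrite big1// => k _.
by rewrite -val_eqE /= in ji; rewrite (negbTE ji) conjc0 !mul0r.
Qed.

Lemma finite_form_delta2 i j : (i < n)%N -> (j < n)%N ->
  finite_form (fdelta i) (fdelta j) = G i j.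
Proof.
move=> ni nj; rewrite finite_form_delta// (bigD1 (Ordinal nj))//= /fdelta eqxx mul1r.
rewrite big1 ?addr0// => k kj.
by rewrite -val_eqE /= in kj; rewrite (negbTE kj) mul0r.
Qed.

End FiniteForm.

(* Each step splits off a rank one kernel, as in Cholesky's decomposition. *)
Lemma gram_decomposition n (G : nat -> nat -> C) : psd_on n G ->
  exists c : nat -> nat -> C, forall i j, (i < n)%N -> (j < n)%N ->
    G i j = \sum_(m < n) (c m i)^* * c m j.
Proof.
elim: n G => [|n IHn] G Gp; first by exists (fun _ _ => 0).
pose B := finite_hform Gp.
have B2 i j : (i < n.+1)%N -> (j < n.+1)%N -> G i j = B (fdelta i) (fdelta j).
  by move=> hi hj; rewrite /B /= finite_form_delta2.
pose d := hnorm B (fdelta n).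
have Gnn : G n n = (d ^+ 2)%:C by rewrite B2// hfxx.
have cs (x : nat -> C^o) : normc (B (fdelta n) x) ^+ 2 <= d ^+ 2 * hnorm B x ^+ 2.
  rewrite -exprMn ler_pXn2r ?nnegrE ?normc_ge0 ?mulr_ge0 ?hnorm_ge0//.
  exact: cauchy_schwarz.
(* If d = 0 its inverse is 0, so v = 0; Cauchy-Schwarz then makes the row n of G vanish too, and
   [vE] holds in both cases. *)
pose v i : C := (d^-1)%:C * G n i.
have dd : d != 0 -> (d^-1)%:C * d%:C = 1 :> C.
  by move=> d0; rewrite -rmorphM mulVf// rmorph1.
have vE i : (i < n.+1)%N -> G n i = d%:C * v i.
  move=> hi; rewrite /v mulrA; have [d0|/dd] := eqVneq d 0.
    rewrite d0 mul0r mul0r B2//; apply: eq0_normc; apply/eqP.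
    have := cs (fdelta i); rewrite d0 expr0n mul0r => h.
    by rewrite -sqrf_eq0 eq_le h sqr_ge0.
  by rewrite [d%:C * _]mulrC => ->; rewrite mul1r.
have [|c hc] := IHn (fun i j => G i j - (v i)^* * v j).
  split=> [i j hi hj|a].
    rewrite (Gp.1 i j) ?ltnS ?(ltnW hi) ?(ltnW hj)// rmorphB /= (conjM (v i)^*) conjcK.
    by rewrite [v i * _]mulrC.
  pose x : nat -> C^o := fun i => if (i < n)%N then a i else 0.
  have xx : B x x = \sum_(i < n) \sum_(j < n) (a i)^* * a j * G i j.
    rewrite /B /= /finite_form big_ord_recr /= [X in _ + X]big1 ?addr0; last first.
      by move=> j _; rewrite /x ltnn conjc0 !mul0r.
    apply: eq_bigr => i _; rewrite big_ord_recr /= /x ltnn mulr0 mul0r addr0.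
    by apply: eq_bigr => j _; rewrite !ltn_ord.
  have nx : B (fdelta n) x = d%:C * \sum_(j < n) a j * v j.
    rewrite /B /= finite_form_delta// big_ord_recr /= /x ltnn mul0r addr0 mulr_sumr.
    apply: eq_bigr => j _; rewrite ltn_ord vE ?ltnS ?(ltnW (ltn_ord j))//.
    by ring.
  have -> : \sum_(i < n) \sum_(j < n) (a i)^* * a j * (G i j - (v i)^* * v j) =
      B x x - (\sum_(j < n) a j * v j)^* * (\sum_(j < n) a j * v j).
    rewrite xx rmorph_sum /= mulr_suml -sumrB; apply: eq_bigr => i _.
    rewrite mulr_sumr -sumrB; apply: eq_bigr => j _.
    by rewrite (conjM (a i)); ring.
  rewrite mulc_conj hfxx -rmorphB /= subr_ge0.
  have := cs x; rewrite nx normcM normcR exprMn real_normK ?num_real//.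
  have [d0|d0] := eqVneq d 0; last by rewrite ler_pM2l// exprn_even_gt0.
  move=> _; rewrite (_ : \sum_(j < n) a j * v j = 0) ?normc0 ?expr0n ?sqr_ge0//.
  by rewrite big1// => j _; rewrite /v d0 invr0 mul0r mulr0.
exists (fun m => if m == n then v else fun i => if (i < n)%N then c m i else 0).
move=> i j hi hj; rewrite big_ord_recr /= eqxx.
rewrite [X in X + _](_ : _ =
    if (i < n)%N && (j < n)%N then G i j - (v i)^* * v j else 0); last first.
  case: ifPn => [/andP[ni nj]|].
    rewrite hc//; apply: eq_bigr => m _; rewrite (ltn_eqF (ltn_ord m)).
    by rewrite ni nj.
  move=> nij; rewrite big1// => m _; rewrite (ltn_eqF (ltn_ord m)).
  by move: nij; case: (i < n)%N; case: (j < n)%N => // _; rewrite ?conjc0 ?mul0r ?mulr0.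
case: ifPn => [_|]; first by rewrite subrK.
rewrite add0r negb_and -!leqNgt => nij.
have vn : v n = d%:C.
  rewrite /v Gnn -rmorphM expr2 mulrA; have [->|d0] := eqVneq d 0; first by rewrite mulr0.
  by rewrite mulVf// mul1r.
case/orP: nij => h.
  have -> : i = n by apply/eqP; rewrite eqn_leq h -ltnS hi.
  by rewrite vn conjR -vE.
have -> : j = n by apply/eqP; rewrite eqn_leq h -ltnS hj.
by rewrite vn (Gp.1 n i)// (vE i)// conjM conjR mulrC.
Qed.

Lemma qsum_nth (Y : Type) (y0 : Y) (k : Y -> Y -> C) l :
  qsum k l l = \sum_(i < size l) \sum_(j < size l)
    (nth (0, y0) l i).1^* * (nth (0, y0) l j).1 * k (nth (0, y0) l i).2 (nth (0, y0) l j).2.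
Proof.
rewrite /qsum (big_nth (0, y0)) big_mkord; apply: eq_bigr => i _.
by rewrite (big_nth (0, y0)) big_mkord.
Qed.

Lemma qsum_iota (Y : Type) (k : Y -> Y -> C) (a : nat -> C) (y : nat -> Y) n :
  qsum k [seq (a i, y i) | i <- iota 0 n] [seq (a i, y i) | i <- iota 0 n] =
  \sum_(i < n) \sum_(j < n) (a i)^* * a j * k (y i) (y j).
Proof.
rewrite /qsum big_map -{1}[n]subn0 big_mkord; apply: eq_bigr => i _.
by rewrite big_map -{1}[n]subn0 big_mkord.
Qed.

Lemma psd_on_nth (Y : Type) (y0 : Y) (k : Y -> Y -> C) (s : seq Y) n :
  psd_kernel k -> psd_on n (fun i j => k (nth y0 s i) (nth y0 s j)).
Proof.
move=> [h p]; split=> [i j _ _|a]; first exact: h.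
have := p [seq (a i, nth y0 s i) | i <- iota 0 n].
by rewrite qsum_iota.
Qed.

(* Schur: if k' is the sum of the c_m^* c_m, then k k' is that of the c_m^* k c_m. *)
Lemma psd_mul (Y : Type) (k k' : Y -> Y -> C) : psd_kernel k -> psd_kernel k' ->
  psd_kernel (fun x y => k x y * k' x y).
Proof.
move=> kp [h' p']; split=> [x y|l]; first by rewrite kp.1 h' rmorphM.
case: l => [|[a0 y0] l']; first by rewrite /qsum big_nil.
set l := _ :: l'; rewrite (qsum_nth y0).
pose s := [seq p.2 | p <- l].
have sE i : (i < size l)%N -> (nth (0, y0) l i).2 = nth y0 s i.
  by move=> hi; rewrite (nth_map (0, y0)).
have [c hc] := gram_decomposition (psd_on_nth y0 s (size l) kp).
have -> : \sum_(i < size l) \sum_(j < size l)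
    (nth (0, y0) l i).1^* * (nth (0, y0) l j).1 *
      (k (nth (0, y0) l i).2 (nth (0, y0) l j).2 * k' (nth (0, y0) l i).2 (nth (0, y0) l j).2)
    = \sum_(m < size l)
        qsum k' [seq ((nth (0, y0) l i).1 * c m i, nth y0 s i) | i <- iota 0 (size l)]
         [seq ((nth (0, y0) l i).1 * c m i, nth y0 s i) | i <- iota 0 (size l)].
  under [RHS]eq_bigr do rewrite (qsum_iota k' (fun i => (nth (0, y0) l i).1 * c _ i)).
  rewrite [RHS]exchange_big; apply: eq_bigr => i _ /=.
  rewrite [RHS]exchange_big; apply: eq_bigr => j _ /=.
  rewrite !sE// hc// mulr_suml mulr_sumr; apply: eq_bigr => m _.
  by rewrite conjM; ring.
by rewrite Re_sum sumr_ge0.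
Qed.

Lemma psd_prod (Y : Type) (I : Type) (r : seq I) (P : pred I) (k : I -> Y -> Y -> C) :
  (forall i, P i -> psd_kernel (k i)) ->
  psd_kernel (fun x y => \prod_(i <- r | P i) k i x y).
Proof.
move=> kp; elim: r => [|i r IHr].
  have := @psd1 Y; congr psd_kernel; apply/funext => x; apply/funext => y.
  by rewrite big_nil.
case Pi: (P i).
  have := psd_mul (kp i Pi) IHr; congr psd_kernel.
  by apply/funext => x; apply/funext => y; rewrite big_cons Pi.
have := IHr; congr psd_kernel.
by apply/funext => x; apply/funext => y; rewrite big_cons Pi.
Qed.

Section KernelHilbert.
Context {Y : Type}.
Variable k : Y -> Y -> C.
Hypothesis kp : psd_kernel k.

(** The functions k(., y), whose span with <k(., x), k(., y)> = k(x, y) is the pre-Hilbert space of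
    Moore and Aronszajn. *)
Definition kfun (y : Y) : Y -> C^o := fun x => k x y.

Definition kspan (f : Y -> C^o) : bool := `[< exists l, f = comb kfun l >].

Lemma kspan_submod : submod_closed kspan.
Proof.
split; first by apply/asboolP; exists [::]; rewrite comb_nil.
move=> a f g /asboolP[l ->] /asboolP[l' ->]; apply/asboolP.
by exists ([seq (a * p.1, p.2) | p <- l] ++ l'); rewrite comb_cat comb_scale.
Qed.

HB.instance Definition _ :=
  GRing.isSubmodClosed.Build C (Y -> C^o) kspan kspan_submod.

Record prehilbert := Prehilbert { preh_val : Y -> C^o ; _ : preh_val \in kspan }.

HB.instance Definition _ := [isSub for preh_val].
HB.instance Definition _ := [Choice of prehilbert by <:].
HB.instance Definition _ := [SubChoice_isSubLmodule of prehilbert by <:].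

Lemma preh_repr_ex (f : prehilbert) : exists l, val f = comb kfun l.
Proof. by case: f => f /= /asboolP. Qed.

Definition preh_repr (f : prehilbert) := sval (cid (preh_repr_ex f)).

Lemma preh_reprP f : val f = comb kfun (preh_repr f).
Proof. exact: (svalP (cid (preh_repr_ex f))). Qed.

Lemma comb_kfun l x : comb kfun l x = \sum_(p <- l) p.1 * k x p.2.
Proof.
elim: l => [|p l IHl]; first by rewrite big_nil comb_nil.
by case: p => a y; rewrite comb_cons big_cons /= -IHl.
Qed.

Definition preh_form (f g : prehilbert) : C :=
  \sum_(p <- preh_repr f) p.1^* * val g p.2.

Lemma qsum_kfun l l' : qsum k l l' = \sum_(p <- l) p.1^* * comb kfun l' p.2.
Proof.
apply: eq_bigr => p _; rewrite comb_kfun mulr_sumr.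
by apply: eq_bigr => p' _; rewrite mulrA.
Qed.

Lemma qsum_conj l l' : qsum k l' l = (qsum k l l')^*.
Proof.
rewrite /qsum exchange_big rmorph_sum; apply: eq_bigr => p _ /=.
rewrite rmorph_sum; apply: eq_bigr => p' _ /=.
by rewrite (kp.1 p.2) !conjM conjcK [p.1 * _]mulrC.
Qed.

(** Reproducing property: the sum that defines [preh_form f g] only evaluates g, so it does not
    depend on how g is written; by symmetry the list chosen for f is immaterial as well. *)
Lemma preh_formE f g l l' : val f = comb kfun l -> val g = comb kfun l' ->
  preh_form f g = qsum k l l'.
Proof.
move=> hf hg; rewrite /preh_form hg -qsum_kfun qsum_conj qsum_kfun -preh_reprP.
by rewrite hf -qsum_kfun -qsum_conj.
Qed.

Lemma preh_form_linear f a g h :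
  preh_form f (a *: g + h) = a * preh_form f g + preh_form f h.
Proof.
rewrite /preh_form mulr_sumr -big_split; apply: eq_bigr => p _ /=.
have -> : (a *: preh_val g + preh_val h) p.2 = a * preh_val g p.2 + preh_val h p.2 by [].
by ring.
Qed.

Lemma preh_form_sym f g : preh_form g f = (preh_form f g)^*.
Proof.
by rewrite (preh_formE (preh_reprP g) (preh_reprP f)) qsum_conj
  -(preh_formE (preh_reprP f) (preh_reprP g)).
Qed.

Lemma preh_form_ge0 f : 0 <= complex.Re (preh_form f f).
Proof. by rewrite (preh_formE (preh_reprP f) (preh_reprP f)); exact: kp.2. Qed.

Definition preh_hform := HForm preh_form_linear preh_form_sym preh_form_ge0.

Lemma kfun_span y : kfun y \in kspan.
Proof. by apply/asboolP; exists [:: (1, y)]; rewrite comb1. Qed.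

Lemma kernel_hilbert : exists (H : complexHilbert R) (t : Y -> H),
  (forall x y, ip (t x) (t y) = k x y) /\ total t.
Proof.
have [H [j [jl jip jd]]] := completion_exists preh_hform.
pose t y := Prehilbert (kfun_span y).
exists H, (j \o t); split=> [x y|h e /(jd h)[f hf]].
  have hx y' : val (t y') = comb kfun [:: (1, y')] by rewrite comb1.
  rewrite /= jip /= (preh_formE (hx x) (hx y)) /qsum !big_seq1 conjc1.
  by rewrite !mul1r.
exists (preh_repr f); apply: le_lt_trans hf.
rewrite -(lin_comb t _ jl) (_ : comb t (preh_repr f) = f)//.
apply/val_inj; rewrite [RHS]preh_reprP.
move: (preh_repr f) => l; elim: l => [|[a y] l IHl]; first by rewrite !comb_nil.
by rewrite !comb_cons -IHl.
Qed.

End KernelHilbert.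

End Kernels.

(** * Inversions of permutations *)

Section Inversions.
Local Open Scope nat_scope.

Lemma inversionsE n (s : 'S_n) :
  inversions s = \sum_(i < n) \sum_(j < n) ((i < j) && (s j < s i)).
Proof.
rewrite /inversions -sum1dep_card big_mkcond pair_big /=.
by apply: eq_bigr => -[i j] _ /=; case: ifP.
Qed.

Lemma inversionsV n (s : 'S_n) : inversions s^-1%g = inversions s.
Proof.
rewrite !inversionsE (reindex_inj (@perm_inj _ s)) exchange_big /=.
rewrite (reindex_inj (@perm_inj _ s)) /=.
by apply: eq_bigr => i _; apply: eq_bigr => j _; rewrite !permK andbC.
Qed.

Lemma sum_ltn n m : m <= n -> \sum_(i < n) (i < m) = m.
Proof.
move=> mn; rewrite -(big_mkord xpredT (fun i => (i < m) : nat)).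
rewrite (big_cat_nat (leq0n m) mn) /= (eq_big_nat _ _ (F2 := fun=> 1)); last first.
  by move=> i /andP[_ ->].
rewrite sum_nat_const_nat subn0 muln1 (eq_big_nat _ _ (F2 := fun=> 0)).
  by rewrite big1 ?addn0.
by move=> i /andP[mi _]; rewrite ltnNge mi.
Qed.

(** The position 0, sent to j, forms an inversion with each of the j smaller values; the other pairs
    are ordered as by s. *)
Lemma inversions_lift n (j : 'I_n.+1) (s : 'S_n) :
  inversions (lift_perm ord0 j s) = j + inversions s.
Proof.
rewrite !inversionsE big_ord_recl /= big_ord_recl /= add0n; congr addn.
  have jn : j <= n by rewrite -ltnS.
  rewrite lift_perm_id; apply: etrans (sum_ltn jn).
  rewrite (reindex_inj (@perm_inj _ s^-1%g)) /=; apply: eq_bigr => i _.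
  rewrite lift_perm_lift permKV /= /bump.
  by case: (leqP j i) => /=; rewrite ?add1n ?add0n ltnNge; case: ltngtP; lia.
apply: eq_bigr => i _; rewrite big_ord_recl /= add0n.
apply: eq_bigr => k _; rewrite !lift_perm_lift /= ltnS; congr (nat_of_bool (_ && _)).
rewrite /bump; case: (leqP j (s i)); case: (leqP j (s k)); lia.
Qed.

Lemma inversions_rev n (s t : 'S_n) : (forall i, t i = rev_ord (s (rev_ord i))) ->
  inversions t = inversions s.
Proof.
move=> h; rewrite !inversionsE exchange_big /= (reindex_inj rev_ord_inj) /=.
apply: eq_bigr => i _; rewrite (reindex_inj rev_ord_inj) /=.
apply: eq_bigr => j _; rewrite !h !rev_ordK /=.
by have := ltn_ord i; have := ltn_ord j; have := ltn_ord (s i);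
  have := ltn_ord (s j); move: (val (s i)) (val (s j)) => a b; lia.
Qed.

Lemma lift_perm_bij n :
  bijective (fun js : 'I_n.+1 * 'S_n => lift_perm ord0 js.1 js.2).
Proof.
apply: inj_card_bij => [[i s] [j t] /= h|].
  have ij : i = j by rewrite -(lift_perm_id ord0 i s) h lift_perm_id.
  congr pair => //; apply/permP => k; apply: (@lift_inj _ j).
  by rewrite -(lift_perm_lift ord0 j t) -h ij lift_perm_lift.
by rewrite card_prod card_ord !card_Sn factS.
Qed.

End Inversions.

(** * Positivity of the q-deformed inner product *)

Section QForm.
Context {R : realType}.
Local Notation C := R[i].
Context {X : Type}.
Variables (q : R) (k : X -> X -> C).

(** Words are functions of the position, of which the first n letters count: deleting a letter is
    then composition with [bump]. *)
Definition qfn n (v w : nat -> X) : C :=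
  \sum_(s : 'S_n) (q ^+ inversions s)%:C * \prod_(i < n) k (v i) (w (s i)).

Lemma qfn_ext n v v' w w' : (forall i, (i < n)%N -> v i = v' i) ->
  (forall i, (i < n)%N -> w i = w' i) -> qfn n v w = qfn n v' w'.
Proof.
move=> hv hw; apply: eq_bigr => s _; congr (_ * _).
by apply: eq_bigr => i _; rewrite hv// hw.
Qed.

Lemma qfn0 v w : qfn 0 v w = 1.
Proof.
rewrite /qfn (eq_bigr (fun=> 1)).
  by rewrite sumr_const card_Sn mulr1n.
move=> s _; rewrite big_ord0 mulr1 inversionsE big_ord0.
by rewrite expr0.
Qed.

(** Expansion along the first row, as for a determinant: the permutations are sorted by the image j
    of 0, which contributes q^j by [inversions_lift]. *)
Lemma qfn_rec n v w : qfn n.+1 v w =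
  \sum_(j < n.+1) (q ^+ j)%:C * k (v 0%N) (w j) * qfn n (fun i => v i.+1) (fun i => w (bump j i)).
Proof.
rewrite /qfn (reindex _ (onW_bij _ (lift_perm_bij n))) /=.
rewrite -(pair_big xpredT xpredT (fun j s => (q ^+ inversions (lift_perm ord0 j s))%:C *
  \prod_(i < n.+1) k (v i) (w (lift_perm ord0 j s i)))) /=.
apply: eq_bigr => j _; rewrite mulr_sumr; apply: eq_bigr => s _.
rewrite inversions_lift exprD rmorphM /= big_ord_recl lift_perm_id.
rewrite -!mulrA; congr (_ * _); rewrite mulrCA; congr (_ * (_ * _)).
by apply: eq_bigr => i _; rewrite lift_perm_lift.
Qed.

Lemma qfn_rev n v w : qfn n (fun i => v (n - i.+1)%N) (fun i => w (n - i.+1)%N) = qfn n v w.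
Proof.
rewrite /qfn.
have inj (s : 'S_n) : injective (fun i => rev_ord (s (rev_ord i))).
  by move=> i j /rev_ord_inj/perm_inj/rev_ord_inj.
pose f (s : 'S_n) : 'S_n := perm (inj s).
have fE s i : f s i = rev_ord (s (rev_ord i)) by rewrite permE.
have fK : involutive f.
  by move=> s; apply/permP => i; rewrite !fE !rev_ordK.
rewrite (reindex_inj (inv_inj fK)); apply: eq_bigr => s _; congr (_ * _).
  by rewrite (@inversions_rev _ s).
rewrite (reindex_inj rev_ord_inj) /=; apply: eq_bigr => i _.
rewrite fE rev_ordK /=; have := ltn_ord (s i); have := ltn_ord i => h h'.
by congr (k (v _) (w _)); move: (val (s i)) h h' => /= a; lia.
Qed.

Lemma qfn_sym n v w : hermitian_kernel k -> qfn n w v = (qfn n v w)^*.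
Proof.
move=> kh; rewrite /qfn rmorph_sum (reindex_inj invg_inj) /=.
apply: eq_bigr => s _; rewrite conjM conjR inversionsV; congr (_ * _).
rewrite rmorph_prod (reindex_inj (@perm_inj _ s)) /=.
by apply: eq_bigr => i _; rewrite permK kh.
Qed.

(** The inversions of s^-1 t are the pairs that s and t order differently. So q^inv is a product
    over the pairs i < j of a kernel in two bits, one telling how s orders the pair and one telling
    how t does; [psd_qfn] rests on this. *)
Lemma inversions_disagree n (s t : 'S_n) : inversions (s^-1 * t)%g =
  (\sum_(i < n) \sum_(j < n) ((i < j) && ((s i < s j) != (t i < t j))))%N.
Proof.
rewrite inversionsE (reindex_inj (@perm_inj _ s)) /=.
under eq_bigr do rewrite (reindex_inj (@perm_inj _ s)) /=.
under eq_bigr do under eq_bigr do rewrite !permM !permK.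
pose P (i j : 'I_n) := ((s i < s j) && (t j < t i))%N.
have -> : (\sum_(i < n) \sum_(j < n) ((s i < s j) && (t j < t i)) =
  \sum_(i < n) \sum_(j < n) ((i < j) && (P i j)) +
  \sum_(i < n) \sum_(j < n) ((i < j) && (P j i)))%N.
  rewrite [X in (_ + X)%N]exchange_big -big_split; apply: eq_bigr => i _ /=.
  rewrite -big_split; apply: eq_bigr => j _ /=; rewrite -/(P i j).
  case: (ltngtP i j) => /= ij; rewrite ?addn0//.
  by rewrite (val_inj ij) /P ltnn.
rewrite -big_split; apply: eq_bigr => i _ /=.
rewrite -big_split; apply: eq_bigr => j _ /=.
case: (ltnP i j) => //= ij.
have sij : (s i != s j :> nat).
  by rewrite val_eqE (inj_eq perm_inj) -val_eqE /= ltn_eqF.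
have tij : (t i != t j :> nat).
  by rewrite val_eqE (inj_eq perm_inj) -val_eqE /= ltn_eqF.
rewrite /P; move: sij tij; move: (nat_of_ord (s i)) (nat_of_ord (s j)).
move: (nat_of_ord (t i)) (nat_of_ord (t j)) => c d a b.
by case: (ltngtP a b); case: (ltngtP c d).
Qed.

Lemma qfn_perm n v w (s : 'S_n) : qfn n v w =
  \sum_(t : 'S_n) (q ^+ inversions (s^-1 * t)%g)%:C *
    \prod_(i < n) k (v (s i)) (w (t i)).
Proof.
rewrite /qfn (reindex_inj (mulgI s^-1%g)) /=; apply: eq_bigr => t _; congr (_ * _).
rewrite (reindex_inj (@perm_inj _ s)) /=.
by apply: eq_bigr => i _; rewrite permM permK.
Qed.

(** The matrix with 1 on the diagonal and q off it has eigenvectors (1, 1) and (1, -1), with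
    eigenvalues 1 + q and 1 - q. *)
Lemma psd_qbool : -1 <= q -> q <= 1 ->
  psd_kernel (fun x y : bool => if x == y then 1 else q%:C : C).
Proof.
move=> q0 q1.
have h0 : 0 <= (1 + q) / 2 by lra.
have h1 : 0 <= (1 - q) / 2 by lra.
have := psd_add (@psd_rank1 _ bool _ (fun=> 1) h0)
  (@psd_rank1 _ bool _ (fun x => (-1) ^+ x) h1).
congr psd_kernel; apply/funext => x; apply/funext => y.
by case: x; case: y => /=; rewrite ?eqxx; apply: complex_ext => /=; field.
Qed.

Hypotheses (q0 : -1 <= q) (q1 : q <= 1) (kp : psd_kernel k).

(** The argument of Bozejko and Speicher: summing over the reorderings s of the left word, n! <v,
    w>_q becomes the sum over s and t of q^inv(s^-1 t) times the product of the k(v_(s i), w_(t i)),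
    which is a Schur product of positive kernels in (s, v) and (t, w). *)
Lemma psd_qfn n : psd_kernel (qfn n).
Proof.
split=> [v w|l]; first by apply: qfn_sym; exact: kp.1.
pose K (x y : 'S_n * (nat -> X)) : C := (q ^+ inversions (x.1^-1 * y.1)%g)%:C *
    \prod_(i < n) k (x.2 (x.1 i)) (y.2 (y.1 i)).
have Kp : psd_kernel K.
  apply: psd_mul; last first.
    apply: psd_prod => i _.
    exact: (psd_comp (fun x : 'S_n * (nat -> X) => x.2 (x.1 i)) kp).
  have := @psd_prod _ ('S_n * (nat -> X)) ('I_n * 'I_n) (index_enum _)
    (fun ij => ij.1 < ij.2)%N
    (fun ij x y => if (x.1 ij.1 < x.1 ij.2)%N == (y.1 ij.1 < y.1 ij.2)%N then 1 else q%:C).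
  have h ij : psd_kernel (fun x y : 'S_n * (nat -> X) =>
      if (x.1 ij.1 < x.1 ij.2)%N == (y.1 ij.1 < y.1 ij.2)%N then 1 else q%:C : C).
    exact: (psd_comp (fun x : 'S_n * (nat -> X) => (x.1 ij.1 < x.1 ij.2)%N) (psd_qbool q0 q1)).
  move=> /(_ (fun ij _ => h ij)).
  congr psd_kernel; apply/funext => x; apply/funext => y.
  rewrite inversions_disagree pair_big /= rmorphXn expr_sum big_mkcond.
  apply: eq_bigr => -[i j] _ /=.
  by case: ifP => ij; rewrite ?expr0//=; case: eqP.
(* Every word of l is taken with all its reorderings s; by [qfn_perm] each s contributes the same,
   hence the factor n!. *)
have := Kp.2 (flatten [seq [seq (p.1, (s, p.2)) | s <- index_enum 'S_n] | p <- l]).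
have -> : qsum K (flatten [seq [seq (p.1, (s, p.2)) | s <- index_enum 'S_n] | p <- l])
   (flatten [seq [seq (p.1, (s, p.2)) | s <- index_enum 'S_n] | p <- l]) =
   (n`!%:R : R)%:C * qsum (qfn n) l l.
  rewrite /qsum big_flatten big_map mulr_sumr; apply: eq_bigr => p _.
  rewrite big_map; under eq_bigr do rewrite big_flatten big_map.
  rewrite exchange_big mulr_sumr; apply: eq_bigr => p' _ /=.
  rewrite (eq_bigr (fun=> p.1^* * p'.1 * qfn n p.2 p'.2)).
    rewrite sumr_const card_Sn -[LHS]mulr_natl; congr (_ * _).
    by rewrite rmorph_nat.
  move=> s _; rewrite big_map (qfn_perm _ _ s) mulr_sumr.
  by apply: eq_bigr => t _.
by rewrite ReM_real pmulr_rge0// ltr0n fact_gt0.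
Qed.

End QForm.

(** * The q-form on words of any length, by deletion of letters *)

Section WordKernel.
Context {R : realType}.
Local Notation C := R[i].
Context {X : Type}.
Variables (q : R) (k : X -> X -> C) (x0 : X).

(* The triples (i, y, w') such that y is the letter number i of w and w' is w
   without that letter. *)
Fixpoint dels (w : seq X) : seq (nat * X * seq X) :=
  if w is x :: w' then
    (0%N, x, w') :: [seq (d.1.1.+1, d.1.2, x :: d.2) | d <- dels w']
  else [::].

Lemma delsE w : dels w =
  [seq (i, nth x0 w i, take i w ++ drop i.+1 w) | i <- iota 0 (size w)].
Proof.
elim: w => //= x w IHw; rewrite drop0 IHw (iotaDl 1) -!map_comp.
by congr cons; apply: eq_map => i.
Qed.

Lemma dels_rcons w x : dels (rcons w x) =
  rcons [seq (d.1.1, d.1.2, rcons d.2 x) | d <- dels w] (size w, x, w).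
Proof.
by elim: w => //= y w ->; rewrite map_rcons -!map_comp.
Qed.

Definition qwords (v w : seq X) : C :=
  if size v == size w then qfn q k (size v) (nth x0 v) (nth x0 w) else 0.

Lemma qwords_nil : qwords [::] [::] = 1.
Proof. by rewrite /qwords eqxx qfn0. Qed.

Lemma qwords_size v w : size v != size w -> qwords v w = 0.
Proof. by rewrite /qwords => /negbTE ->. Qed.

Lemma nth_del (w : seq X) i j : (i < size w)%N ->
  nth x0 (take i w ++ drop i.+1 w) j = nth x0 w (bump i j).
Proof.
move=> iw; rewrite nth_cat size_take iw /bump.
case: (ltnP j i) => ji; first by rewrite nth_take.
by rewrite nth_drop; congr nth; lia.
Qed.

Lemma qwords_cons h v w : qwords (h :: v) w =
  \sum_(d <- dels w) (q ^+ d.1.1)%:C * k h d.1.2 * qwords v d.2.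
Proof.
rewrite delsE big_map -{1}[size w]subn0 big_mkord /qwords /=.
have [e|ne] := eqVneq (size v).+1 (size w).
  rewrite qfn_rec -e; apply: eq_bigr => j _ /=; congr (_ * _).
  have jw : (j < size w)%N by rewrite -e.
  rewrite size_cat size_take size_drop jw.
  have -> : (size v == j + (size w - j.+1))%N by apply/eqP; rewrite -e; lia.
  by apply: qfn_ext => i iv //; rewrite nth_del.
rewrite big1// => j _; rewrite size_cat size_take size_drop ltn_ord.
have -> : (size v == j + (size w - j.+1))%N = false.
  by apply/eqP => h'; move: ne; rewrite h' => /eqP; have := ltn_ord j; lia.
by rewrite mulr0.
Qed.

Lemma qwords_rev v w : qwords (rev v) (rev w) = qwords v w.
Proof.
rewrite /qwords !size_rev; case: eqP => // e.
rewrite -[RHS]qfn_rev; apply: qfn_ext => i iv; first by rewrite nth_rev.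
by rewrite nth_rev -e.
Qed.

Lemma qwords_sym : hermitian_kernel k -> hermitian_kernel qwords.
Proof.
move=> kh v w; rewrite /qwords eq_sym; case: eqP => [->|]; last by rewrite conjc0.
exact: qfn_sym.
Qed.

(** Words of different sizes are orthogonal, so the sum splits according to the size. *)
Lemma psd_qwords : -1 <= q -> q <= 1 -> psd_kernel k -> psd_kernel qwords.
Proof.
move=> q0 q1 kp; split=> [|l]; first exact/qwords_sym/kp.1.
pose N := (\max_(p <- l) size p.2).+1.
pose ln n := [seq p <- l | size p.2 == n].
have -> : qsum qwords l l =
    \sum_(n < N) qsum (fun v w => qfn q k n (nth x0 v) (nth x0 w)) (ln n) (ln n).
  have lN : all (fun p => size p.2 < N)%N l.
    rewrite /N; elim: l {ln N} => //= p l IHl; rewrite big_cons ltnS leq_maxl /=.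
    by apply: sub_all IHl => p'; rewrite !ltnS => h; rewrite (leq_trans h) ?leq_maxr.
  have split (f : C * seq X -> C) l1 : all (fun p => size p.2 < N)%N l1 ->
      \sum_(p <- l1) f p = \sum_(n < N) \sum_(p <- l1 | size p.2 == n) f p.
    elim: l1 => [_|p l1 IHl /= /andP[pN h]].
      by rewrite big_nil big1// => n _; rewrite big_nil.
    rewrite big_cons (IHl h) (bigD1 (Ordinal pN))//= [RHS](bigD1 (Ordinal pN))//=.
    rewrite big_cons eqxx addrA; congr (_ + _); apply: eq_bigr => n.
    by rewrite -val_eqE /= big_cons eq_sym => /negbTE ->.
  rewrite /qsum split//; apply: eq_bigr => n _; rewrite big_filter.
  apply: eq_bigr => p /eqP pn; rewrite big_filter [RHS]big_mkcond.
  apply: eq_bigr => p' _; rewrite /qwords pn eq_sym.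
  by case: eqP => // _; rewrite mulr0.
rewrite Re_sum sumr_ge0// => n _.
exact: (psd_comp (fun v => nth x0 v) (psd_qfn q0 q1 kp n)).2.
Qed.

End WordKernel.

Lemma qwords_map (R : realType) (X X' : Type) (q : R) (k : X -> X -> R[i])
    (f : X' -> X) x0 x0' v w :
  qwords q k x0 (map f v) (map f w) = qwords q (fun x y => k (f x) (f y)) x0' v w.
Proof.
rewrite /qwords !size_map; case: eqP => // e.
apply: eq_bigr => s _; congr (_ * _); apply: eq_bigr => i _.
by rewrite !(nth_map x0')// -e.
Qed.

Lemma total_ext (R : realType) (I : Type) (F : complexHilbert R) (t : I -> F) u u' :
  total t -> (forall i, ip (t i) u = ip (t i) u') -> u = u'.
Proof.
move=> tt h; apply/eqP; rewrite -subr_eq0; apply/eqP; apply: (total_orth tt) => v.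
by rewrite hfBr /= h subrr.
Qed.

(** * Left and right creation and annihilation operators *)

Section FockOperators.
Context {R : realType}.
Local Notation C := R[i].
Context {X : Type} {F : complexHilbert R}.
Variables (q : R) (k : X -> X -> C) (x0 : X) (t : seq X -> F).
Hypotheses (q0 : -1 < q) (q1 : q < 1) (kp : psd_kernel k).
Hypothesis t_ip : forall v w, ip (t v) (t w) = qwords q k x0 v w.
Hypothesis tt : total t.

Definition ann_word (h : X) (w : seq X) : F :=
  \sum_(d <- dels w) ((q ^+ d.1.1)%:C * k h d.1.2) *: t d.2.

(** The annihilated combination is kept as a list, to which the bound on creation in lower degree
    can be applied again. *)
Definition ann_list (h : X) (l : seq (C * seq X)) : seq (C * seq X) :=
  flatten [seq [seq (p.1 * ((q ^+ d.1.1)%:C * k h d.1.2), d.2) | d <- dels p.2] | p <- l].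

Lemma comb_ann_list h l : comb t (ann_list h l) = comb (ann_word h) l.
Proof.
elim: l => [|[a w] l IHl]; first by rewrite !comb_nil.
rewrite /ann_list /= comb_cat IHl comb_cons; congr (_ + _).
rewrite /comb big_map scaler_sumr; apply: eq_bigr => d _.
by rewrite scalerA.
Qed.

Lemma ip_t_cons h v w : ip (t (h :: v)) (t w) = ip (t v) (ann_word h w).
Proof.
rewrite t_ip qwords_cons hf_sumr; apply: eq_bigr => d _.
by rewrite hfZr /= t_ip.
Qed.

Lemma ip_comb_cons h l l' :
  ip (comb (t \o cons h) l) (comb t l') = ip (comb t l) (comb (ann_word h) l').
Proof.
rewrite hf_suml [RHS]hf_suml; apply: eq_bigr => p _.
rewrite !hfZl !hf_sumr; congr (_ * _); apply: eq_bigr => p' _.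
by rewrite !hfZr /= ip_t_cons.
Qed.

Lemma ann_word_cons h h' w : ann_word h (h' :: w) =
  k h h' *: t w + q%:C *: \sum_(d <- dels w) ((q ^+ d.1.1)%:C * k h d.1.2) *: t (h' :: d.2).
Proof.
rewrite /ann_word /= big_cons /= expr0 mul1r; congr (_ + _).
rewrite big_map scaler_sumr; apply: eq_bigr => d _ /=.
by rewrite scalerA exprS rmorphM mulrA.
Qed.

(** The relation a(h) a^*(h) = <h, h> + q a^*(h) a(h) on combinations, before either operator is
    known to exist. *)
Lemma comb_ann_word_cons h l : comb (ann_word h \o cons h) l =
  k h h *: comb t l + q%:C *: comb (t \o cons h) (ann_list h l).
Proof.
elim: l => [|[a w] l IHl].
  by rewrite !comb_nil !scaler0 addr0.
rewrite !comb_cons IHl /= ann_word_cons /ann_list /= comb_cat -/(ann_list h l).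
rewrite !scalerDr !scalerA [k h h * a]mulrC addrACA; congr (_ + (_ + _)).
rewrite /comb big_map !scaler_sumr; apply: eq_bigr => d _.
by rewrite !scalerA /=; congr (_ *: _); ring.
Qed.

Definition cre_const (h : X) : R := complex.Re (k h h) / (1 - `|q|).

Let q_lt1 : 0 < 1 - `|q|.
Proof. by rewrite subr_gt0 ltr_norml q0 q1. Qed.

Lemma kxx_ge0 h : 0 <= complex.Re (k h h).
Proof.
by have := kp.2 [:: (1, h)]; rewrite /qsum !big_seq1 conjc1 !mul1r.
Qed.

Lemma kxx_real h : k h h = (complex.Re (k h h))%:C.
Proof.
apply: complex_ext => //=; have := kp.1 h h => /(congr1 (@complex.Im R)).
by rewrite Im_conjc; lra.
Qed.

Lemma cre_const_ge0 h : 0 <= cre_const h.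
Proof. by rewrite divr_ge0 ?kxx_ge0// ltW. Qed.

(* Since |a^*(h) xi|^2 = <h,h> |xi|^2 + q |a(h) xi|^2 and |a(h)| on tensors of
   degree n is at most |a^*(h)| on tensors of degree n - 1, the constant
   <h,h> / (1 - |q|) propagates from one degree to the next one. *)
Lemma cre_bound_size n h l : all (fun p => size p.2 <= n)%N l ->
  nrm (comb (t \o cons h) l) ^+ 2 <= cre_const h * nrm (comb t l) ^+ 2.
Proof.
have normE2 l' : nrm (comb (t \o cons h) l') ^+ 2 =
    complex.Re (k h h) * nrm (comb t l') ^+ 2 + q * nrm (comb (ann_word h) l') ^+ 2.
  have mapE (f : seq X -> F) :
      comb f [seq (p.1, h :: p.2) | p <- l'] = comb (f \o cons h) l'.
    by rewrite /comb big_map.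
  rewrite hnorm_sqr /= -{2}mapE ip_comb_cons mapE comb_ann_word_cons hfDr !hfZr /=.
  rewrite ReD {1}kxx_real !ReM_real -hnorm_sqr; congr (_ + _ * _).
  by rewrite (Re_hf_sym (ip_form F)) /= ip_comb_cons comb_ann_list hnorm_sqr.
elim: n l => [|n IHn] l ln.
  rewrite normE2 (_ : comb (ann_word h) l = 0) ?hnorm0 ?expr0n ?mulr0 ?addr0.
    by rewrite ler_wpM2r ?sqr_ge0// /cre_const ler_pdivlMr// ler_piMr ?kxx_ge0// lerBlDr lerDl.
  elim: l ln  => [|[a w] l IHl /= /andP[w0 lw]]; first by rewrite comb_nil.
  rewrite comb_cons IHl// addr0 (_ : w = [::]) ?/ann_word ?big_nil ?scaler0//.
  by case: w w0.
set c := cre_const h; set xi := comb t l; set eta := comb (ann_word h) l.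
have lesz : all (fun p => size p.2 <= n)%N (ann_list h l).
  elim: l ln {xi eta} => //= -[a w] l IHl /= /andP[wn lw].
  rewrite /ann_list /= all_cat IHl// andbT all_map (delsE x0) all_map; apply/allP => i /=.
  rewrite mem_iota add0n => /= iw; rewrite size_cat size_take size_drop iw.
  by rewrite -ltnS; apply: leq_trans wn; lia.
have := IHn _ lesz; rewrite comb_ann_list -/eta -/c => h1.
have h2 : nrm eta ^+ 2 <= nrm (comb (t \o cons h) (ann_list h l)) * nrm xi.
  apply: le_trans (Re_cauchy_schwarz (ip_form F) _ _).
  by rewrite /= ip_comb_cons comb_ann_list -/eta -hnorm_sqr ler_norm.
have e0 := hnorm_ge0 (ip_form F) eta; have x0' := hnorm_ge0 (ip_form F) xi.
have c0 := cre_const_ge0 h; rewrite -/c in c0.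
have h3 : nrm eta ^+ 2 <= c * nrm xi ^+ 2.
  have [->|n0] := eqVneq (nrm eta) 0; first by rewrite expr0n mulr_ge0 ?sqr_ge0.
  have np : 0 < nrm eta ^+ 2 by rewrite exprn_even_gt0.
  rewrite -(ler_pM2l np).
  have := ler_pM (sqr_ge0 _) (sqr_ge0 _) h2 h2; rewrite -expr2 => /le_trans; apply.
  rewrite -expr2 exprMn [X in _ <= X]mulrA [X in _ <= X * _]mulrC.
  by apply: ler_wpM2r h1; exact: sqr_ge0.
rewrite normE2 -/xi -/eta.
have h4 : q * nrm eta ^+ 2 <= `|q| * (c * nrm xi ^+ 2).
  exact: le_trans (ler_wpM2r (sqr_ge0 _) (ler_norm q)) (ler_wpM2l (normr_ge0 q) h3).
have h5 : complex.Re (k h h) = c * (1 - `|q|) by rewrite /c /cre_const divfK ?gt_eqF.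
by rewrite h5; move: h4; set y := nrm xi ^+ 2; lra.
Qed.

Lemma cre_bound h l :
  nrm (comb (t \o cons h) l) <= Num.sqrt (cre_const h) * nrm (comb t l).
Proof.
rewrite -(@ler_pXn2r _ 2)// ?nnegrE ?mulr_ge0 ?hnorm_ge0 ?sqrtr_ge0//.
rewrite exprMn (sqr_sqrtr (cre_const_ge0 h)).
apply: (@cre_bound_size (\max_(p <- l) size p.2)).
elim: l => //= p l IHl; rewrite big_cons leq_maxl /=.
by apply: sub_all IHl => p' h'; rewrite (leq_trans h') ?leq_maxr.
Qed.

Lemma cre_ex h : exists f : F -> F,
  bounded_by (Num.sqrt (cre_const h)) f /\ forall v, f (t v) = t (h :: v).
Proof.
have [f fb ft] := extension tt (sqrtr_ge0 _) (cre_bound h).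
by exists f.
Qed.

Definition cre h : F -> F := sval (cid (cre_ex h)).

Lemma cre_bounded_by h : bounded_by (Num.sqrt (cre_const h)) (cre h).
Proof. exact: (svalP (cid (cre_ex h))).1. Qed.

Lemma cre_t h v : cre h (t v) = t (h :: v).
Proof. exact: (svalP (cid (cre_ex h))).2. Qed.

Lemma cre_bounded h : bounded (cre h).
Proof. by exists (Num.sqrt (cre_const h)); [exact: sqrtr_ge0|exact: cre_bounded_by]. Qed.

Definition ann h : F -> F := sval (cid (adjoint_exists (cre_bounded h))).

Lemma cre_ann h : adjoint (cre h) (ann h).
Proof. exact: (svalP (cid (adjoint_exists (cre_bounded h)))). Qed.

Lemma ann_bounded h : bounded (ann h).
Proof. exact: adjoint_bounded (cre_bounded h) (cre_ann h). Qed.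

Lemma ann_t h w : ann h (t w) = ann_word h w.
Proof. by apply: (total_ext tt) => v; rewrite -cre_ann cre_t ip_t_cons. Qed.

Lemma ann_nil h : ann h (t [::]) = 0.
Proof. by rewrite ann_t /ann_word big_nil. Qed.

Lemma ann_cre h h' u : ann h (cre h' u) = k h h' *: u + q%:C *: cre h' (ann h u).
Proof.
have := @bounded_by_eq_on _ _ F F t (ann h \o cre h')
  (fun u => k h h' *: u + q%:C *: (cre h' \o ann h) u) tt.
apply.
- exact: bounded_comp (ann_bounded _) (cre_bounded _).
- apply: bounded_add; apply: bounded_scale; first exact: bounded_id.
  exact: bounded_comp (cre_bounded _) (ann_bounded _).
move=> w /=; rewrite cre_t !ann_t ann_word_cons; congr (_ + _ *: _).
rewrite /ann_word (lin_sum (bounded_lin (cre_bounded h'))).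
by apply: eq_bigr => d _; rewrite (linZ (bounded_lin (cre_bounded h'))) cre_t.
Qed.

(** Reversing words preserves the q-form. Conjugation by this isometry turns facts about left
    operators into facts about right ones. *)
Lemma flip_ex : exists f : F -> F, bounded_by 1 f /\ forall v, f (t v) = t (rev v).
Proof.
have [|f fb ft] := @extension _ _ F F t (t \o rev) 1 tt ler01; last by exists f.
move=> l; rewrite mul1r /hnorm /= -!(qsum_ip (ip_form F)) /=.
suff -> : qsum (fun v w => ip (t (rev v)) (t (rev w))) l l = qsum (fun v w => ip (t v) (t w)) l l.
  by [].
by apply: eq_bigr => p _; apply: eq_bigr => p' _; rewrite !t_ip qwords_rev.
Qed.

Definition flip : F -> F := sval (cid flip_ex).

Lemma flip_bounded : bounded flip.
Proof. by exists 1 => //; exact: (svalP (cid flip_ex)).1. Qed.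

Lemma flip_t v : flip (t v) = t (rev v).
Proof. exact: (svalP (cid flip_ex)).2. Qed.

Lemma flip_adjoint : adjoint flip flip.
Proof.
have [g fg] := adjoint_exists flip_bounded.
suff e : flip = g by move=> u v; rewrite [in RHS]e fg.
apply/funext => u; apply: (bounded_by_eq_on tt) u; first exact: flip_bounded.
  exact: adjoint_bounded flip_bounded fg.
move=> w; apply: (total_ext tt) => v; rewrite -fg !flip_t !t_ip.
by rewrite -[RHS]qwords_rev revK.
Qed.

Definition rcre h := flip \o cre h \o flip.
Definition rann h := flip \o ann h \o flip.

Lemma rcre_bounded h : bounded (rcre h).
Proof.
by apply: bounded_comp flip_bounded; apply: bounded_comp (cre_bounded h); exact: flip_bounded.
Qed.

Lemma rann_bounded h : bounded (rann h).
Proof.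
by apply: bounded_comp flip_bounded; apply: bounded_comp (ann_bounded h); exact: flip_bounded.
Qed.

Lemma rcre_rann h : adjoint (rcre h) (rann h).
Proof.
have := adjoint_comp (adjoint_comp flip_adjoint (cre_ann h)) flip_adjoint.
by [].
Qed.

Lemma rcre_t h v : rcre h (t v) = t (rcons v h).
Proof. by rewrite /rcre /= flip_t cre_t flip_t rev_cons revK. Qed.

Lemma rann_t h v : rann h (t v) =
  \sum_(d <- dels (rev v)) ((q ^+ d.1.1)%:C * k h d.1.2) *: t (rev d.2).
Proof.
rewrite /rann /= flip_t ann_t /ann_word (lin_sum (bounded_lin flip_bounded)).
by apply: eq_bigr => d _; rewrite (linZ (bounded_lin flip_bounded)) flip_t.
Qed.

Lemma cre_rcre x y u : cre x (rcre y u) = rcre y (cre x u).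
Proof.
have := @bounded_by_eq_on _ _ F F t (cre x \o rcre y) (rcre y \o cre x) tt; apply.
- exact: bounded_comp (cre_bounded _) (rcre_bounded _).
- exact: bounded_comp (rcre_bounded _) (cre_bounded _).
by move=> v; rewrite /= rcre_t !cre_t rcre_t.
Qed.

(** The last letter y sits at position [size v], whence the power of q: the commutator of an
    annihilation operator and a right creation operator is k x y times q^N, with N the degree. *)
Lemma ann_rcre_t x y v : ann x (rcre y (t v)) =
  rcre y (ann x (t v)) + (q ^+ size v)%:C * k x y *: t v.
Proof.
rewrite rcre_t !ann_t /ann_word dels_rcons -cats1 big_cat big_seq1 /=; congr (_ + _).
rewrite (lin_sum (bounded_lin (rcre_bounded y))) big_map; apply: eq_bigr => d _.
by rewrite (linZ (bounded_lin (rcre_bounded y))) rcre_t.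
Qed.

End FockOperators.

(** * Limits of forms, and polarization *)

Section HermitianLimits.
Context {R : realType} {E : lmodType R[i]}.
Variable B : hform E.
Local Notation C := R[i].

Lemma clim_hform u v x y : hlim B u x -> hlim B v y -> clim (fun n => B (u n) (v n)) (B x y).
Proof.
move=> ux vy; have [K K0 hK] := hcauchy_bounded (hlim_cauchy ux).
move=> e e0.
have K1 : 0 < K + 1 by rewrite ltr_wpDl.
have Y1 : 0 < hnorm B y + 1 by rewrite ltr_wpDl ?hnorm_ge0.
have [|N hN] := ux (e / 2 / (hnorm B y + 1)); first by rewrite !divr_gt0.
have [|M hM] := vy (e / 2 / (K + 1)); first by rewrite !divr_gt0.
exists (maxn N M) => n; rewrite geq_max => /andP[/hN h1 /hM h2].
have -> : B (u n) (v n) - B x y = B (u n - x) y + B (u n) (v n - y).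
  by rewrite hfBl hfBr; ring.
apply: le_lt_trans (le_normcD _ _) _.
rewrite ltr_pdivlMr// in h1; rewrite ltr_pdivlMr// in h2.
have c1 := cauchy_schwarz B (u n - x) y.
have c2 := cauchy_schwarz B (u n) (v n - y).
have k2 := ler_wpM2r (hnorm_ge0 B (v n - y)) (hK n).
have := hnorm_ge0 B (u n - x); have := hnorm_ge0 B (v n - y).
move: c1 c2 k2 h1 h2; move: (normc _) (normc _) (hnorm B (u n - x)) (hnorm B (v n - y)).
by move=> a b c d; lra.
Qed.

Lemma clim_ge0 (z : nat -> C) l : clim z l -> (forall n, 0 <= z n) -> 0 <= l.
Proof.
move=> zl z0; apply/complex_ge0P; split.
  apply/eqP; rewrite -normr_eq0; apply/eqP/eq0_of_le_eps => // e e0.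
  have [N /(_ N (leqnn N)) h] := zl e e0.
  apply: le_trans (ltW h); apply: le_trans (Im_le_normc _).
  have /complex_ge0P[i0 _] := z0 N.
  by move: i0; case: (z N) l {zl h} => a b [c d] /= ->; rewrite add0r normrN.
rewrite -subr_le0 sub0r; apply: le_eps => e e0; rewrite add0r.
have [N /(_ N (leqnn N)) h] := zl e e0.
have /complex_ge0P[_ r0] := z0 N.
have := Re_le_normc (z N - l); rewrite ReB ler_norml => /andP[_].
by lra.
Qed.

Lemma clim_sum (I : finType) (z : I -> nat -> C) (l : I -> C) :
  (forall i, clim (z i) (l i)) -> clim (fun n => \sum_i z i n) (\sum_i l i).
Proof.
move=> h; elim: (index_enum I) => [|i r IHr].
  rewrite big_nil (_ : (fun n => _) = fun=> 0); first exact: clim_cst.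
  by apply/funext => n; rewrite big_nil.
rewrite big_cons; have := clim_lin 1 (h i) IHr; rewrite mul1r.
by congr clim; apply/funext => n; rewrite mul1r big_cons.
Qed.

Lemma hlim_seq x (S : set E) : (forall e, 0 < e -> exists2 y, S y & hnorm B (x - y) < e) ->
  exists2 u, (forall n, S (u n)) & hlim B u x.
Proof.
move=> h; have /choice[u hu] : forall n : nat, exists y, S y /\ hnorm B (x - y) < n.+1%:R^-1.
  move=> n; have [|y Sy hy] := h n.+1%:R^-1; first by rewrite invr_gt0.
  by exists y.
exists u => [n|e e0]; first by case: (hu n).
have [N hN] := natS_inv_lt e0; exists N => n /hN.
by apply: lt_trans; rewrite hnormB; case: (hu n).
Qed.

End HermitianLimits.

Section SesquilinearForms.
Context {R : realType} {E : lmodType R[i]}.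
Local Notation C := R[i].
Variable b : E -> E -> C.
Hypothesis br : forall x a u v, b x (a *: u + v) = a * b x u + b x v.
Hypothesis bl : forall x a u v, b (a *: u + v) x = a^* * b u x + b v x.

(** Polarization with u + v and i u + v. It supplies the symmetry that the definitions of positive
    operators and positive matrices leave implicit. *)
Lemma hermitian_of_real : (forall u, complex.Im (b u u) = 0) ->
  forall u v, b v u = (b u v)^*.
Proof.
move=> h u v.
have e1 := h (1 *: u + v); have e2 := h ('i *: u + v).
rewrite !br !bl in e1 e2.
have hu := h u; have hv := h v.
move: e1 e2 hu hv; move: (b u u) (b u v) (b v u) (b v v) => [a1 a2] [b1 b2] [c1 c2] [d1 d2] /=.
by move=> e1 e2 hu hv; apply: complex_ext => /=; lra.
Qed.

End SesquilinearForms.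

Lemma dels_map (X X' : Type) (f : X -> X') w :
  dels (map f w) = [seq (d.1.1, f d.1.2, map f d.2) | d <- dels w].
Proof. by elim: w => //= x w ->; rewrite -!map_comp. Qed.

(** * The dilation space, its Wold decomposition and the compression phi *)

Section Dilation.
Context {R : realType}.
Local Notation C := R[i].
Variables (q : R) (q0 : -1 < q) (q1 : q < 1).
Context {K H : complexHilbert R}.
Variables (T : K -> H) (Ts : H -> K).
Hypotheses (T_adj : adjoint T Ts) (T_contr : bounded_by 1 T).

Let Ts_contr : bounded_by 1 Ts.
Proof. exact: adjoint_bounded_by ler01 T_contr T_adj. Qed.

(* The dilation space is the sum of K and H in which <k, h> = <T k, h>. *)
Definition dkernel (x y : K + H) : C :=
  match x, y with
  | inl a, inl b => ip a b
  | inl a, inr h => ip (T a) h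
  | inr h, inl a => ip h (T a)
  | inr h, inr h' => ip h h'
  end.

(** The form of 1 - T T^*, nonnegative because T^* is a contraction too. *)
Definition defect (h h' : H) : C := ip h h' - ip (Ts h) (Ts h').

Let defect_linear h a h1 h2 : defect h (a *: h1 + h2) = a * defect h h1 + defect h h2.
Proof. by rewrite /defect Ts_contr.1 !ip_linear opprD addrACA -mulrBr. Qed.

Let defect_sym h h' : defect h' h = (defect h h')^*.
Proof. by rewrite /defect rmorphB /= -!ip_conj. Qed.

Let defect_ge0 h : 0 <= complex.Re (defect h h).
Proof.
rewrite /defect ReB subr_ge0 -[ip h h]/(ip_form H h h) -[ip _ _]/(ip_form K _ _).
rewrite -!hnorm_sqr ler_pXn2r ?nnegrE ?hnorm_ge0//.
by have := Ts_contr.2 h; rewrite mul1r.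
Qed.

Let defect_hform := HForm defect_linear defect_sym defect_ge0.

(** Represent k by (k, 0) and h by (T^* h, h), the second component being measured by the defect:
    the resulting inner products are those of [dkernel]. *)
Lemma psd_dkernel : psd_kernel dkernel.
Proof.
have := psd_add
  (psd_comp (fun x : K + H => match x with inl a => a | inr h => Ts h end)
    (psd_hform (ip_form K) idfun))
  (psd_comp (fun x : K + H => match x with inl a => 0 | inr h => h end)
    (psd_hform defect_hform idfun)).
congr psd_kernel; apply/funext => -[a|h]; apply/funext => -[b|h'] /=.
- by rewrite /defect (lin0 Ts_contr.1) !hf0l subrr addr0.
- by rewrite -T_adj /defect (lin0 Ts_contr.1) !hf0l subrr addr0.
- by rewrite -(adjoint_sym T_adj) /defect (lin0 Ts_contr.1) !hf0r subrr addr0.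
- by rewrite /defect addrC subrK.
Qed.

Context {FK FH L : complexHilbert R}.
Variables (tK : seq K -> FK) (tH : seq H -> FH) (tL : seq (K + H) -> L).
Hypotheses (tK_ip : forall v w, ip (tK v) (tK w) = qwords q (@ip _ _ K) 0 v w).
Hypotheses (tH_ip : forall v w, ip (tH v) (tH w) = qwords q (@ip _ _ H) 0 v w).
Hypotheses (tL_ip : forall v w, ip (tL v) (tL w) = qwords q dkernel (inl 0) v w).
Hypotheses (tK_tot : total tK) (tH_tot : total tH) (tL_tot : total tL).

Let kpK : psd_kernel (@ip _ _ K) := psd_hform (ip_form K) idfun.
Let kpH : psd_kernel (@ip _ _ H) := psd_hform (ip_form H) idfun.

Local Notation cK := (cre q0 q1 kpK tK_ip tK_tot).
Local Notation aK := (ann q0 q1 kpK tK_ip tK_tot).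
Local Notation cH := (cre q0 q1 kpH tH_ip tH_tot).
Local Notation aH := (ann q0 q1 kpH tH_ip tH_tot).
Local Notation cL := (cre q0 q1 psd_dkernel tL_ip tL_tot).
Local Notation aL := (ann q0 q1 psd_dkernel tL_ip tL_tot).
Local Notation rL := (rcre q0 q1 psd_dkernel tL_ip tL_tot).

Definition vacuum_vec (n : L) := forall a : K, aL (inl a) n = 0.

Definition cre_word (n : L) (v : seq K) : L := foldr (fun a u => cL (inl a) u) n v.

Let cL_lin x : linear (cL x). Proof. exact: bounded_lin (cre_bounded _ _ _ _ _ _). Qed.
Let aL_lin x : linear (aL x). Proof. exact: bounded_lin (ann_bounded _ _ _ _ _ _). Qed.
Let rL_lin x : linear (rL x). Proof. exact: bounded_lin (rcre_bounded _ _ _ _ _ _). Qed.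

Lemma ann_cre_word n a w : vacuum_vec n -> aL (inl a) (cre_word n w) =
  \sum_(d <- dels w) ((q ^+ d.1.1)%:C * ip a d.1.2) *: cre_word n d.2.
Proof.
move=> n0; elim: w => [|b w IHw] /=; first by rewrite big_nil n0.
rewrite ann_cre IHw big_cons /= expr0 mul1r; congr (_ + _).
rewrite big_map (lin_sum (cL_lin _)) scaler_sumr; apply: eq_bigr => d _ /=.
by rewrite (linZ (cL_lin _)) scalerA exprS rmorphM mulrA.
Qed.

(** For the operators of K, a vacuum vector n behaves as the vacuum of F_q(K), up to the scale
    |n|. *)
Lemma ip_cre_word n n' v w : vacuum_vec n -> vacuum_vec n' ->
  ip (cre_word n v) (cre_word n' w) = qwords q (@ip _ _ K) 0 v w * ip n n'.
Proof.
move=> n0 n0'; elim: v w => [|a v IHv] w /=.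
  case: w => [|b w] /=; first by rewrite qwords_nil mul1r.
  by rewrite qwords_size// mul0r -(adjoint_sym (cre_ann _ _ _ _ _ _)) n0 hf0l.
rewrite cre_ann ann_cre_word// hf_sumr qwords_cons mulr_suml; apply: eq_bigr => d _.
by rewrite hfZr /= IHv mulrA.
Qed.

Let vac := {n : L | vacuum_vec n}.

Lemma theta_ex (n : vac) : exists f : FK -> L,
  bounded_by (nrm (sval n)) f /\ forall v, f (tK v) = cre_word (sval n) v.
Proof.
have [|f fb ft] :=
  @extension _ _ FK L tK (cre_word (sval n)) _ tK_tot (hnorm_ge0 (ip_form L) (sval n)).
  2: by exists f.
move=> l; rewrite -(@ler_pXn2r _ 2)// ?nnegrE ?mulr_ge0 ?hnorm_ge0// exprMn.
rewrite !hnorm_sqr /= -!(qsum_ip (ip_form _)) /=.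
have -> : qsum (fun v w => ip (cre_word (sval n) v) (cre_word (sval n) w)) l l =
    qsum (fun v w => ip (tK v) (tK w)) l l * ip (sval n) (sval n).
  rewrite /qsum mulr_suml; apply: eq_bigr => p _; rewrite mulr_suml.
  apply: eq_bigr => p' _; rewrite ip_cre_word ?tK_ip ?mulrA//; exact: (svalP n).
rewrite -[ip (sval n) _]/(ip_form L _ _) hfxx mulrC ReM_real hnorm_sqr.
by [].
Qed.

Definition theta (n : vac) : FK -> L := sval (cid (theta_ex n)).

Lemma theta_bounded n : bounded (theta n).
Proof. by exists (nrm (sval n)); [exact: hnorm_ge0|exact: (svalP (cid (theta_ex n))).1]. Qed.

Lemma theta_t n v : theta n (tK v) = cre_word (sval n) v.
Proof. exact: (svalP (cid (theta_ex n))).2. Qed.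

(** So [theta n e] behaves as the tensor of e and n, and L as F_q(K) tensored with the space of
    vacuum vectors. *)
Lemma ip_theta n n' e e' : ip (theta n e) (theta n' e') = ip e e' * ip (sval n) (sval n').
Proof.
have [g hg] := adjoint_exists (theta_bounded n).
have gb := adjoint_bounded (theta_bounded n) hg.
have step v : g (theta n' (tK v)) = ip (sval n) (sval n') *: tK v.
  apply: (total_ext tK_tot) => w; rewrite -hg !theta_t.
  rewrite (ip_cre_word _ _ (svalP n) (svalP n')) [RHS](hfZr (ip_form FK)) mulrC.
  by congr (_ * _); exact/esym/tK_ip.
have := bounded_by_eq_on tK_tot (bounded_comp gb (theta_bounded n'))
  (bounded_scale (ip (sval n) (sval n')) (@bounded_id _ FK)) step e'.
by rewrite /= hg => ->; rewrite hfZr /= mulrC.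
Qed.

(** The commutator of an annihilation operator and a right creation operator is a multiple of the
    identity in each degree separately, so vacuum vectors are built in a fixed degree j. *)
Definition hom (j : nat) (n : L) :=
  exists2 l, all (fun p => size p.2 == j) l & n = comb tL l.

Lemma hom_lin j a n n' : hom j n -> hom j n' -> hom j (a *: n + n').
Proof.
move=> [l hl ->] [l' hl' ->].
exists ([seq (a * p.1, p.2) | p <- l] ++ l'); last by rewrite comb_cat comb_scale.
by rewrite all_cat hl' andbT all_map.
Qed.

Lemma hom_cre j x n : hom j n -> hom j.+1 (cL x n).
Proof.
move=> [l hl ->]; exists [seq (p.1, x :: p.2) | p <- l].
  by rewrite all_map; apply: sub_all hl => p /= /eqP ->.
rewrite (lin_comb _ _ (cL_lin x)) /comb big_map; apply: eq_bigr => p _ /=.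
by rewrite cre_t.
Qed.

Lemma hom_rcre j x n : hom j n -> hom j.+1 (rL x n).
Proof.
move=> [l hl ->]; exists [seq (p.1, rcons p.2 x) | p <- l].
  by rewrite all_map; apply: sub_all hl => p /= /eqP; rewrite size_rcons => ->.
rewrite (lin_comb _ _ (rL_lin x)) /comb big_map; apply: eq_bigr => p _ /=.
by rewrite rcre_t.
Qed.

Lemma ann_rcre_hom j x y n : hom j n ->
  aL x (rL y n) = rL y (aL x n) + (q ^+ j)%:C * dkernel x y *: n.
Proof.
move=> [l hl ->]; elim: l hl => [_|[a w] l IHl /= /andP[/eqP wj /IHl e]].
  by rewrite comb_nil (lin0 (rL_lin y)) (lin0 (aL_lin x)) (lin0 (rL_lin y)) scaler0 addr0.
rewrite comb_cons rL_lin aL_lin e ann_rcre_t wj aL_lin rL_lin scalerDr.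
by rewrite addrACA -addrA scalerDr !scalerA [_ * a]mulrC addrA addrA.
Qed.

Let hvac := {n : L | vacuum_vec n /\ exists j, hom j n}.

(** An algebraic span: right multiplication by a letter maps it into itself exactly, so it contains
    every word. *)
Let wold (u : L) := exists l : seq (C * (hvac * seq K)),
  u = comb (fun p => cre_word (sval p.1) p.2) l.

Let wold0 : wold 0. Proof. by exists [::]; rewrite comb_nil. Qed.

Let wold_lin a u v : wold u -> wold v -> wold (a *: u + v).
Proof.
move=> [l ->] [l' ->]; exists ([seq (a * p.1, p.2) | p <- l] ++ l').
by rewrite comb_cat comb_scale.
Qed.

Let wold_cre_word n v : vacuum_vec n -> (exists j, hom j n) -> wold (cre_word n v).
Proof.
move=> h h'; exists [:: (1, (exist _ n (conj h h') : hvac, v))].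
by rewrite comb1.
Qed.

Let cre_word_lin v a n n' : cre_word (a *: n + n') v = a *: cre_word n v + cre_word n' v.
Proof. by elim: v => //= b v ->; rewrite cL_lin. Qed.

Let rcre_word x n v : rL x (cre_word n v) = cre_word (rL x n) v.
Proof. by elim: v => //= a v <-; rewrite cre_rcre. Qed.

Let wold_rinl n v a j : vacuum_vec n -> hom j n -> wold (cre_word (rL (inl a) n) v).
Proof.
move=> n0 nj.
pose n' := -(q ^+ j)%:C *: cL (inl a) n + rL (inl a) n.
have e : rL (inl a) n = (q ^+ j)%:C *: cL (inl a) n + n'.
  by rewrite /n' addrA scaleNr subrr add0r.
rewrite e cre_word_lin; apply: wold_lin.
  have -> : cre_word (cL (inl a) n) v = cre_word n (rcons v a).
    by rewrite /cre_word -cats1 foldr_cat.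
  by apply: wold_cre_word => //; exists j.
apply: wold_cre_word; last by exists j.+1; apply: hom_lin; [exact: hom_cre|exact: hom_rcre].
move=> b; rewrite /n' aL_lin ann_cre (ann_rcre_hom _ _ nj) n0.
rewrite (lin0 (rL_lin _)) (lin0 (cL_lin _)) scaler0 addr0 add0r scalerA mulNr scaleNr.
by rewrite addNr.
Qed.

(* Wold decomposition: multiplying a vacuum vector n of degree j on the right by
   a in K, one gets q^j a n plus a vacuum vector; multiplying it by h in H, one
   gets a vacuum vector plus the product by T^* h. *)
Let wold_rcre x u : wold u -> wold (rL x u).
Proof.
move=> [l ->]; rewrite (lin_comb _ _ (rL_lin x)).
elim: l => [|[a [n v]] l IHl]; first by rewrite comb_nil.
rewrite comb_cons; apply: wold_lin => //= {IHl}.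
case: n => n [n0 [j nj]] /=; rewrite rcre_word.
case: x => [b|h]; first exact: wold_rinl nj.
have -> : rL (inr h) n = 1 *: rL (inl (Ts h)) n + (-1 *: rL (inl (Ts h)) n + rL (inr h) n).
  by rewrite addrA scale1r scaleN1r subrr add0r.
rewrite cre_word_lin; apply: wold_lin; first exact: wold_rinl nj.
apply: wold_cre_word; last by exists j.+1; apply: hom_lin; exact: hom_rcre.
move=> b; rewrite aL_lin !(ann_rcre_hom _ _ nj) n0 !(lin0 (rL_lin _)) !add0r.
by rewrite /= T_adj scaleN1r addNr.
Qed.

Let wold_t w : wold (tL w).
Proof.
elim/last_ind: w => [|w x IHw].
  have := @wold_cre_word (tL [::]) [::]; apply; first by move=> a; rewrite ann_nil.
  by exists 0; exists [:: (1, [::])]; rewrite ?comb1.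
by have := wold_rcre x IHw; rewrite rcre_t.
Qed.

Lemma theta_total : total (fun p : vac * FK => theta p.1 p.2).
Proof.
have w2 u : wold u -> exists l, u = comb (fun p : vac * FK => theta p.1 p.2) l.
  move=> [l ->]; elim: l => [|[a [[n [n0 nj]] v]] l [l' IHl]].
    by exists [::]; rewrite !comb_nil.
  exists ((a, (exist _ n n0 : vac, tK v)) :: l').
  by rewrite !comb_cons IHl /= theta_t.
move=> u e /(tL_tot u)[l hl].
have [l' hl'] : exists l', comb tL l = comb (fun p : vac * FK => theta p.1 p.2) l'.
  apply: w2; elim: l {hl} => [|[a w] l IHl]; first by rewrite comb_nil.
  by rewrite comb_cons; exact: wold_lin.
by exists l'; rewrite -hl'.
Qed.

Definition is_dilate (x : FK -> FK) (f : L -> L) :=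
  bounded f /\ forall n e, f (theta n e) = theta n (x e).

(** The kernel c^2 <u, v> - <x u, x v> is positive, hence so is its Schur product with the Gram
    kernel of the vacuum vectors; this is the difference of the squared norms to be compared. The
    bound c itself is kept, which [phi_small] needs for uniformity. *)
Lemma dilate_ex_by x c : 0 <= c -> bounded_by c x -> exists2 f, bounded_by c f & is_dilate x f.
Proof.
move=> c0 xc.
pose B (u v : FK) : C := (c ^+ 2)%:C * ip u v - ip (x u) (x v).
have Bl u a v w : B u (a *: v + w) = a * B u v + B u w.
  by rewrite /B xc.1 !ip_linear mulrDr mulrCA opprD addrACA -mulrBr.
have Bs u v : B v u = (B u v)^*.
  by rewrite /B rmorphB /= (conjM (_ %:C)) conjR -!ip_conj.
have B0 u : 0 <= complex.Re (B u u).
  rewrite /B ReB ReM_real -[ip u u]/(ip_form _ u u) -[ip (x u) _]/(ip_form _ _ _).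
  rewrite -!hnorm_sqr -exprMn subr_ge0 ler_pXn2r ?nnegrE ?mulr_ge0 ?hnorm_ge0//.
  exact: xc.2.
have kp := psd_mul (psd_comp (fun p : vac * FK => p.2) (psd_hform (HForm Bl Bs B0) idfun))
  (psd_comp (fun p : vac * FK => sval p.1) (psd_hform (ip_form L) idfun)).
have [|f fb ft] := @extension _ _ L L (fun p : vac * FK => theta p.1 p.2)
  (fun p => theta p.1 (x p.2)) c theta_total c0; last first.
- by exists f => //; split; [exists c|move=> n e; exact: (ft (n, e))].
move=> l; rewrite -(@ler_pXn2r _ 2)// ?nnegrE ?mulr_ge0 ?hnorm_ge0// exprMn.
rewrite !hnorm_sqr /= -!(qsum_ip (ip_form _)) -ReM_real -subr_ge0 -ReB.
have := kp.2 l; congr (_ <= complex.Re _).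
rewrite /qsum mulr_sumr -sumrB; apply: eq_bigr => p _.
rewrite mulr_sumr -sumrB; apply: eq_bigr => p' _ /=.
by rewrite !ip_theta /B; ring.
Qed.

Lemma dilate_ex x : bounded x -> exists f, is_dilate x f.
Proof. by move=> [c c0 xc]; have [f _ ?] := dilate_ex_by c0 xc; exists f. Qed.

(** x tensored with the identity of the vacuum vectors; the default value can occur for unbounded x
    only. *)
Definition dilate (x : FK -> FK) : L -> L := xget (idfun : L -> L) [set f | is_dilate x f].

Lemma dilateP x : bounded x -> is_dilate x (dilate x).
Proof. by move=> /dilate_ex[f hf]; exact: (xgetPex (idfun : L -> L) (ex_intro _ f hf)). Qed.

Lemma dilate_bounded x : bounded x -> bounded (dilate x).
Proof. by move=> /dilateP[]. Qed.

Lemma dilate_theta x n e : bounded x -> dilate x (theta n e) = theta n (x e).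
Proof. by move=> /dilateP[_ ->]. Qed.

Lemma dilate_uniq x f : bounded x -> is_dilate x f -> dilate x = f.
Proof.
move=> xb [fb ft]; apply/funext; apply: (bounded_by_eq_on theta_total) => //.
  exact: dilate_bounded.
by move=> p; rewrite dilate_theta// ft.
Qed.

Lemma dilate_bounded_by c x : 0 <= c -> bounded_by c x -> bounded_by c (dilate x).
Proof.
move=> c0 xc; have [f fc fx] := dilate_ex_by c0 xc.
by rewrite (dilate_uniq _ fx)//; exists c.
Qed.

Lemma dilate_id : dilate idfun = idfun.
Proof. by apply: dilate_uniq => //; [exact: bounded_id|split => //; exact: bounded_id]. Qed.

Lemma dilate_lin a x y : bounded x -> bounded y -> dilate (a *: x + y) = a *: dilate x + dilate y.
Proof.
move=> xb yb; apply: dilate_uniq; first exact: bounded_add (bounded_scale a xb) yb.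
split; first exact: bounded_add (bounded_scale a (dilate_bounded xb)) (dilate_bounded yb).
move=> n e; rewrite -[LHS]/(a *: dilate x _ + dilate y _) !dilate_theta//.
by rewrite -[RHS]/(theta n (a *: x e + y e)) (bounded_lin (theta_bounded n)).
Qed.

Lemma dilate_comp x y : bounded x -> bounded y -> dilate (x \o y) = dilate x \o dilate y.
Proof.
move=> xb yb; apply: dilate_uniq; first exact: bounded_comp.
by split=> [|n e]; [apply: bounded_comp; exact: dilate_bounded|rewrite /= !dilate_theta].
Qed.

Lemma dilate_adjoint x y : bounded x -> adjoint x y -> adjoint (dilate x) (dilate y).
Proof.
move=> xb xy; have yb := adjoint_bounded xb xy.
have [z xz] := adjoint_exists (dilate_bounded xb).
rewrite (_ : dilate y = z)//; apply: dilate_uniq => //; split.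
  exact: (adjoint_bounded (dilate_bounded xb) xz).
move=> n e; apply: (total_ext theta_total) => -[n' e'].
by rewrite -xz dilate_theta// !ip_theta xy.
Qed.

Lemma dilate_cre a : dilate (cK a) = cL (inl a).
Proof.
apply: dilate_uniq; first exact: cre_bounded.
split; first exact: cre_bounded.
move=> n e; have := bounded_by_eq_on tK_tot
  (bounded_comp (cre_bounded q0 q1 psd_dkernel tL_ip tL_tot (inl a)) (theta_bounded n))
  (bounded_comp (theta_bounded n) (cre_bounded q0 q1 kpK tK_ip tK_tot a)).
by apply=> v; rewrite /= cre_t !theta_t.
Qed.

Lemma dilate_ann a : dilate (aK a) = aL (inl a).
Proof.
apply: (@adjoint_uniq _ _ _ (cL (inl a))); last exact: cre_ann.
by rewrite -dilate_cre; apply: dilate_adjoint; [exact: cre_bounded|exact: cre_ann].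
Qed.

Lemma J_ex : exists f : FH -> L, bounded f /\ forall w, f (tH w) = tL (map inr w).
Proof.
have [|f fb ft] := @extension _ _ FH L tH (fun w => tL (map inr w)) 1 tH_tot ler01.
  move=> l; rewrite mul1r /hnorm /= -!(qsum_ip (ip_form _)) /=.
  suff -> : qsum (fun v w => ip (tL (map inr v)) (tL (map inr w))) l l =
    qsum (fun v w => ip (tH v) (tH w)) l l by [].
  apply: eq_bigr => p _; apply: eq_bigr => p' _.
  by rewrite tL_ip tH_ip (qwords_map _ _ _ _ (0 : H)).
by exists f; split => //; exists 1.
Qed.

Definition J : FH -> L := sval (cid J_ex).

Lemma J_bounded : bounded J.
Proof. exact: (svalP (cid J_ex)).1. Qed.

Lemma J_t w : J (tH w) = tL (map inr w).
Proof. exact: (svalP (cid J_ex)).2. Qed.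

Definition Js : L -> FH := sval (cid (adjoint_exists J_bounded)).

Lemma J_adj : adjoint J Js.
Proof. exact: (svalP (cid (adjoint_exists J_bounded))). Qed.

Lemma Js_bounded : bounded Js.
Proof. exact: adjoint_bounded J_bounded J_adj. Qed.

Lemma JsJ u : Js (J u) = u.
Proof.
have := bounded_by_eq_on tH_tot (bounded_comp Js_bounded J_bounded) (@bounded_id _ FH).
apply=> w /=; apply: (total_ext tH_tot) => v.
by rewrite -J_adj !J_t tL_ip tH_ip (qwords_map _ _ _ _ (0 : H)).
Qed.

(** On words in H, a letter a of K is paired with h as T a is: this is the purpose of the form
    chosen on the sum of K and H. *)
Lemma ann_J a u : aL (inl a) (J u) = J (aH (T a) u).
Proof.
have := bounded_by_eq_on tH_tot
  (bounded_comp (ann_bounded q0 q1 psd_dkernel tL_ip tL_tot (inl a)) J_bounded)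
  (bounded_comp J_bounded (ann_bounded q0 q1 kpH tH_ip tH_tot (T a))).
apply=> w /=; rewrite J_t !ann_t /ann_word dels_map big_map (lin_sum (bounded_lin J_bounded)).
by apply: eq_bigr => d _; rewrite (linZ (bounded_lin J_bounded)) J_t.
Qed.

Lemma Js_cre a u : Js (cL (inl a) u) = cH (T a) (Js u).
Proof.
apply: ip_ext => z; rewrite -J_adj -(adjoint_sym (cre_ann _ _ _ _ _ _)).
by rewrite ann_J J_adj (adjoint_sym (cre_ann _ _ _ _ _ _)).
Qed.

Definition phi (x : FK -> FK) : FH -> FH := Js \o dilate x \o J.

Lemma ip_phi x u v : ip u (phi x v) = ip (J u) (dilate x (J v)).
Proof. by rewrite /phi /= J_adj. Qed.

Lemma phi_id : phi idfun = idfun.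
Proof. by apply/funext => u; rewrite /phi /= dilate_id JsJ. Qed.

Lemma phi_lin a x y : bounded x -> bounded y -> phi (a *: x + y) = a *: phi x + phi y.
Proof.
move=> xb yb; apply/funext => u; rewrite /phi /= dilate_lin//.
by rewrite -[(a *: _ + _) (J u)]/(a *: dilate x (J u) + dilate y (J u)) (bounded_lin Js_bounded).
Qed.

Definition op_word (F : Type) (X : Type) (c : X -> F -> F) (s : seq X) (u : F) : F :=
  foldr c u s.

Lemma op_word_cons (F X : Type) (c : X -> F -> F) x s :
  op_word c (x :: s) = c x \o op_word c s.
Proof. by []. Qed.

Lemma op_word_bounded (F : complexHilbert R) (X : Type) (c : X -> F -> F) s :
  (forall x, bounded (c x)) -> bounded (op_word c s).
Proof.
move=> cb; elim: s => [|x s IHs]; first exact: bounded_id.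
by rewrite op_word_cons; exact: bounded_comp.
Qed.

(** Normal ordering is essential: annihilation operators pass through J and creation operators
    through its adjoint, each becoming that of T a, whereas a creation operator to the right of an
    annihilation operator would reach neither. *)
Lemma phi_normal_word r s : phi (op_word cK r \o op_word aK s) =
  op_word cH (map T r) \o op_word aH (map T s).
Proof.
have cb := cre_bounded q0 q1 kpK tK_ip tK_tot.
have ab := ann_bounded q0 q1 kpK tK_ip tK_tot.
apply/funext => u; rewrite /phi /= dilate_comp; last 2 first.
- exact: op_word_bounded.
- exact: op_word_bounded.
rewrite [LHS]/=.
have -> : dilate (op_word aK s) (J u) = J (op_word aH (map T s) u).
  elim: s => [|a s IHs] /=; first by rewrite dilate_id.
  by rewrite op_word_cons dilate_comp ?dilate_ann /= ?IHs ?ann_J//; exact: op_word_bounded.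
elim: r => [|a r IHr] /=; first by rewrite dilate_id JsJ.
by rewrite op_word_cons dilate_comp ?dilate_cre /= ?Js_cre ?IHr//; exact: op_word_bounded.
Qed.

Lemma vacuum_nil : vacuum_vec (tL [::]).
Proof. by move=> a; rewrite ann_nil. Qed.

(** J sends the vacuum to that of L, which is [theta n] of the vacuum of F_q(K) for n the vacuum of
    L. *)
Lemma phi_vacuum x : bounded x -> ip (tH [::]) (phi x (tH [::])) = ip (tK [::]) (x (tK [::])).
Proof.
move=> xb; rewrite ip_phi J_t /=.
have -> : tL [::] = theta (exist _ _ vacuum_nil) (tK [::]) by rewrite theta_t.
by rewrite dilate_theta// ip_theta /= tL_ip qwords_nil mulr1.
Qed.

(** Strong continuity of phi on bounded sets, with d uniform in p: J u is close to a finite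
    combination of vectors theta n e, on which [dilate p] only sees the values p e, and the bound c
    controls the remainder. *)
Lemma phi_small c u e : 0 <= c -> 0 < e -> exists m (f : 'I_m -> FK), exists2 d, 0 < d &
  forall p, bounded_by c p -> (forall i, nrm (p (f i)) <= d) -> nrm (phi p u) <= e.
Proof.
move=> c0 e0; have [b b0 [jl jb]] := Js_bounded.
have b1 : 0 < b + 1 by rewrite ltr_wpDl.
have c1 : 0 < c + 1 by rewrite ltr_wpDl.
have [|l hl] := @theta_total (J u) (e / 2 / (b + 1) / (c + 1)); first by rewrite !divr_gt0.
pose S := \sum_(p <- l) normc p.1 * nrm (sval p.2.1).
have S0 : 0 <= S by rewrite sumr_ge0// => p _; rewrite mulr_ge0 ?normc_ge0 ?hnorm_ge0.
have S1 : 0 < S + 1 by rewrite ltr_wpDl.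
exists (size l), (fun i => (tnth (in_tuple l) i).2.2), (e / 2 / (b + 1) / (S + 1)).
  by rewrite !divr_gt0.
move=> p pc hp; have [pl pb] := dilate_bounded_by c0 pc.
have pbd : bounded p by exists c.
have h1 : nrm (dilate p (comb (fun p : vac * FK => theta p.1 p.2) l)) <= e / 2 / (b + 1).
  rewrite (lin_comb _ _ pl); apply: le_trans (hnorm_sum _ _ _ _) _.
  apply: le_trans (_ : _ <= S * (e / 2 / (b + 1) / (S + 1))) _.
    rewrite /S mulr_suml big_tnth [X in _ <= X]big_tnth; apply: ler_sum => i _.
    rewrite hnormZ -mulrA ler_wpM2l ?normc_ge0//= dilate_theta//.
    apply: le_trans ((svalP (cid (theta_ex _))).1.2 _) _.
    by rewrite ler_wpM2l ?hnorm_ge0.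
  apply: le_trans (ler_mulD1 _ _) _; first by rewrite !divr_ge0 ?ltW.
  by rewrite mulrC divfK ?gt_eqF.
have h2 : nrm (dilate p (J u)) <= e / (b + 1).
  have -> : J u = (J u - comb (fun p : vac * FK => theta p.1 p.2) l) +
     comb (fun p : vac * FK => theta p.1 p.2) l by rewrite subrK.
  rewrite (linD pl); apply: le_trans (hnorm_triangle _ _ _) _.
  have h3 := pb (J u - comb (fun p : vac * FK => theta p.1 p.2) l).
  have h4 : c * nrm (J u - comb (fun p : vac * FK => theta p.1 p.2) l) <= e / 2 / (b + 1).
    apply: le_trans (ler_mulD1 _ (hnorm_ge0 _ _)) _.
    by rewrite mulrC -ler_pdivlMr// ltW.
  have -> : e / (b + 1) = e / 2 / (b + 1) + e / 2 / (b + 1) by field; rewrite gt_eqF.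
  by rewrite lerD// (le_trans h3 h4).
apply: le_trans (jb _) _; apply: le_trans (ler_mulD1 _ (hnorm_ge0 _ _)) _.
by rewrite mulrC -ler_pdivlMr.
Qed.

(** Positivity of the matrix X is that of the kernel <u, X_ij v> in (i, u) and (j, v). Its Schur
    product with the Gram kernel of the vacuum vectors describes the matrix of dilations on
    combinations of vectors theta n e, of which each J (u i) is a limit. *)
Lemma phi_cp n (X : 'I_n -> 'I_n -> FK -> FK) : (forall i j, bounded (X i j)) ->
  positive_matrix X -> positive_matrix (fun i j => phi (X i j)).
Proof.
move=> Xb Xp u.
pose k (x y : 'I_n * FK) : C := ip x.2 (X x.1 y.1 y.2).
(* Gathers, for each i, the vectors of the list that carry the index i. *)
pose V (l : seq (C * ('I_n * FK))) (i : 'I_n) : FK :=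
  \sum_(p <- l) (p.1 * (p.2.1 == i)%:R) *: p.2.2.
have kV l l' : qsum k l l' = \sum_i \sum_j ip (V l i) (X i j (V l' j)).
  under [RHS]eq_bigr => i _ do under eq_bigr => j _ do
    rewrite /V (lin_sum (bounded_lin (Xb i j))) hf_suml.
  rewrite /qsum; under [RHS]eq_bigr => i _ do rewrite exchange_big.
  rewrite [RHS]exchange_big; apply: eq_bigr => p _ /=.
  under [RHS]eq_bigr => i _ do (under eq_bigr => j _ do rewrite hf_sumr); rewrite /=.
  under [RHS]eq_bigr => i _ do rewrite exchange_big.
  rewrite [RHS]exchange_big; apply: eq_bigr => p' _ /=.
  rewrite (bigD1 p.2.1)//= (bigD1 p'.2.1)//= !eqxx !mulr1.
  rewrite [X in _ + X]big1; last first.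
    move=> i /negbTE ip2; rewrite big1// => j _.
    by rewrite eq_sym ip2 mulr0 scale0r hf0l.
  rewrite [X in _ + X + _]big1 ?addr0; last first.
    move=> j /negbTE jp2.
    by rewrite [p'.2.1 == j]eq_sym jp2 mulr0 scale0r (lin0 (bounded_lin (Xb _ _))) hf0r.
  by rewrite (linZ (bounded_lin (Xb _ _))) hfZl hfZr mulrA.
have kp : psd_kernel k.
  split=> [x y|l]; last first.
    by rewrite kV; have /complex_ge0P[] := Xp (V l).
  have := @hermitian_of_real _ ('I_n -> FK) (fun u v => \sum_i \sum_j ip (u i) (X i j (v j))).
  move=> /(_ _ _ _ (fun i => (i == x.1)%:R *: x.2) (fun i => (i == y.1)%:R *: y.2)).
  have E (a b : 'I_n * FK) :
      \sum_i \sum_j ip ((i == a.1)%:R *: a.2) (X i j ((j == b.1)%:R *: b.2)) = k a b.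
    rewrite (bigD1 a.1)//= (bigD1 b.1)//= !eqxx !scale1r big1; last first.
      by move=> j /negbTE ->; rewrite scale0r (lin0 (bounded_lin (Xb _ _))) hf0r.
    rewrite big1 ?addr0// => i /negbTE ->.
    by rewrite big1// => j _; rewrite scale0r hf0l.
  rewrite !E; apply.
  - move=> w a v v'; rewrite mulr_sumr -big_split; apply: eq_bigr => i _ /=.
    rewrite mulr_sumr -big_split; apply: eq_bigr => j _ /=.
    rewrite -[(a *: v + v') j]/(a *: v j + v' j) (bounded_lin (Xb i j)).
    by rewrite hfDr hfZr.
  - move=> w a v v'; rewrite mulr_sumr -big_split; apply: eq_bigr => i _ /=.
    rewrite mulr_sumr -big_split; apply: eq_bigr => j _ /=.
    by rewrite -[(a *: v + v') i]/(a *: v i + v' i) hfDl hfZl.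
  - by move=> w; have /complex_ge0P[] := Xp w.
have kp2 := psd_mul (psd_comp (fun p : 'I_n * (vac * FK) => (p.1, p.2.2)) kp)
  (psd_comp (fun p : 'I_n * (vac * FK) => sval p.2.1) (psd_hform (ip_form L) idfun)).
have pos (l : 'I_n -> seq (C * (vac * FK))) :
    0 <= \sum_i \sum_j ip (comb (fun p => theta p.1 p.2) (l i))
      (dilate (X i j) (comb (fun p => theta p.1 p.2) (l j))).
  pose ll := flatten [seq [seq (p.1, (i, p.2)) | p <- l i] | i <- index_enum 'I_n].
  have -> : \sum_i \sum_j ip (comb (fun p => theta p.1 p.2) (l i))
      (dilate (X i j) (comb (fun p => theta p.1 p.2) (l j))) =
    qsum (fun p p' => k (p.1, p.2.2) (p'.1, p'.2.2) * ip (sval p.2.1) (sval p'.2.1)) ll ll.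
    rewrite /qsum big_flatten big_map; apply: eq_bigr => i _.
    rewrite big_map.
    under [RHS]eq_bigr => p _ do rewrite big_flatten big_map.
    rewrite [RHS]exchange_big; apply: eq_bigr => j _ /=.
    rewrite (lin_comb _ _ (bounded_lin (dilate_bounded (Xb i j)))) /comb hf_suml.
    apply: eq_bigr => p _; rewrite hf_sumr big_map; apply: eq_bigr => p' _ /=.
    rewrite hfZl hfZr /= dilate_theta// ip_theta /k /=.
    by rewrite !mulrA.
  apply/complex_ge0P; split; last exact: kp2.2.
  have := qsum_conj kp2 ll ll => /(congr1 (@complex.Im R)).
  by rewrite Im_conjc; set z := complex.Im _; lra.
have /choice[a ha] : forall i, exists a : nat -> L,
    (forall m, exists l, a m = comb (fun p : vac * FK => theta p.1 p.2) l) /\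
    hlim (ip_form L) a (J (u i)).
  move=> i; have [|a ha hl] := @hlim_seq _ _ (ip_form L) (J (u i))
    [set v | exists l, v = comb (fun p : vac * FK => theta p.1 p.2) l]; last by exists a.
  move=> e /(theta_total (J (u i)))[l hl].
  by exists (comb (fun p : vac * FK => theta p.1 p.2) l) => //; exists l.
under eq_bigr do under eq_bigr do rewrite ip_phi.
have lims : clim (fun m => \sum_i \sum_j ip (a i m) (dilate (X i j) (a j m)))
    (\sum_i \sum_j ip (J (u i)) (dilate (X i j) (J (u j)))).
  apply: clim_sum => i; apply: clim_sum => j.
  apply: (@clim_hform _ _ (ip_form L)); first by case: (ha i).
  have [c c0 [pl pb]] := dilate_bounded (Xb i j).
  move=> e e0; have c1 : 0 < c + 1 by rewrite ltr_wpDl.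
  have [N hN] := (ha j).2 _ (divr_gt0 e0 c1); exists N => m /hN h.
  rewrite -(linB pl); apply: le_lt_trans (pb _) _.
  apply: le_lt_trans (ler_mulD1 _ (hnorm_ge0 _ _)) _.
  by rewrite mulrC -ltr_pdivlMr.
apply: clim_ge0 lims _ => m.
have /choice[l hl] : forall i, exists l, a i m = comb (fun p : vac * FK => theta p.1 p.2) l.
  by move=> i; have [h _] := ha i; exact: h.
under eq_bigr do under eq_bigr do rewrite !hl.
exact: pos.
Qed.

End Dilation.

(** * Von Neumann's density argument, for two vectors at once *)

Section Density.
Context {R : realType} {F : complexHilbert R}.
Local Notation C := R[i].
Variable A : set (F -> F).
Hypotheses (Ab : forall a, A a -> bounded a) (A1 : A idfun).
Hypothesis Alin : forall c a b, A a -> A b -> A (c *: a + b).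
Hypothesis Acomp : forall a b, A a -> A b -> A (a \o b).
Hypothesis Aadj : forall a, A a -> exists2 b, A b & adjoint a b.

Definition pair_ip (u v : F * F) : C := ip u.1 v.1 + ip u.2 v.2.

Let pair_linear u a v w : pair_ip u (a *: v + w) = a * pair_ip u v + pair_ip u w.
Proof. by rewrite /pair_ip /= !ip_linear addrACA -mulrDr. Qed.

Let pair_sym u v : pair_ip v u = (pair_ip u v)^*.
Proof. by rewrite /pair_ip rmorphD /= -!ip_conj. Qed.

Let pair_ge0 u : 0 <= complex.Re (pair_ip u u).
Proof. by rewrite /pair_ip ReD addr_ge0// Re_ip_ge0. Qed.

Definition pair_form : hform (F * F)%type := HForm pair_linear pair_sym pair_ge0.
Canonical pair_form.

Local Notation hn := (hnorm pair_form).

Lemma pair_norm_sqr u : hn u ^+ 2 = nrm u.1 ^+ 2 + nrm u.2 ^+ 2.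
Proof. by rewrite !hnorm_sqr /= /pair_ip ReD. Qed.

Lemma pair_norm1 u : nrm u.1 <= hn u.
Proof.
rewrite -(@ler_pXn2r _ 2)// ?nnegrE ?hnorm_ge0// pair_norm_sqr lerDl.
exact: sqr_ge0.
Qed.

Lemma pair_norm2 u : nrm u.2 <= hn u.
Proof.
rewrite -(@ler_pXn2r _ 2)// ?nnegrE ?hnorm_ge0// pair_norm_sqr lerDr.
exact: sqr_ge0.
Qed.

Lemma pair_norm_le u : hn u <= nrm u.1 + nrm u.2.
Proof.
rewrite -(@ler_pXn2r _ 2)// ?nnegrE ?addr_ge0 ?hnorm_ge0// pair_norm_sqr sqrrD.
by have := mulr_ge0 (hnorm_ge0 (ip_form F) u.1) (hnorm_ge0 (ip_form F) u.2); lra.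
Qed.

Lemma pair_norm_eq0 u : hn u = 0 -> u = 0.
Proof.
move=> h; have h1 := pair_norm1 u; have h2 := pair_norm2 u; rewrite h in h1 h2.
case: u h h1 h2 => a b _ /= h1 h2; congr pair; apply: nrm_eq0; apply/eqP;
by rewrite eq_le ?h1 ?h2 hnorm_ge0.
Qed.

Lemma pair_complete : hcomplete pair_form setT.
Proof.
move=> u _ uc.
have [|x _ hx] := @hilbert_complete _ F (fun n => (u n).1) (fun=> Logic.I).
  move=> e /uc[N hN]; exists N => m n hm hn.
  exact: le_lt_trans (pair_norm1 (u m - u n)) (hN _ _ hm hn).
have [|y _ hy] := @hilbert_complete _ F (fun n => (u n).2) (fun=> Logic.I).
  move=> e /uc[N hN]; exists N => m n hm hn.
  exact: le_lt_trans (pair_norm2 (u m - u n)) (hN _ _ hm hn).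
exists (x, y) => // e e0.
have [|N hN] := hx (e / 2); first by lra.
have [|M hM] := hy (e / 2); first by lra.
exists (maxn N M) => n; rewrite geq_max => /andP[/hN h1 /hM h2].
by apply: le_lt_trans (pair_norm_le _) _ => /=; lra.
Qed.

Variables x1 x2 : F.

Definition diag_map (a : F -> F) (u : F * F) : F * F := (a u.1, a u.2).

Lemma diag_map_bounded a : bounded a -> exists2 c, 0 < c & forall u, hn (diag_map a u) <= c * hn u.
Proof.
move=> [c c0 [_ ac]]; exists (2 * c + 1); first by rewrite ltr_wpDl ?mulr_ge0.
move=> u; apply: le_trans (pair_norm_le _) _ => /=.
have h1 := le_trans (ac u.1) (ler_wpM2l c0 (pair_norm1 u)).
have h2 := le_trans (ac u.2) (ler_wpM2l c0 (pair_norm2 u)).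
by have := hnorm_ge0 pair_form u; lra.
Qed.

Lemma diag_map_linear a : linear a -> linear (diag_map a).
Proof. by move=> al c u v; rewrite /diag_map /= !al. Qed.

Let S : set (F * F) :=
  [set v | forall e, 0 < e -> exists2 a, A a & hn (v - diag_map a (x1, x2)) < e].

Let S_orbit a : A a -> S (diag_map a (x1, x2)).
Proof. by move=> Aa e e0; exists a; rewrite ?subrr ?hnorm0. Qed.

Let S_lin c u v : S u -> S v -> S (c *: u + v).
Proof.
move=> hu hv e e0; have c1 : 0 < normc c + 1 by rewrite ltr_wpDl ?normc_ge0.
have [|a Aa ha] := hu (e / 2 / (normc c + 1)); first by rewrite !divr_gt0.
have [|b Ab' hb] := hv (e / 2); first by lra.
exists (c *: a + b); first exact: Alin.
have -> : c *: u + v - diag_map (c *: a + b) (x1, x2) =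
    c *: (u - diag_map a (x1, x2)) + (v - diag_map b (x1, x2)).
  by rewrite scalerBr addrACA -opprD.
apply: le_lt_trans (hnorm_triangle _ _ _) _; rewrite hnormZ.
rewrite ltr_pdivlMr// in ha.
have := hnorm_ge0 pair_form (u - diag_map a (x1, x2)).
by lra.
Qed.

Let S_closed u v : (forall n, S (u n)) -> hlim pair_form u v -> S v.
Proof.
move=> Su uv e e0; have [|N /(_ N (leqnn N)) hN] := uv (e / 2); first by lra.
have [|a Aa ha] := Su N (e / 2); first by lra.
exists a => //; have := hnorm_triangleB pair_form v (u N) (diag_map a (x1, x2)).
by rewrite (hnormB _ v (u N)); lra.
Qed.

Let S0 : S 0.
Proof.
have := S_lin (-1) (S_orbit A1) (S_orbit A1).
by rewrite scaleN1r addNr.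
Qed.

Let S_diag a u : A a -> S u -> S (diag_map a u).
Proof.
move=> Aa Su e e0; have [c c0 hc] := diag_map_bounded (Ab Aa).
have [b Ab' hb] := Su _ (divr_gt0 e0 c0); exists (a \o b); first exact: Acomp.
have -> : diag_map (a \o b) (x1, x2) = diag_map a (diag_map b (x1, x2)) by [].
rewrite -(linB (diag_map_linear (bounded_lin (Ab Aa)))).
by apply: le_lt_trans (hc _) _; rewrite mulrC -ltr_pdivlMr.
Qed.

Let proj_ex w : exists p, S p /\ forall s, S s -> pair_ip (w - p) s = 0.
Proof.
have [|||p Sp hp] := @orthogonal_projection _ _ pair_form S w S0.
- by move=> y z Sy Sz; have := S_lin 1 Sy Sz; rewrite scale1r.
- by move=> r y Sy; have := S_lin r%:C Sy S0; rewrite addr0.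
- move=> u Su uc; have [v _ uv] := pair_complete (fun=> Logic.I) uc.
  by exists v => //; exact: S_closed uv.
exists p; split => // s Ss; apply: complex_ext; first exact: hp.
have /hp : S ('i *: s) by have := S_lin 'i Ss S0; rewrite addr0.
rewrite hfZr Re_iM => /eqP; rewrite oppr_eq0 => /eqP.
by [].
Qed.

Let P w : F * F := sval (cid (proj_ex w)).
Let PS w : S (P w). Proof. exact: (svalP (cid (proj_ex w))).1. Qed.
Let Porth w s : S s -> pair_ip (w - P w) s = 0.
Proof. exact: (svalP (cid (proj_ex w))).2. Qed.

Let Puniq w p : S p -> (forall s, S s -> pair_ip (w - p) s = 0) -> P w = p.
Proof.
move=> Sp hp; have Sd : S (p - P w).
  by rewrite addrC -scaleN1r; apply: S_lin => //; exact: PS.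
apply/eqP; rewrite eq_sym -subr_eq0; apply/eqP/pair_norm_eq0/eqP.
have e : p - P w = (w - P w) - (w - p) by rewrite opprB [RHS]addrC subrKA.
by rewrite -sqrf_eq0 hnorm_sqr {1}e hfBl /= Porth// hp// subrr.
Qed.

Let Plin : linear P.
Proof.
move=> c u v; apply: Puniq; first by apply: S_lin; exact: PS.
move=> s Ss; have -> : c *: u + v - (c *: P u + P v) = c *: (u - P u) + (v - P v).
  by rewrite scalerBr addrACA -opprD.
by rewrite hfDl hfZl /= !Porth// mulr0 addr0.
Qed.

Let Pbound w : hn (P w) <= hn w.
Proof.
have [->|n0] := eqVneq (hn (P w)) 0; first exact: hnorm_ge0.
have np : 0 < hn (P w) by rewrite lt_neqAle eq_sym n0 hnorm_ge0.
rewrite -(ler_pM2r np) -expr2 hnorm_sqr.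
have e : pair_form (P w) (P w) = pair_form w (P w).
  apply/eqP; rewrite eq_sym -subr_eq0 -hfBl; apply/eqP.
  by apply: Porth; exact: PS.
by rewrite e; apply: le_trans (ler_norm _) _; exact: Re_cauchy_schwarz.
Qed.

Let Pcomm a w : A a -> P (diag_map a w) = diag_map a (P w).
Proof.
move=> Aa; have al := diag_map_linear (bounded_lin (Ab Aa)).
apply: Puniq; first by apply: S_diag => //; exact: PS.
move=> s Ss; have [b Ab' ab] := Aadj Aa.
rewrite -(linB al); have := Porth w (S_diag Ab' Ss).
by rewrite /pair_ip /= !ab.
Qed.

Variable X : F -> F.
Hypothesis Xb : bounded X.
Hypothesis Xcomm : forall y, bounded y -> (forall a, A a -> y \o a = a \o y) -> y \o X = X \o y.

(** Entries of the 2 x 2 matrix of P, with true for the first coordinate. *)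
Let entry (i j : bool) (u : F) : F :=
  let v := P (if j then (u, 0) else (0, u)) in if i then v.1 else v.2.

Let entry_bounded i j : bounded (entry i j).
Proof.
exists 1 => //; split=> [c u v|u]; rewrite /entry.
  have -> : (if j then (c *: u + v, 0) else (0, c *: u + v)) =
    c *: (if j then (u, 0) else (0, u)) + (if j then (v, 0) else (0, v)) :> F * F.
    by case: j; congr pair => /=; rewrite scaler0 addr0.
  by rewrite Plin; case: i.
rewrite mul1r; apply: (@le_trans _ _ (hn (if j then (u, 0) else (0, u)))).
  apply: le_trans (Pbound _); case: i; [exact: pair_norm1|exact: pair_norm2].
by apply: le_trans (pair_norm_le _) _; case: j => /=; rewrite hnorm0 ?addr0 ?add0r.
Qed.

Let entry_comm i j : entry i j \o X = X \o entry i j.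
Proof.
apply: Xcomm => [|a Aa]; first exact: entry_bounded.
apply/funext => u; rewrite /= /entry.
have -> : (if j then (a u, 0) else (0, a u)) = diag_map a (if j then (u, 0) else (0, u)).
  by case: j; congr pair => /=; rewrite (lin0 (bounded_lin (Ab Aa))).
by rewrite Pcomm//; case: i.
Qed.

(** P projects onto the closure of the orbit of (x1, x2) under A acting diagonally. It commutes with
    A, hence its entries commute with X, and X maps (x1, x2) into that closure. Two vectors are
    approximated at once because [compression_bicommutant] compares the two sides of a commutation
    relation. *)
Lemma commutant_density e : 0 < e ->
  exists2 a, A a & nrm (X x1 - a x1) < e /\ nrm (X x2 - a x2) < e.
Proof.
move=> e0; have Xl := bounded_lin Xb.
have PX w : P (diag_map X w) = diag_map X (P w).
  have split2 (u : F * F) : u = (u.1, 0) + (0, u.2).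
    by case: u => a b; congr pair; rewrite /= ?addr0 ?add0r.
  have PE i w' : (if i then (P w').1 else (P w').2) =
      entry i true w'.1 + entry i false w'.2.
    by rewrite {1 2}[w']split2 (linD Plin) /entry; case: i.
  have c i j u : entry i j (X u) = X (entry i j u).
    by have /(congr1 (fun f => f u)) := entry_comm i j.
  rewrite [LHS]surjective_pairing; congr pair.
    by rewrite (PE true) (PE true w) (linD Xl) -!c.
  by rewrite (PE false) (PE false w) (linD Xl) -!c.
have Sx : S (x1, x2) by have := S_orbit A1.
have Px : P (x1, x2) = (x1, x2) by apply: Puniq => // s _; rewrite subrr (hf0l pair_form).
have SX : S (diag_map X (x1, x2)) by have := PS (diag_map X (x1, x2)); rewrite PX Px.
have [a Aa ha] := SX e e0; exists a => //; split.
  exact: le_lt_trans (pair_norm1 (diag_map X (x1, x2) - diag_map a (x1, x2))) ha.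
exact: le_lt_trans (pair_norm2 (diag_map X (x1, x2) - diag_map a (x1, x2))) ha.
Qed.

End Density.

(** * Commutants, and generated von Neumann algebras as bicommutants *)

Section DoubleCommutant.
Context {R : realType} {F : complexHilbert R}.
Local Notation C := R[i].
Variable S : set (F -> F).
Hypothesis S_sa : forall s, S s -> bounded s /\ adjoint s s.

Lemma commutantP (X : set (F -> F)) x :
  commutant X x <-> bounded x /\ forall s, X s -> x \o s = s \o x.
Proof. by split=> -[/bounded_opP h1 h2]; split=> //; exact/bounded_opP. Qed.

Lemma commutant_id X : commutant X (idfun : F -> F).
Proof. by apply/commutantP; split=> //; exact: bounded_id. Qed.

Lemma commutant_lin (X : set (F -> F)) c x y : (forall s, X s -> linear s) ->
  commutant X x -> commutant X y -> commutant X (c *: x + y).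
Proof.
move=> Xl /commutantP[xb xc] /commutantP[yb yc]; apply/commutantP; split.
  exact: bounded_add (bounded_scale c xb) yb.
move=> s Xs; apply/funext => u.
have := congr1 (fun f => f u) (xc s Xs); have := congr1 (fun f => f u) (yc s Xs).
rewrite /= => h1 h2; rewrite -[LHS]/(c *: x (s u) + y (s u)) h1 h2.
by rewrite -[RHS]/(s (c *: x u + y u)) (Xl s Xs).
Qed.

Lemma commutant_comp (X : set (F -> F)) x y :
  commutant X x -> commutant X y -> commutant X (x \o y).
Proof.
move=> /commutantP[xb xc] /commutantP[yb yc]; apply/commutantP.
split=> [|s Xs]; first exact: bounded_comp.
by rewrite -compA yc// compA xc.
Qed.

Lemma commutant_adj (X : set (F -> F)) x y :
  (forall s, X s -> exists2 s', X s' & adjoint s s') ->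
  commutant X x -> adjoint x y -> commutant X y.
Proof.
move=> Xa /commutantP[xb xc] xy; apply/commutantP.
split=> [|s Xs]; first exact: adjoint_bounded xy.
have [s' Xs' ss'] := Xa s Xs; apply/funext => u; apply: ip_ext => v.
have := congr1 (fun f => f v) (xc s' Xs'); rewrite /= => h.
by rewrite -xy -(adjoint_sym ss') -h xy (adjoint_sym ss').
Qed.

Lemma commutant_mono (X Y : set (F -> F)) : X `<=` Y -> commutant Y `<=` commutant X.
Proof. by move=> XY x /commutantP[xb xc]; apply/commutantP; split=> // s /XY; exact: xc. Qed.

Lemma commutant2_sub (X : set (F -> F)) : (forall s, X s -> bounded s) ->
  X `<=` commutant (commutant X).
Proof.
move=> Xb s Xs; apply/commutantP; split=> [|y /commutantP[_ yc]]; first exact: Xb.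
by rewrite yc.
Qed.

(** As S consists of self-adjoint operators, its bicommutant is closed under adjoints; conversely M
    = M'' contains S'' by monotonicity. *)
Lemma smallest_von_neumann :
  smallest (@von_neumann_algebra R F) S = commutant (commutant S).
Proof.
have Sb s : S s -> bounded s by move=> /S_sa[].
apply/seteqP; split.
  apply: smallest_sub; last exact: commutant2_sub.
  split.
    move=> x y; apply: commutant_adj => z Cz.
    have [zb zc] := (commutantP _ _).1 Cz; have [z' zz'] := adjoint_exists zb.
    exists z' => //; apply: commutant_adj Cz zz' => s Ss.
    by exists s => //; case: (S_sa Ss).
  apply/seteqP; split; last by apply: commutant2_sub => x /commutantP[].
  apply: commutant_mono; apply: commutant2_sub => x.
  by move=> /commutantP[].
move=> x Cx M [[Madj MM] SM]; rewrite -MM.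
by move: x Cx; apply: commutant_mono; exact: commutant_mono.
Qed.

End DoubleCommutant.

(** * Positive operators and suprema of directed families *)

Section PositiveOperators.
Context {R : realType} {F : complexHilbert R}.
Local Notation C := R[i].

Definition positive_op (p : F -> F) := forall u, 0 <= ip u (p u).

Section PositiveForm.
Variable p : F -> F.
Hypotheses (pl : linear p) (pp : positive_op p).

Let form_lin u a v w : ip u (p (a *: v + w)) = a * ip u (p v) + ip u (p w).
Proof. by rewrite pl hfDr hfZr. Qed.

Let form_sym u v : ip v (p u) = (ip u (p v))^*.
Proof.
apply: (hermitian_of_real (b := fun u v => ip u (p v))).
- by move=> w a x y; exact: form_lin.
- by move=> w a x y; rewrite hfDl hfZl.
- by move=> w; have /complex_ge0P[] := pp w.
Qed.

Let form_ge0 u : 0 <= complex.Re (ip u (p u)).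
Proof. by have /complex_ge0P[] := pp u. Qed.

Definition positive_form : hform F :=
  @HForm R F (fun u v => ip u (p v)) form_lin form_sym form_ge0.

(** Cauchy-Schwarz for the form <u, p v>, at p u and u. It turns convergence of quadratic forms into
    strong convergence. *)
Lemma positive_sqr_le c u : 0 <= c -> bounded_by c p ->
  nrm (p u) ^+ 2 <= c * complex.Re (ip u (p u)).
Proof.
move=> c0 pc; have := Re_cauchy_schwarz_sqr positive_form (p u) u.
rewrite !hnorm_sqr /= -[ip (p u) (p u)]/(ip_form F _ _) -hnorm_sqr => h.
have [->|n0] := eqVneq (nrm (p u)) 0; first by rewrite expr0n mulr_ge0.
have np : 0 < nrm (p u) ^+ 2 by rewrite exprn_even_gt0.
rewrite -(ler_pM2l np) -expr2; apply: le_trans h _.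
rewrite mulrA ler_wpM2r// mulrC.
apply: le_trans (ler_norm _) _; apply: le_trans (Re_cauchy_schwarz (ip_form F) _ _) _.
have := pc.2 (p u); have := hnorm_ge0 (ip_form F) (p u).
by move: (nrm (p u)) (nrm (p (p u))) => a b; nra.
Qed.

(** From 0 <= p <= q one gets <v, p v> <= c |v|^2, and Cauchy-Schwarz for the form of p, at p u and
    u, turns this into a bound on p. *)
Lemma positive_bounded_by (q : F -> F) c : 0 <= c -> bounded_by c q ->
  (forall u, 0 <= ip u (q u - p u)) -> bounded_by c p.
Proof.
move=> c0 [ql qc] pq; split=> // u.
have le v : complex.Re (ip v (p v)) <= c * nrm v ^+ 2.
  have /complex_ge0P[_] := pq v; rewrite hfBr ReB subr_ge0 /= => /le_trans; apply.
  apply: le_trans (ler_norm _) _; apply: le_trans (Re_cauchy_schwarz (ip_form F) _ _) _.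
  by rewrite expr2 mulrCA ler_wpM2l ?hnorm_ge0.
have := Re_cauchy_schwarz_sqr positive_form (p u) u.
rewrite !hnorm_sqr /= -[ip (p u) (p u)]/(ip_form F _ _) -hnorm_sqr => h.
have [->|n0] := eqVneq (nrm (p u)) 0; first by rewrite mulr_ge0 ?hnorm_ge0.
have np : 0 < nrm (p u) ^+ 2 by rewrite exprn_even_gt0.
rewrite -(@ler_pXn2r _ 2)// ?nnegrE ?mulr_ge0 ?hnorm_ge0//.
rewrite -(ler_pM2l np) -expr2; apply: le_trans h _.
apply: le_trans (ler_pM (form_ge0 _) (form_ge0 _) (le _) (le _)) _.
by rewrite le_eqVlt; apply/orP; left; apply/eqP; ring.
Qed.

End PositiveForm.

End PositiveOperators.

Section Vigier.
Context {R : realType} {F : complexHilbert R}.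
Local Notation C := R[i].
Variables (M D : set (F -> F)) (x : F -> F).
Hypotheses (M2 : commutant (commutant M) = M) (Mb : forall y, M y -> bounded y).
Hypotheses (DM : D `<=` [set d | M d /\ is_adjoint d d]) (Ddir : directed D).
Hypothesis Dx : op_sup M D x.

Let Mx : M x. Proof. by case: Dx. Qed.
Let Db d : D d -> bounded d. Proof. by move=> /DM[/Mb]. Qed.
Let xb : bounded x. Proof. exact: Mb. Qed.
Let D_le_x d : D d -> op_le d x. Proof. by case: Dx => _ + _; apply. Qed.

Lemma op_le_trans (a b c : F -> F) : op_le a b -> op_le b c -> op_le a c.
Proof. by move=> ab bc u; rewrite -(subrKA (b u)) hfDr addr_ge0 ?ab ?bc. Qed.

Let sub_bounded (a b : F -> F) : bounded a -> bounded b -> bounded (fun u => a u - b u).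
Proof.
move=> ab bb; have := bounded_add ab (bounded_scale (-1) bb).
by congr bounded; apply/funext => u; rewrite scaleN1r.
Qed.

(** An increasing family bounded above converges strongly; its limit y lies in M = M'' and is an
    upper bound, so y = x as x is the least one. The conclusion is shaped for [phi_small]: one d
    close to x at finitely many vectors, with a bound on x - d that is independent of them and of
    e. *)
Lemma vigier : exists2 c, 0 <= c & forall m (f : 'I_m -> F) (e : R), 0 < e ->
  exists d, [/\ D d, bounded_by c (fun u => x u - d u) & forall i, nrm (x (f i) - d (f i)) <= e].
Proof.
have [[d0 Dd0] Dup] := Ddir.
have [c c0 xd0] := sub_bounded xb (Db Dd0).
(* Above a fixed d0 all differences lie between 0 and x - d0, hence share the bound c. *)
pose D0 := [set d | D d /\ op_le d0 d].
have D0up a b : D0 a -> D0 b -> exists d, [/\ D0 d, op_le a d & op_le b d].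
  move=> [Da a0] [Db' b0]; have [d [Dd ad bd]] := Dup _ _ Da Db'.
  by exists d; split => //; split => //; exact: op_le_trans a0 ad.
have op_refl (a : F -> F) : op_le a a by move=> u; rewrite subrr hf0r.
have D00 : D0 d0 by [].
have diff_lin (a b : F -> F) : bounded a -> bounded b -> linear (fun u => a u - b u).
  by move=> ab bb; exact: bounded_lin (sub_bounded ab bb).
have diff_by a b : D0 a -> D0 b -> op_le a b -> bounded_by c (fun u => b u - a u).
  move=> [Da a0] [Db' b0] ab.
  apply: (@positive_bounded_by _ _ _ _ _ (fun u => x u - d0 u)) => //.
    by apply: diff_lin; exact: Db.
  move=> u; have -> : x u - d0 u - (b u - a u) = (x u - b u) + (a u - d0 u).
    by rewrite opprB addrACA [RHS]addrACA [- d0 u - b u]addrC.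
  by rewrite hfDr addr_ge0//; [exact: (D_le_x Db')|exact: a0].
have xdiff_by a : D0 a -> bounded_by c (fun u => x u - a u).
  move=> [Da a0]; apply: (@positive_bounded_by _ _ _ _ _ (fun u => x u - d0 u)) => //.
  - by apply: diff_lin => //; exact: Db.
  - by move=> u; exact: D_le_x.
  - by move=> u; rewrite opprB addrC subrKA.
pose lim u v := forall e : R, 0 < e -> exists2 d1, D0 d1 & forall d, D0 d -> op_le d1 d ->
  nrm (d u - v) < e.
have lim_ex u : exists v, lim u v.
  (* d n nearly attains the supremum of <u, d u>. Beyond d n this form increases by at most 1 / (n +
     1), which bounds |a u - d n u| and replaces the directed family by a sequence. *)
  pose E := [set complex.Re (ip u (d u)) | d in D0].
  have Es : has_sup E.
    split; first by exists (complex.Re (ip u (d0 u))), d0.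
    exists (complex.Re (ip u (x u))) => _ [d [Dd _] <-].
    have /complex_ge0P[_] := D_le_x Dd u.
    by rewrite hfBr ReB subr_ge0.
  have Ele d : D0 d -> complex.Re (ip u (d u)) <= sup E.
    by move=> Dd; apply: ub_le_sup; [case: Es|exists d].
  have /choice[d hd] :
      forall n : nat, exists d, D0 d /\ sup E - n.+1%:R^-1 < complex.Re (ip u (d u)).
    move=> n; have [|_ [d Dd <-] h] := @sup_adherent _ E n.+1%:R^-1 _ Es; first by rewrite invr_gt0.
    by exists d.
  have near n a : D0 a -> op_le (d n) a -> nrm (a u - d n u) ^+ 2 <= c * n.+1%:R^-1.
    move=> Da dna; have [Dn hn] := hd n.
    have h := @positive_sqr_le _ _ (fun u => a u - d n u) _ _ c u c0 (diff_by _ _ Dn Da dna).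
    apply: le_trans (h _ _) _.
    - by apply: diff_lin; apply: Db; [case: Da|case: Dn].
    - by move=> v; exact: dna.
    rewrite ler_wpM2l// hfBr ReB lerBlDr; have := Ele _ Da.
    by rewrite /=; move: (n.+1%:R^-1) hn => t; lra.
  have nearlt n a e : 0 < e -> (c + 1) * n.+1%:R^-1 < e ^+ 2 -> D0 a -> op_le (d n) a ->
      nrm (a u - d n u) < e.
    move=> e0 ne Da dna; rewrite -(@ltr_pXn2r _ 2)// ?nnegrE ?hnorm_ge0 ?ltW//.
    apply: le_lt_trans (near _ _ Da dna) _; apply: le_lt_trans ne.
    by rewrite ler_wpM2r ?lerDl// invr_ge0.
  have c1 : 0 < c + 1 by rewrite ltr_wpDl.
  have small e : 0 < e -> exists N, forall n, (N <= n)%N -> (c + 1) * n.+1%:R^-1 < e ^+ 2.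
    move=> e0; have [N hN] := natS_inv_lt (divr_gt0 (exprn_gt0 2 e0) c1).
    by exists N => n /hN; rewrite ltr_pdivlMr// mulrC.
  have [|v _ hv] := @hilbert_complete _ F (fun n => d n u) (fun=> Logic.I).
    move=> e e0; have [|N hN] := small (e / 2); first by lra.
    exists N => m n hm hn.
    have [a [Da ma na]] := D0up _ _ (hd m).1 (hd n).1.
    have e2 : 0 < e / 2 by lra.
    have h1 := nearlt m a _ e2 (hN m hm) Da ma; have h2 := nearlt n a _ e2 (hN n hn) Da na.
    have := hnorm_triangleB (ip_form F) (d m u) (a u) (d n u).
    by rewrite (hnormB _ (d m u) (a u)); lra.
  exists v => e e0; have [|N hN] := small (e / 2); first by lra.
  have [|N' hN'] := hv (e / 2); first by lra.
  have h1 := hN _ (leq_maxl N N'); have h2 := hN' _ (leq_maxr N N').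
  exists (d (maxn N N')); first by case: (hd (maxn N N')).
  move=> a Da na; have e2 : 0 < e / 2 by lra.
  have h3 := nearlt _ _ _ e2 h1 Da na.
  by have := hnorm_triangleB (ip_form F) (a u) (d (maxn N N') u) v; lra.
have [y hy] := choice lim_ex.
have lim_uniq u v v' : lim u v -> lim u v' -> v = v'.
  move=> h h'; apply/eqP; rewrite -subr_eq0; apply/eqP/nrm_eq0.
  apply: eq0_of_le_eps (hnorm_ge0 _ _) _ => e e0.
  have [|a Da ha] := h (e / 2); first by lra.
  have [|b Db' hb] := h' (e / 2); first by lra.
  have [d [Dd ad bd]] := D0up _ _ Da Db'.
  have h1 := ha _ Dd ad; have h2 := hb _ Dd bd.
  have := hnorm_triangleB (ip_form F) v (d u) v'.
  by rewrite (hnormB _ v (d u)); lra.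
have lim_lin a u v u' v' : lim u v -> lim u' v' -> lim (a *: u + u') (a *: v + v').
  move=> h h' e e0; have a1 : 0 < normc a + 1 by rewrite ltr_wpDl ?normc_ge0.
  have [|d1 D1 h1] := h (e / 2 / (normc a + 1)); first by rewrite !divr_gt0.
  have [|d2 D2 h2] := h' (e / 2); first by lra.
  have [d3 [D3 d13 d23]] := D0up _ _ D1 D2.
  exists d3 => // d Dd d3d.
  have k1 := h1 _ Dd (op_le_trans d13 d3d); have k2 := h2 _ Dd (op_le_trans d23 d3d).
  rewrite (bounded_lin (Db Dd.1)) opprD addrACA -scalerBr.
  apply: le_lt_trans (hnorm_triangle _ _ _) _; rewrite hnormZ.
  rewrite ltr_pdivlMr// in k1; have := hnorm_ge0 (ip_form F) (d u - v).
  by lra.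
have yl : linear y by move=> a u v; apply: lim_uniq (hy _) _; exact: lim_lin.
have yb : bounded y.
  have [b b0 [_ hb]] := Db Dd0.
  exists (b + c); first exact: addr_ge0.
  split=> // u; apply: le_eps => e e0.
  have [d1 D1 /(_ _ D1 (op_refl _)) h1] := hy u e e0.
  have h2 := (diff_by _ _ D00 D1 D1.2).2 u; have h3 := hb u.
  have h4 := hnorm_triangleB (ip_form F) (y u) (d1 u) (d0 u).
  have h5 := hnorm_triangleB (ip_form F) (y u) (d0 u) 0; rewrite !subr0 in h5.
  by rewrite (hnormB _ (y u) (d1 u)) in h4; lra.
have My : M y.
  rewrite -M2; apply/commutantP; split=> // z /commutantP[zb zc].
  apply/funext => u /=; apply: (lim_uniq (z u)); first exact: hy.
  move=> e e0; have [b b0 [zl hb]] := zb.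
  have b1 : 0 < b + 1 by rewrite ltr_wpDl.
  have [d1 D1 h1] := hy u _ (divr_gt0 e0 b1); exists d1 => // d Dd dd.
  have := congr1 (fun f => f u) (zc d (DM Dd.1).1); rewrite /= => <-.
  rewrite -(linB zl); apply: le_lt_trans (hb _) _.
  apply: le_lt_trans (ler_mulD1 _ (hnorm_ge0 _ _)) _.
  by rewrite mulrC -ltr_pdivlMr//; exact: h1.
(* The sign s serves both the comparison of y with members of D and that of y with x. *)
have lim_ge0 u w (s : bool) : (exists2 d1, D0 d1 & forall d, D0 d -> op_le d1 d ->
    0 <= (-1) ^+ s * ip u (d u - w)) -> 0 <= (-1) ^+ s * ip u (y u - w).
  move=> [d1 D1 h1].
  have /choice[d hd] : forall n : nat, exists d, D0 d /\ op_le d1 d /\ nrm (d u - y u) < n.+1%:R^-1.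
    move=> n; have [|d2 D2 h2] := hy u n.+1%:R^-1; first by rewrite invr_gt0.
    have [d [Dd d1d d2d]] := D0up _ _ D1 D2.
    by exists d; split => //; split => //; exact: h2.
  have l1 : hlim (ip_form F) (fun n => d n u - w) (y u - w).
    move=> e e0; have [N hN] := natS_inv_lt e0; exists N => n /hN.
    apply: lt_trans; rewrite opprB addrA subrK.
    by case: (hd n) => _ [].
  have l2 : hlim (ip_form F) (fun=> u) u by move=> e e0; exists 0 => n _; rewrite subrr hnorm0.
  have l3 := clim_lin ((-1) ^+ s) (clim_hform l2 l1) (clim_cst 0).
  rewrite addr0 in l3; apply: clim_ge0 l3 _ => n.
  by rewrite addr0; case: (hd n) => Dn [d1n _]; exact: h1.
have Dy d : D d -> op_le d y.
  move=> Dd u; have := @lim_ge0 u (d u) false; rewrite expr0 mul1r; apply.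
  have [d' [Dd' d0d' dd']] := Dup _ _ Dd0 Dd.
  exists d' => // a Da d'a; rewrite mul1r.
  exact: (op_le_trans dd' d'a).
have xy : op_le x y by case: Dx => _ _; apply.
have yx : op_le y x.
  move=> u; have := @lim_ge0 u (x u) true; rewrite expr1 mulN1r -hfNr opprB; apply.
  by exists d0 => // d [Dd _] _; rewrite mulN1r -hfNr opprB; exact: D_le_x.
have yE u : y u = x u.
  apply/eqP; rewrite -subr_eq0; apply/eqP/nrm_eq0/eqP.
  have [b b0 hb] := sub_bounded yb xb.
  have := @positive_sqr_le _ _ (fun u => y u - x u) _ _ b u b0 hb.
  move=> /(_ (bounded_lin (sub_bounded yb xb)) xy).
  have -> : ip u (y u - x u) = 0.
    apply/eqP; rewrite eq_le xy andbT -oppr_ge0 -hfNr opprB.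
    exact: yx.
  rewrite mulr0 => h; rewrite -sqrf_eq0 eq_le h.
  exact: sqr_ge0.
exists c => // m f e e0.
suff [d Dd hd] : exists2 d, D0 d & forall i, nrm (x (f i) - d (f i)) <= e.
  by exists d; split => //; [case: Dd|exact: xdiff_by].
suff [d1 D1 h1] : exists2 d1, D0 d1 & forall d, D0 d -> op_le d1 d ->
    forall i, nrm (x (f i) - d (f i)) <= e.
  by exists d1 => //; exact: h1.
elim: m f => [|m IHm] f; first by exists d0 => // d _ _ [].
have [d1 D1 h1] := IHm (fun i => f (lift ord0 i)).
have [d2 D2 h2] := hy (f ord0) e e0.
have [d3 [D3 d13 d23]] := D0up _ _ D1 D2.
exists d3 => // d Dd d3d i; case: (unliftP ord0 i) => [j|] ->.
  by apply: h1 => //; exact: op_le_trans d13 d3d.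
by rewrite -yE hnormB ltW// h2//; exact: op_le_trans d23 d3d.
Qed.

End Vigier.

(** * Compressions of amplifications preserve bicommutants *)

Section Amplification.
Context {R : realType} {F G L : complexHilbert R} {X : Type}.
Local Notation C := R[i].
Variables (theta : X -> F -> L) (dilate : (F -> F) -> L -> L) (J : G -> L) (Js : L -> G).
Hypotheses (theta_bounded : forall n, bounded (theta n)).
Hypothesis theta_total : total (fun p : X * F => theta p.1 p.2).
Hypothesis dilate_theta : forall x n e, bounded x -> dilate x (theta n e) = theta n (x e).
Hypothesis dilate_bounded : forall x, bounded x -> bounded (dilate x).
Hypothesis dilate_id : dilate idfun = idfun.
Hypothesis dilate_lin : forall c a b, bounded a -> bounded b ->
  dilate (c *: a + b) = c *: dilate a + dilate b.
Hypothesis dilate_comp : forall a b, bounded a -> bounded b ->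
  dilate (a \o b) = dilate a \o dilate b.
Hypothesis dilate_adjoint : forall a b, bounded a -> adjoint a b -> adjoint (dilate a) (dilate b).
Hypotheses (J_bounded : bounded J) (Js_bounded : bounded Js).
Variables (A S : set (F -> F)) (S' : set (G -> G)).
Hypothesis S_sub : S `<=` A.
Hypotheses (A_bounded : forall a, A a -> bounded a) (A_id : A idfun).
Hypothesis A_lin : forall c a b, A a -> A b -> A (c *: a + b).
Hypothesis A_comp : forall a b, A a -> A b -> A (a \o b).
Hypothesis A_adj : forall a, A a -> exists2 b, A b & adjoint a b.

(* The matrix entries of an operator commuting with dilate(A), with respect to the
   copies theta n of F in L, commute with A. *)
Lemma dilate_bicommutant x y : commutant (commutant S) x -> bounded y ->
  (forall a, A a -> y \o dilate a = dilate a \o y) -> y \o dilate x = dilate x \o y.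
Proof.
move=> /commutantP[xb xc] yb yA.
have [g hg] := choice (fun n => adjoint_exists (theta_bounded n)).
have gb n : bounded (g n) by exact: adjoint_bounded (hg n).
(* The adjoint g n of theta n intertwines dilate a and a, as theta n does. *)
have gpi a n w : bounded a -> g n (dilate a w) = a (g n w).
  move=> ab; have [b aab] := adjoint_exists ab; apply: ip_ext => u.
  have bb := adjoint_bounded ab aab.
  rewrite -hg -(adjoint_sym (dilate_adjoint ab aab)) dilate_theta// hg.
  by rewrite (adjoint_sym aab).
pose z n' n := g n' \o y \o theta n.
have zS n' n : commutant S (z n' n).
  apply/commutantP; split; first by apply: bounded_comp => //; exact: bounded_comp.
  move=> s Ss; have As := S_sub Ss; have sb := A_bounded As; apply/funext => e.
  rewrite /z /= -gpi// -dilate_theta//; congr (g n' _).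
  exact: (congr1 (fun f => f (theta n e)) (yA s As)).
apply/funext; apply: (bounded_by_eq_on theta_total).
- exact: bounded_comp yb (dilate_bounded xb).
- exact: bounded_comp (dilate_bounded xb) yb.
move=> [n e] /=; apply: (total_ext theta_total) => -[n' e'].
rewrite /= !hg gpi// dilate_theta//; congr (ip _ _).
have := congr1 (fun f => f e) (xc _ (zS n' n)).
by rewrite /z /= => ->.
Qed.

(** An element v of the commutant of S' commutes with the compression of dilate a for each a in A.
    To pass to x, approximate dilate x by one dilate a at the two vectors J w and J (v w). *)
Lemma compression_bicommutant x :
  (forall a, A a -> commutant (commutant S') (Js \o dilate a \o J)) ->
  commutant (commutant S) x -> commutant (commutant S') (Js \o dilate x \o J).
Proof.
move=> phiA xM; have /commutantP[xb _] := xM.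
have cb a : bounded a -> bounded (Js \o dilate a \o J).
  by move=> ab; exact: bounded_comp (bounded_comp Js_bounded (dilate_bounded ab)) J_bounded.
apply/commutantP; split=> [|v vS]; first exact: cb.
have /commutantP[vb _] := vS.
apply/funext => w; apply/eqP; rewrite -subr_eq0; apply/eqP/nrm_eq0.
apply: eq0_of_le_eps (hnorm_ge0 _ _) _ => e e0.
have [b b0 [bl hb]] := Js_bounded; have [c c0 [cl hc]] := vb.
have d1 : 0 < b + c * b + 1 by rewrite ltr_wpDl ?addr_ge0 ?mulr_ge0.
pose A' : set (L -> L) := [set dilate a | a in A].
have [_ [a Aa <-] [h1 h2]] : exists2 p, A' p &
    nrm (dilate x (J (v w)) - p (J (v w))) < e / (b + c * b + 1) /\
    nrm (dilate x (J w) - p (J w)) < e / (b + c * b + 1).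
  apply: commutant_density; last exact: divr_gt0.
  - by move=> _ [a Aa <-]; exact/dilate_bounded/A_bounded.
  - by exists idfun.
  - move=> k _ _ [a Aa <-] [a' Aa' <-]; exists (k *: a + a'); first exact: A_lin.
    by rewrite dilate_lin//; exact: A_bounded.
  - move=> _ _ [a Aa <-] [a' Aa' <-]; exists (a \o a'); first exact: A_comp.
    by rewrite dilate_comp//; exact: A_bounded.
  - move=> _ [a Aa <-]; have [a' Aa' aa'] := A_adj Aa.
    by exists (dilate a'); [exists a'|apply: dilate_adjoint => //; exact: A_bounded].
  - exact: dilate_bounded.
  - move=> y yb yA; apply: dilate_bicommutant => // a Aa.
    by apply: yA; exists a.
have /commutantP[ab ac] := phiA a Aa.
have e1 := congr1 (fun f => f w) (ac v vS); rewrite /= in e1.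
have -> : (Js \o dilate x \o J \o v) w - (v \o (Js \o dilate x \o J)) w =
  Js (dilate x (J (v w)) - dilate a (J (v w))) - v (Js (dilate x (J w) - dilate a (J w))).
  by rewrite /= !(linB bl) (linB cl) e1 opprB addrA subrK.
apply: le_trans (hnorm_triangle _ _ _) _; rewrite hnormN.
have h3 := le_trans (hb (dilate x (J (v w)) - dilate a (J (v w)))) (ler_wpM2l b0 (ltW h1)).
have h4 := le_trans (hc _) (ler_wpM2l c0
  (le_trans (hb (dilate x (J w) - dilate a (J w))) (ler_wpM2l b0 (ltW h2)))).
have := mulVf (lt0r_neq0 d1); have : 0 < e / (b + c * b + 1) by rewrite divr_gt0.
have : e / (b + c * b + 1) * (b + c * b + 1) = e by rewrite divfK ?gt_eqF.
by move: (e / _) h3 h4 => t; nra.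
Qed.

End Amplification.

(** * Normality from strong continuity on bounded sets *)

Section NormalMaps.
Context {R : realType} {F G : complexHilbert R}.
Variables (M : set (F -> F)) (N : set (G -> G)) (phi : (F -> F) -> G -> G).
Hypotheses (M2 : commutant (commutant M) = M) (Mb : forall x, M x -> bounded x).
Hypothesis Nb : forall x, N x -> bounded x.
Hypothesis phi_MN : forall x, M x -> N (phi x).
Hypothesis phi_lin : forall c a b, bounded a -> bounded b -> phi (c *: a + b) = c *: phi a + phi b.
Hypothesis phi_positive : forall x, bounded x -> positive_op x -> positive_op (phi x).
Hypothesis phi_small : forall (c : R) u (e : R), 0 <= c -> 0 < e ->
  exists m (f : 'I_m -> F), exists2 d : R, 0 < d &
  forall p, bounded_by c p -> (forall i, nrm (p (f i)) <= d) -> nrm (phi p u) <= e.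

(** phi preserves order, and phi x u is a limit of vectors phi d u by strong continuity; so every
    upper bound of phi(D) is above phi x. *)
Lemma normal_of_small : normal_map M N phi.
Proof.
move=> D x DM Ddir Dx; have [Mx Dlex _] := Dx.
have xb := Mb Mx.
have Db d : D d -> bounded d by move=> /DM[/Mb].
have phiB a b u : bounded a -> bounded b ->
    phi (fun u => a u - b u) u = phi a u - phi b u.
  move=> ab bb.
  have -> : (fun u => a u - b u) = -1 *: b + a by apply/funext => w; rewrite addrC -scaleN1r.
  by rewrite phi_lin// [LHS]addrC scaleN1r.
have sub_bounded (a b : F -> F) : bounded a -> bounded b -> bounded (fun u => a u - b u).
  move=> ab bb; have := bounded_add ab (bounded_scale (-1) bb).
  by congr bounded; apply/funext => u; rewrite scaleN1r.
split; first exact: phi_MN.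
- move=> _ [d Dd <-] u; rewrite -phiB//; last exact: Db.
  apply: phi_positive; first by apply: sub_bounded => //; exact: Db.
  by move=> w; exact: Dlex.
move=> y Ny ub u.
have [c c0 hc] := vigier M2 Mb DM Ddir Dx.
have /choice[d hd] : forall n : nat, exists d, D d /\ nrm (phi x u - phi d u) <= n.+1%:R^-1.
  move=> n; have [|m [f [r r0 h]]] := @phi_small c u n.+1%:R^-1 c0; first by rewrite invr_gt0.
  have [d [Dd db df]] := hc m f r r0; exists d; split => //.
  by rewrite -phiB//; [exact: h|exact: Db].
have l1 : hlim (ip_form G) (fun n => y u - phi (d n) u) (y u - phi x u).
  move=> e e0; have [|n hn] := natS_inv_lt (_ : 0 < e / 2); first by lra.
  exists n => k /hn h; rewrite opprB addrC addrA subrK.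
  by apply: le_lt_trans (hd k).2 _; move: (k.+1%:R^-1) h => t; lra.
have l2 : hlim (ip_form G) (fun=> u) u by move=> e e0; exists 0%N => n _; rewrite subrr hnorm0.
apply: clim_ge0 (clim_hform l2 l1) _ => n.
by apply: ub; exists (d n) => //; case: (hd n).
Qed.

End NormalMaps.

(** Each remaining word is one letter shorter than w. The size is an argument of G so that it can be
    replaced inside any summand. *)
Lemma sum_dels_size (E : nmodType) (X : Type) (G : nat -> nat * X * seq X -> E) w :
  \sum_(d <- dels w) G (size d.2).+1 d = \sum_(d <- dels w) G (size w) d.
Proof.
elim: w G => [|x w IHw] G /=; first by rewrite !big_nil.
rewrite !big_cons !big_map /=; congr (_ + _).
exact: (IHw (fun n d => G n.+1 (d.1.1.+1, d.1.2, x :: d.2))).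
Qed.

Section NormalOrdering.
Context {R : realType}.
Local Notation C := R[i].
Variables (q : R).
Context {Z X : Type} (em em' : Z -> X).

(* The Wick product of the letters e, each one split into its creation part em e
   and its annihilation part em' e, with nu evaluating the normally ordered words. *)
Fixpoint normal_order (E : lmodType C) (v : seq Z) (nu : seq X -> seq X -> E) : E :=
  if v is e :: v' then
    normal_order v' (fun k l => nu (em e :: k) l) +
    normal_order v' (fun k l => (q ^+ size k)%:C *: nu k (em' e :: l))
  else nu [::] [::].

Lemma normal_order_ext (E : lmodType C) v (nu nu' : seq X -> seq X -> E) :
  (forall k l, nu k l = nu' k l) ->
  normal_order v nu = normal_order v nu'.
Proof. by move=> h; congr normal_order; apply/funext => k; apply/funext => l. Qed.

Context {E : lmodType C}.
Implicit Types nu : seq X -> seq X -> E.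

Lemma normal_order_linear (E' : lmodType C) (f : E -> E') v nu : linear f ->
  f (normal_order v nu) = normal_order v (fun k l => f (nu k l)).
Proof.
move=> fl; elim: v nu => //= e v IHv nu; rewrite linD// !IHv; congr (_ + _).
by apply: normal_order_ext => k l; rewrite linZ.
Qed.

Lemma normal_order_lin v a nu nu' : normal_order v (fun k l => a *: nu k l + nu' k l) =
  a *: normal_order v nu + normal_order v nu'.
Proof.
elim: v nu nu' => //= e v IHv nu nu'; rewrite IHv scalerDr addrACA; congr (_ + _).
by rewrite -IHv; apply: normal_order_ext => k l; rewrite scalerDr !scalerA mulrC.
Qed.

Lemma normal_order_creation v nu : (forall k x l, nu k (x :: l) = 0) ->
  normal_order v nu = nu (map em v) [::].
Proof.
elim: v nu => //= e v IHv nu nu0; rewrite !IHv => [|k x l|k x l].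
- by rewrite nu0 scaler0 addr0.
- by rewrite nu0 scaler0.
- exact: nu0.
Qed.

Lemma scale_linear (a : C) : linear ( *:%R a : E -> E).
Proof. by move=> b x y; rewrite scalerDr !scalerA mulrC. Qed.

(** Contracting a letter against the creation part of a Wick product amounts to deleting a letter of
    v first. In the terms where e becomes an annihilation letter, the deletion shortens by one the
    creation word that e crosses, which accounts for the extra factor q. *)
Lemma normal_order_dels (g : X -> C) v nu :
  normal_order v (fun k l => \sum_(d <- dels k) ((q ^+ d.1.1)%:C * g d.1.2) *: nu d.2 l) =
  \sum_(d <- dels v) ((q ^+ d.1.1)%:C * g (em d.1.2)) *: normal_order d.2 nu.
Proof.
elim: v nu => [|e v IHv] nu /=; first by rewrite !big_nil.
rewrite big_cons /= expr0 mul1r big_map /=.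
rewrite (normal_order_ext v (nu' := fun k l => g (em e) *: nu k l +
  (q%:C *: \sum_(d <- dels k) ((q ^+ d.1.1)%:C * g d.1.2) *: nu (em e :: d.2) l))); last first.
  move=> k l; rewrite big_cons /= expr0 mul1r big_map scaler_sumr; congr (_ + _).
  by apply: eq_bigr => d _; rewrite /= exprS rmorphM !scalerA mulrA.
rewrite normal_order_lin -addrA; congr (_ + _).
rewrite -(normal_order_linear _ _ (scale_linear q%:C)) (IHv (fun k l => nu (em e :: k) l)).
rewrite (normal_order_ext v (nu' := fun k l =>
  q%:C *: \sum_(d <- dels k) ((q ^+ d.1.1)%:C * g d.1.2) *:
    ((q ^+ size d.2)%:C *: nu d.2 (em' e :: l)))); last first.
  move=> k l; rewrite !scaler_sumr.
  rewrite -(sum_dels_size (fun n (d : nat * X * seq X) =>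
    (q ^+ n)%:C *: (((q ^+ d.1.1)%:C * g d.1.2) *: nu d.2 (em' e :: l)))).
  by apply: eq_bigr => d _; rewrite /= !scalerA; congr (_ *: _); rewrite exprS rmorphM /=; ring.
rewrite -(normal_order_linear _ _ (scale_linear q%:C)).
rewrite (IHv (fun k l => (q ^+ size k)%:C *: nu k (em' e :: l))).
rewrite -scalerDr -big_split scaler_sumr; apply: eq_bigr => d _ /=.
by rewrite -scalerDr scalerA exprS rmorphM mulrA.
Qed.

End NormalOrdering.

(** T acts on each letter and keeps the sizes, hence the powers of q: this is how phi carries Wick
    operators to Wick operators. *)
Lemma normal_order_map (R : realType) (q : R) (Z X X' : Type) (T : X -> X') (em em' : Z -> X)
  (E : lmodType R[i]) v (nu : seq X' -> seq X' -> E) :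
  normal_order q (T \o em) (T \o em') v nu =
  normal_order q em em' v (fun k l => nu (map T k) (map T l)).
Proof.
elim: v nu => //= e v IHv nu; rewrite !IHv; congr (_ + _).
by apply: normal_order_ext => k l; rewrite size_map.
Qed.

Lemma normal_order_bounded (R : realType) (q : R) (Z X : Type) (em em' : Z -> X)
  (F : complexHilbert R) v (nu : seq X -> seq X -> F -> F) : (forall k l, bounded (nu k l)) ->
  bounded (fun u => normal_order q em em' v (fun k l => nu k l u)).
Proof.
elim: v nu => [|e v IHv] nu nub /=; first exact: nub.
apply: bounded_add; first exact: (IHv (fun k l => nu (em e :: k) l)).
apply: (IHv (fun k l u => (q ^+ size k)%:C *: nu k (em' e :: l) u)) => k l.
exact: bounded_scale.
Qed.

(** Not an instance of [normal_order_linear], as phi is linear on bounded operators only. *)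
Lemma normal_order_operator (R : realType) (q : R) (Z X : Type) (em em' : Z -> X)
  (F G : complexHilbert R) (phi : (F -> F) -> G -> G) v (nu : seq X -> seq X -> F -> F) :
  (forall c a b, bounded a -> bounded b -> phi (c *: a + b) = c *: phi a + phi b) ->
  (forall k l, bounded (nu k l)) ->
  phi (fun u => normal_order q em em' v (fun k l => nu k l u)) =
  fun u => normal_order q em em' v (fun k l => phi (nu k l) u).
Proof.
move=> phil; elim: v nu => [|e v IHv] nu nub //=.
have b1 := @normal_order_bounded _ q _ _ em em' _ v
  (fun k l => nu (em e :: k) l) (fun k l => nub _ _).
have b2 := @normal_order_bounded _ q _ _ em em' _ v
  (fun k l u => (q ^+ size k)%:C *: nu k (em' e :: l) u) (fun k l => bounded_scale _ (nub _ _)).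
have /= h := phil 1 _ _ b1 b2; rewrite !scale1r in h.
rewrite [LHS]h (IHv (fun k l => nu (em e :: k) l)) // (IHv (fun k l u =>
  (q ^+ size k)%:C *: nu k (em' e :: l) u)); last by move=> k l; exact: bounded_scale.
apply/funext => u; congr (_ + _); apply: normal_order_ext => k l.
have z0 : bounded (fun _ : F => 0 : F).
  by have := bounded_scale 0 (@bounded_id _ F); congr bounded; apply/funext => w; rewrite scale0r.
have phi0 : phi (fun _ => 0) = fun=> 0.
  transitivity (phi (-1 *: (fun=> 0) + (fun=> 0))); last by rewrite phil// scaleN1r addNr.
  by congr phi; apply/funext => w; rewrite -[RHS]/(-1 *: 0 + 0) scaler0 addr0.
have -> : (fun w => (q ^+ size k)%:C *: nu k (em' e :: l) w) =
  (q ^+ size k)%:C *: nu k (em' e :: l) + (fun=> 0).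
  by apply/funext => w; rewrite -[RHS]/(_ *: nu _ _ w + 0) addr0.
by rewrite phil// phi0 -[LHS]/(_ *: phi _ u + 0) addr0.
Qed.

(** * Wick operators and the algebra generated by the fields *)

Section WickAlgebra.
Context {R : realType}.
Local Notation C := R[i].
Context {X : Type} {F : complexHilbert R}.
Variables (q : R) (k : X -> X -> C) (x0 : X) (t : seq X -> F).
Hypotheses (q0 : -1 < q) (q1 : q < 1) (kp : psd_kernel k).
Hypothesis t_ip : forall v w, ip (t v) (t w) = qwords q k x0 v w.
Hypothesis tt : total t.
Context {Z : Type}.
Variables (em em' : Z -> X) (sw : Z -> Z).
Hypotheses (em_sw : forall z, em (sw z) = em' z) (em'_sw : forall z, em' (sw z) = em z).

Local Notation cr := (cre q0 q1 kp t_ip tt).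
Local Notation an := (ann q0 q1 kp t_ip tt).

Let cr_lin x : linear (cr x). Proof. exact: bounded_lin (cre_bounded _ _ _ _ _ _). Qed.
Let an_lin x : linear (an x). Proof. exact: bounded_lin (ann_bounded _ _ _ _ _ _). Qed.

(** Stands for s(a) + i s(b) when z = a + i b: em z is the image of z, em' z that of its conjugate,
    and sw is the conjugation. Abstract letters Z let words in K_C be evaluated in K and, through T,
    in H. *)
Definition field_op (z : Z) : F -> F := cr (em z) + an (em' z).

Lemma field_bounded z : bounded (field_op z).
Proof. by apply: bounded_add; [exact: cre_bounded|exact: ann_bounded]. Qed.

Lemma field_adjoint z : adjoint (field_op z) (field_op (sw z)).
Proof.
move=> u v; rewrite /field_op em_sw em'_sw.
rewrite -[LHS]/(ip (cr _ u + an _ u) v) -[RHS]/(ip u (cr _ v + an _ v)).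
by rewrite hfDl hfDr addrC /= cre_ann (adjoint_sym (cre_ann _ _ _ _ _ _)).
Qed.

Lemma ann_op_word f w u : an f (op_word cr w u) =
  \sum_(d <- dels w) ((q ^+ d.1.1)%:C * k f d.1.2) *: op_word cr d.2 u +
  (q ^+ size w)%:C *: op_word cr w (an f u).
Proof.
elim: w => [|x w IHw] /=; first by rewrite big_nil expr0 scale1r add0r.
rewrite ann_cre IHw big_cons /= expr0 mul1r -addrA; congr (_ + _).
rewrite linD// scalerDr big_map /= (lin_sum (cr_lin x)) scaler_sumr; congr (_ + _).
  by apply: eq_bigr => d _; rewrite linZ// scalerA exprS rmorphM mulrA.
by rewrite linZ// scalerA exprS rmorphM.
Qed.

Definition wick_op (v : seq Z) (u : F) : F :=
  normal_order q em em' v (fun r s => op_word cr r (op_word an s u)).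

Lemma wick_op_bounded v : bounded (wick_op v).
Proof.
apply: (normal_order_bounded q em em' v (nu := fun r s => op_word cr r \o op_word an s)) => r s.
by apply: bounded_comp; apply: op_word_bounded => x; [exact: cre_bounded|exact: ann_bounded].
Qed.

(** The annihilation part of the field either contracts with a creation letter of a normally ordered
    word or crosses all of them, at the price q^size; the second case completes the Wick product of
    e v. *)
Lemma field_wick e v u : field_op e (wick_op v u) = wick_op (e :: v) u +
  \sum_(d <- dels v) ((q ^+ d.1.1)%:C * k (em' e) (em d.1.2)) *: wick_op d.2 u.
Proof.
rewrite -[LHS]/(cr (em e) (wick_op v u) + an (em' e) (wick_op v u)).
rewrite {1 2}/wick_op (normal_order_linear _ _ _ _ _ (cr_lin _)).
rewrite (normal_order_linear _ _ _ _ _ (an_lin _)).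
rewrite [wick_op (e :: v) u]/wick_op /= -addrA; congr (_ + _).
rewrite /wick_op -(normal_order_dels _ _ _ (k (em' e))) addrC.
rewrite -[X in _ = X + _]scale1r -normal_order_lin.
by apply: normal_order_ext => r s; rewrite scale1r ann_op_word.
Qed.

Lemma wick_vacuum v : wick_op v (t [::]) = t (map em v).
Proof.
rewrite /wick_op normal_order_creation.
  by rewrite /=; elim: (map em v) => //= x w ->; rewrite cre_t.
have cr0 r : op_word cr r 0 = 0 by elim: r => //= x r ->; rewrite lin0.
move=> r x s; suff -> : op_word an (x :: s) (t [::]) = 0 by [].
by elim: s x => [|y s IHs] x /=; [exact: ann_nil|have /= -> := IHs y; rewrite lin0].
Qed.

(** By [field_wick] this span is stable under left multiplication by fields; it is thus a unital
    algebra, closed under adjoints, on which phi is known explicitly. *)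
Inductive wick_span : set (F -> F) :=
| wick_span_word v : wick_span (wick_op v)
| wick_span_lin c a b : wick_span a -> wick_span b -> wick_span (c *: a + b).

Lemma wick_op_nil : wick_op [::] = idfun.
Proof. by []. Qed.

Lemma wick_span0 : wick_span (fun=> 0).
Proof.
rewrite (_ : (fun=> 0) = -1 *: wick_op [::] + wick_op [::]).
  by apply: wick_span_lin; exact: wick_span_word.
by rewrite scaleN1r addNr.
Qed.

(* Induction on words, through W(e v) = s(e) W(v) - \sum_j q^j <e, v_j> W(v \ v_j). *)
Lemma wick_ind (P : set (F -> F)) : P idfun -> (forall c a b, P a -> P b -> P (c *: a + b)) ->
  (forall z a, P a -> P (field_op z \o a)) -> forall v, P (wick_op v).
Proof.
move=> P1 Plin Pf v; have [n] := ubnP (size v).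
elim: n v => // n IHn [|e v] /= vn; first by rewrite wick_op_nil.
have P0 : P (fun=> 0).
  by have := Plin (-1) _ _ P1 P1; rewrite scaleN1r addNr.
rewrite (_ : wick_op (e :: v) = -1 *: (fun u =>
  \sum_(d <- dels v) ((q ^+ d.1.1)%:C * k (em' e) (em d.1.2)) *: wick_op d.2 u) +
  (field_op e \o wick_op v)); last first.
  by apply/funext => u; rewrite scaleN1r /= -[RHS]/(- _ + field_op e _) field_wick addrC addrK.
apply: (Plin); last exact/Pf/IHn.
have Psum (r : seq nat) (c : nat -> C) (g : nat -> F -> F) : (forall i, i \in r -> P (g i)) ->
    P (fun u => \sum_(i <- r) c i *: g i u).
  elim: r => [|i r IHr] hr.
    by rewrite (_ : (fun u => _) = fun=> 0)//; apply/funext => u; rewrite big_nil.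
  rewrite (_ : (fun u => _) = c i *: g i + (fun u => \sum_(i <- r) c i *: g i u)); last first.
    by apply/funext => u; rewrite big_cons.
  apply: Plin; first by apply: hr; rewrite mem_head.
  by apply: IHr => j jr; apply: hr; rewrite in_cons jr orbT.
rewrite (_ : (fun u => _) = fun u => \sum_(i <- iota 0 (size v))
    ((q ^+ i)%:C * k (em' e) (em (nth e v i))) *: wick_op (take i v ++ drop i.+1 v) u); last first.
  by apply/funext => u; rewrite (delsE e) big_map.
apply: Psum => i; rewrite mem_iota add0n => /= iv; apply: IHn.
by rewrite size_cat size_take size_drop iv; move: vn iv; lia.
Qed.

Lemma wick_span_bounded a : wick_span a -> bounded a.
Proof.
elim=> [v|c x y _ xb _ yb]; first exact: wick_op_bounded.
exact: bounded_add (bounded_scale c xb) yb.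
Qed.

Lemma wick_span_field z : wick_span (field_op z).
Proof.
rewrite (_ : field_op z = wick_op [:: z]); first exact: wick_span_word.
by apply/funext => u; rewrite /wick_op /= expr0 scale1r.
Qed.

Lemma wick_span_fieldM z a : wick_span a -> wick_span (field_op z \o a).
Proof.
elim=> [v|c x y _ IHx _ IHy]; last first.
  rewrite (_ : _ \o _ = c *: (field_op z \o x) + (field_op z \o y)); first exact: wick_span_lin.
  by apply/funext => u; exact: (bounded_lin (field_bounded z)).
have wsum (r : seq (nat * Z * seq Z)) c : wick_span (fun u => \sum_(d <- r) c d *: wick_op d.2 u).
  elim: r => [|d r IHr].
    by rewrite (_ : (fun u => _) = fun=> 0); [exact: wick_span0|apply/funext => u; rewrite big_nil].
  rewrite (_ : (fun u => _) = c d *: wick_op d.2 + (fun u => \sum_(d <- r) c d *: wick_op d.2 u)).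
    by apply: wick_span_lin => //; exact: wick_span_word.
  by apply/funext => u; rewrite big_cons.
rewrite (_ : _ \o _ = 1 *: wick_op (z :: v) + (fun u =>
  \sum_(d <- dels v) ((q ^+ d.1.1)%:C * k (em' z) (em d.1.2)) *: wick_op d.2 u)).
  by apply: wick_span_lin; [exact: wick_span_word|exact: wsum].
by apply/funext => u; rewrite /= field_wick scale1r.
Qed.

Lemma wick_span_comp a b : wick_span a -> wick_span b -> wick_span (a \o b).
Proof.
move=> wa wb; elim: wa => [v|c x y _ wx _ wy]; last exact: (wick_span_lin c wx wy).
apply: (@wick_ind (fun x => wick_span (x \o b))) => //.
  by move=> c x y wx wy; exact: (wick_span_lin c wx wy).
by move=> z x wx; exact: (wick_span_fieldM z wx).
Qed.

Lemma wick_span_adjoint a : wick_span a -> exists2 b, wick_span b & adjoint a b.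
Proof.
pose P : set (F -> F) := fun a => exists2 b, wick_span b & adjoint a b.
have Plin c x y : P x -> P y -> P (c *: x + y).
  move=> [x' wx xx'] [y' wy yy']; exists (c^* *: x' + y'); first exact: wick_span_lin.
  move=> u v; rewrite -[LHS]/(ip (c *: x u + y u) v) -[RHS]/(ip u (c^* *: x' v + y' v)).
  by rewrite hfDl hfZl hfDr hfZr /= xx' yy'.
elim=> [v|c x y _ + _]; last exact: Plin.
apply: (@wick_ind P) => //.
  by exists idfun => //; rewrite -wick_op_nil; exact: wick_span_word.
move=> z x [x' wx xx']; exists (x' \o field_op (sw z)).
  by apply: wick_span_comp => //; exact: wick_span_field.
by move=> u w /=; rewrite field_adjoint xx'.
Qed.

End WickAlgebra.

(** * Odd trigonometric polynomials approximating the sign *)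

Section TrigonometricPolynomials.
Context {R : realType}.

(* [true] stands for odd functions, [false] for even ones. *)
Inductive trig_poly : bool -> (R -> R) -> Prop :=
| trig_sin t : trig_poly true (fun s => sin (t * s))
| trig_cos t : trig_poly false (fun s => cos (t * s))
| trig_lin b a f g : trig_poly b f -> trig_poly b g -> trig_poly b (fun s => a * f s + g s).

Lemma trig_poly0 b : trig_poly b (fun=> 0).
Proof.
have [f hf] : exists f, trig_poly b f.
  by case: b; eexists; [exact: (trig_sin 0)|exact: (trig_cos 0)].
by have := trig_lin (-1) hf hf; congr trig_poly; apply/funext => s; ring.
Qed.

Lemma trig_scale b a f : trig_poly b f -> trig_poly b (fun s => a * f s).
Proof.
move=> hf; have := trig_lin a hf (trig_poly0 b).
by congr trig_poly; apply/funext => s; rewrite addr0.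
Qed.

Lemma trig_mul b c f g : trig_poly b f -> trig_poly c g -> trig_poly (b (+) c) (fun s => f s * g s).
Proof.
have mulS d a (f' g' h' : R -> R) : trig_poly d f' -> trig_poly d g' ->
    (forall s, h' s = a * (f' s) + a * (g' s)) -> trig_poly d h'.
  move=> hf hg e; have := trig_lin a hf (trig_scale a hg).
  by congr trig_poly; apply/funext => s; rewrite e.
have mulL d h a (g1 g2 : R -> R) : trig_poly d (fun s => h s * g1 s) ->
    trig_poly d (fun s => h s * g2 s) -> trig_poly d (fun s => h s * (a * g1 s + g2 s)).
  by move=> h1 h2; have := trig_lin a h1 h2; congr trig_poly; apply/funext => s; ring.
move=> hf; elim: hf g => [t|t|b' a f1 f2 _ IH1 _ IH2] g hg.
- elim: hg => [r|r|c' a g1 g2 _ IH1 _ IH2]; last exact: mulL.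
  + apply: (mulS _ (2^-1) _ _ _ (trig_cos (t - r)) (trig_scale (-1) (trig_cos (t + r)))) => s.
    by rewrite !mulrDl !mulNr !cosD cosN sinN; field.
  + apply: (mulS _ (2^-1) _ _ _ (trig_sin (t + r)) (trig_sin (t - r))) => s.
    by rewrite !mulrDl !mulNr !sinD cosN sinN; field.
- elim: hg => [r|r|c' a g1 g2 _ IH1 _ IH2]; last exact: mulL.
  + apply: (mulS _ (2^-1) _ _ _ (trig_sin (t + r)) (trig_scale (-1) (trig_sin (t - r)))) => s.
    by rewrite !mulrDl !mulNr !sinD cosN sinN; field.
  + apply: (mulS _ (2^-1) _ _ _ (trig_cos (t - r)) (trig_cos (t + r))) => s.
    by rewrite !mulrDl !mulNr !cosD cosN sinN; field.
have := trig_lin a (IH1 _ hg) (IH2 _ hg).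
by congr trig_poly; apply/funext => s; ring.
Qed.

Lemma trig_bounded b f : trig_poly b f -> exists c, forall s, `|f s| <= c.
Proof.
elim=> [t|t|b' a g h _ [c hc] _ [d hd]].
- by exists 1 => s; rewrite ler_norml sin_geN1 sin_le1.
- by exists 1 => s; rewrite ler_norml cos_geN1 cos_le1.
- exists (`|a| * c + d) => s; apply: le_trans (ler_normD _ _) _.
  by rewrite normrM lerD// ler_wpM2l.
Qed.

Lemma trig_measurable b f : trig_poly b f -> measurable_fun [set: measurableTypeR R] f.
Proof.
elim=> [t|t|b' a g h _ mg _ mh].
- apply: (measurableT_comp (f := @sin R)); last exact: mulrl_measurable.
  by apply: continuous_measurable_fun; exact: continuous_sin.
- apply: (measurableT_comp (f := @cos R)); last exact: mulrl_measurable.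
  by apply: continuous_measurable_fun; exact: continuous_cos.
- by apply: measurable_funD => //; apply: measurable_funM => //; exact: measurable_cst.
Qed.

(** The Newton-Schulz iteration for the sign function, with attracting fixed points -1 and 1. Being
    an odd polynomial, it keeps odd trigonometric polynomials odd. *)
Definition sign_step (y : R) := y * (3 - y ^+ 2) / 2.

Lemma sign_step_trig f k : trig_poly true f -> trig_poly true (fun s => iter k sign_step (f s)).
Proof.
move=> hf; elim: k => //= k IHk.
have := trig_lin (3 / 2) IHk (trig_scale (- 2^-1) (trig_mul (trig_mul IHk IHk) IHk)).
by congr trig_poly; apply/funext => s; rewrite /sign_step; field.
Qed.

Lemma sign_step_bounds y k : `|y| <= 1 -> `|iter k sign_step y| <= 1.
Proof.
move=> y1; elim: k => //= k; move: (iter _ _ _) => z {y1}.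
rewrite !ler_norml => /andP[z1 z2]; rewrite /sign_step.
(* [h1] and [h2] are 2 (1 - sign_step z) and 2 (1 + sign_step z) in factored form. *)
have h1 : 0 <= (z - 1) ^+ 2 * (z + 2) by rewrite mulr_ge0 ?sqr_ge0//; lra.
have h2 : 0 <= (z + 1) ^+ 2 * (2 - z) by rewrite mulr_ge0 ?sqr_ge0//; lra.
by apply/andP; split; lra.
Qed.

Lemma sign_stepN y k : iter k sign_step (- y) = - iter k sign_step y.
Proof. by elim: k => //= k ->; rewrite /sign_step; field. Qed.

(** While z < 1/2, a step adds z (1 - z^2) / 2 >= 3 z / 8, hence at least e / 4 since z >= e; from
    1/2 on it does not decrease z. The condition on k makes e (1 + k / 4) exceed 1/2. *)
Lemma sign_step_ge (e : R) k (y : R) : 0 < e -> e <= y -> y <= 1 -> 2 <= e * k%:R ->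
  2^-1 <= iter k sign_step y.
Proof.
move=> e0 ey y1 ek.
suff : Num.min 2^-1 (e * (1 + k%:R / 4)) <= iter k sign_step y.
  by rewrite ge_min => /orP[//|]; apply: le_trans; lra.
elim: k {ek} => [|k /=]; first by rewrite mul0r addr0 mulr1 ge_min ey orbT.
move=> IH.
have : `|iter k sign_step y| <= 1 by apply: sign_step_bounds; rewrite ler_norml; lra.
rewrite ler_norml => /andP[_ z1].
have z0 : Num.min 2^-1 e <= iter k sign_step y.
  apply: le_trans IH; rewrite le_min !ge_min lexx /=; apply/orP; right.
  have := divr_ge0 (ler0n R k) (ler0n R 4); move: (_ / _) => r r0; nra.
have -> : k.+1%:R = k%:R + 1 :> R by rewrite natr1.
move: (k%:R) (ler0n R k) (iter k sign_step y) IH z0 z1 => r r0 z.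
rewrite !ge_min /sign_step => /orP IH /orP z0 z1.
have [z2|z2] := leP 2^-1 z; apply/orP; [left|right].
  have : 0 <= (z - 2^-1) * (1 - z) by rewrite mulr_ge0//; lra.
  by nra.
have {}IH : e * (1 + r / 4) <= z by case: IH => //; lra.
have {}z0 : e <= z by case: z0 => //; lra.
have h : 0 <= z * ((2^-1 - z) * (2^-1 + z)) by rewrite !mulr_ge0//; lra.
nra.
Qed.

End TrigonometricPolynomials.

(** * Measures for which every sin (t ln l) has mean 0 *)

Section SineMean.
Context {R : realType}.
Variable mu : {measure set (measurableTypeR R) -> \bar R}.
Hypothesis mu_fin : (mu setT < +oo)%E.

Lemma bounded_integrable (f : R -> R) c : measurable_fun [set: measurableTypeR R] f ->
  (forall l, `|f l| <= c) -> mu.-integrable setT (EFin \o f).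
Proof.
move=> mf hf; apply: measurable_bounded_integrable => //.
by exists c; split; [exact: num_real|move=> M cM l _; exact: le_trans (hf l) (ltW cM)].
Qed.

Lemma Rintegral_indicator A : measurable A -> \int[mu]_l (\1_A l : R) = fine (mu A).
Proof. by move=> mA; rewrite /Rintegral integral_indic// setIT. Qed.

Hypothesis sine_mean : forall t : R, \int[mu]_l sin (t * ln l) = 0.

Let trig_ln_measurable b f : trig_poly b f ->
  measurable_fun [set: measurableTypeR R] (fun l => f (ln l)).
Proof. by move=> /trig_measurable mf; apply: measurableT_comp mf _; exact: measurable_ln. Qed.

Let trig_ln_integrable b f : trig_poly b f -> mu.-integrable setT (EFin \o (fun l => f (ln l))).
Proof.
move=> hf; have [c hc] := trig_bounded hf.
exact: (bounded_integrable (trig_ln_measurable hf) (fun l => hc _)).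
Qed.

Lemma trig_mean f : trig_poly true f -> \int[mu]_l f (ln l) = 0.
Proof.
suff gen b g : trig_poly b g -> b = true -> \int[mu]_l g (ln l) = 0 by move/gen; apply.
elim=> {f g} [t _|//|b' a g h hg IHg hh IHh b1].
  exact: sine_mean.
rewrite RintegralD//.
- by rewrite RintegralZl// ?IHg// ?IHh ?mulr0 ?addr0//; exact: trig_ln_integrable hg.
- exact: (trig_ln_integrable (trig_scale a hg)).
- exact: trig_ln_integrable hh.
Qed.

(* The iteration turns sin (s / n) into an odd trigonometric polynomial which is
   bounded by 1 everywhere and at least 1/2 for 2 <= s <= n. *)
Lemma sine_mean_mass (n : nat) : (2 < n)%N ->
  fine (mu setT) <=
  3 * (fine (mu `[expR (-2), +oo[%classic) + fine (mu `]-oo, expR (- n%:R)]%classic)).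
Proof.
move=> n2; pose A : set (measurableTypeR R) := `[expR (-2), +oo[%classic.
pose C : set (measurableTypeR R) := `]-oo, expR (- n%:R)]%classic; rewrite -/A -/C.
have n0 : 0 < n%:R :> R by rewrite ltr0n; lia.
have n2' : 2 < n%:R :> R by rewrite ltr_nat.
have e2 : 0 < (2 / n%:R : R) < 1 by rewrite divr_gt0// ltr_pdivrMr// mul1r.
have pi2 : 1 <= pi / 2 :> R by have := pi_ge2 R; lra.
have e0 : 0 < sin (2 / n%:R) :> R by rewrite sin_gt0_pi//; lra.
(* Enough iterations to lift sin (2 / n), the least value of the sine on [2 / n, 1], to 1/2. *)
have [k hk] : exists k : nat, 2 <= sin (2 / n%:R) * k%:R :> R.
  have [k hk] := natS_inv_lt (divr_gt0 e0 (ltr0Sn R 1)); exists k.+1.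
  have := hk k (leqnn k); rewrite -[_^-1]mul1r ltr_pdivrMr ?ltr0n//.
  by rewrite mulrAC ltr_pdivlMr// => /ltW; rewrite mul1r.
pose f s : R := iter k sign_step (sin (n%:R^-1 * s)).
have ft : trig_poly true f by apply: sign_step_trig; exact: trig_sin.
have mA : measurable (A : set (measurableTypeR R)) by exact: measurable_itv.
have mC : measurable (C : set (measurableTypeR R)) by exact: measurable_itv.
(* Off A and C one has -n < ln l < -2, where f is at most -1/2; elsewhere f <= 1. As f has mean 0,
   integration yields the factor 3. *)
have fbound l : f (ln l) <= 3 / 2 * (\1_A l + \1_C l) - 2^-1.
  have f1 : f (ln l) <= 1.
    have := @sign_step_bounds R (sin (n%:R^-1 * ln l)) k.
    by rewrite !ler_norml sin_geN1 sin_le1 => /(_ isT)/andP[].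
  rewrite !indicE; case: (boolP (l \in A)) => lA.
    by case: (l \in C); rewrite /=; lra.
  case: (boolP (l \in C)) => lC; first by rewrite /=; lra.
  move: lA lC; rewrite !notin_setE /A /C /= !in_itv /= andbT => /negP lA /negP lC.
  rewrite -!ltNge in lA lC.
  have l0 : 0 < l by apply: lt_trans lC; exact: expR_gt0.
  have h1 : ln l < -2 by rewrite -ltr_expR lnK.
  have h2 : - n%:R < ln l by rewrite -ltr_expR lnK.
  have u1 : - (n%:R^-1 * ln l) <= 1 by rewrite -mulrN mulrC ler_pdivrMr// mul1r; lra.
  have u2 : 2 / n%:R <= - (n%:R^-1 * ln l) by rewrite -mulrN [leRHS]mulrC ler_pM2r ?invr_gt0//; lra.
  have := @sign_step_ge R _ k (- sin (n%:R^-1 * ln l)) e0.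
  rewrite sign_stepN -sinN => h.
  have : 2^-1 <= - f (ln l).
    apply: h hk; last exact: sin_le1.
    move: u2; rewrite le_eqVlt => /predU1P[<-//|u2]; apply/ltW.
    by rewrite ltr_sin// in_itv /=; apply/andP; split; lra.
  by lra.
have indic01 (B : set (measurableTypeR R)) l : 0 <= (\1_B l : R) <= 1.
  by rewrite indicE; case: (_ \in _); rewrite ?lexx ler01.
have ii B : measurable B -> mu.-integrable setT (EFin \o (\1_B : measurableTypeR R -> R)).
  move=> mB; apply: (@bounded_integrable _ 1); first exact: measurable_indic.
  by move=> l; rewrite indicE; case: (_ \in _); rewrite ?normr1 ?normr0.
have ic (c : R) : mu.-integrable setT (EFin \o (fun=> c)).
  by apply: (@bounded_integrable _ `|c|) => //; exact: measurable_cst.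
have iAC : mu.-integrable setT (EFin \o (fun l : measurableTypeR R => \1_A l + \1_C l : R)).
  apply: (@bounded_integrable _ 2); first by apply: measurable_funD; exact: measurable_indic.
  by move=> l; rewrite ger0_norm; have := indic01 A l; have := indic01 C l; lra.
have iAC' : mu.-integrable setT
    (EFin \o (fun l : measurableTypeR R => 3 / 2 * (\1_A l + \1_C l) : R)).
  apply: (@bounded_integrable _ 3).
    apply: measurable_funM; first exact: measurable_cst.
    by apply: measurable_funD; exact: measurable_indic.
  by move=> l; rewrite ger0_norm; have := indic01 A l; have := indic01 C l; lra.
have := @le_Rintegral _ _ _ mu setT (fun l => f (ln l)) (fun l => 3 / 2 * (\1_A l + \1_C l) - 2^-1)
  measurableT (trig_ln_integrable ft) _ (fun l _ => fbound l).
rewrite trig_mean// RintegralB// RintegralZl// RintegralD// ?Rintegral_cst//; try exact: ii.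
rewrite !Rintegral_indicator// => h; have {h} := h _.
suff hh : mu.-integrable setT (EFin \o (fun l : measurableTypeR R =>
    3 / 2 * (\1_A l + \1_C l) - 2^-1 : R)) by move=> /(_ hh); lra.
have mAC : measurable_fun [set: measurableTypeR R] (fun l => \1_A l + \1_C l : R).
  by apply: measurable_funD; exact: measurable_indic.
apply: (@bounded_integrable _ 3).
  by apply: measurable_funB => //; apply: measurable_funM.
by move=> l; rewrite ler_norml; have := indic01 A l; have := indic01 C l; lra.
Qed.

End SineMean.

(** * The inner product of the complexification *)

Section ComplexifiedForm.
Context {R : realType} {HR : realHilbert R}.
Local Notation C := R[i].
Local Notation HC := (complexification HR).

Lemma rip_linear (x u v : HR) a : ip x (a *: u + v) = a * ip x u + ip x v.
Proof. by rewrite /ip linearPl. Qed.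

Lemma rip_sym (x y : HR) : ip y x = ip x y.
Proof. by rewrite /ip (hermC (hilbert_form HR)) /= expr0 mul1r. Qed.

Lemma ripxx (x : HR) : ip x x = `|x| ^+ 2.
Proof. exact: hilbert_formE. Qed.

Lemma ripD (x u v : HR) : ip x (u + v) = ip x u + ip x v.
Proof. by have := rip_linear x u v 1; rewrite scale1r mul1r. Qed.

Lemma rip0 (x : HR) : ip x 0 = 0.
Proof. by have := rip_linear x 0 0 (-1); rewrite scaler0 addr0 mulN1r addNr. Qed.

Lemma ripZ (x u : HR) a : ip x (a *: u) = a * ip x u.
Proof. by have := rip_linear x u 0 a; rewrite addr0 rip0 addr0. Qed.

Lemma ripN (x u : HR) : ip x (- u) = - ip x u.
Proof. by rewrite -scaleN1r ripZ mulN1r. Qed.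

Lemma cip_linear (x : HC) a (u v : HC) : cip x (a *: u + v) = a * cip x u + cip x v.
Proof.
case: a => a b; apply: complex_ext => /=; rewrite ?(ripD, ripN, ripZ); ring.
Qed.

Lemma cip_sym (x y : HC) : cip y x = (cip x y)^*.
Proof.
apply: complex_ext => /=; rewrite ?[ip y.1 _]rip_sym ?[ip y.2 _]rip_sym//.
by ring.
Qed.

Lemma cip_linearl (x : HC) a (u v : HC) : cip (a *: u + v) x = a^* * cip u x + cip v x.
Proof.
rewrite [cip u x]cip_sym [cip v x]cip_sym cip_sym cip_linear.
move: a (cip x u) (cip x v) => [a1 a2] [b1 b2] [c1 c2].
by apply: complex_ext => /=; ring.
Qed.

Lemma cip_ge0 (x : HC) : 0 <= complex.Re (cip x x).
Proof. by rewrite /= !ripxx addr_ge0 ?sqr_ge0. Qed.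

Definition cip_form : hform HC := HForm cip_linear cip_sym cip_ge0.
Canonical cip_form.

Lemma cip_eq0 (x : HC) : complex.Re (cip x x) = 0 -> x = 0.
Proof.
case: x => a b /=; rewrite !ripxx => h.
have ha := sqr_ge0 `|a|; have hb := sqr_ge0 `|b|.
congr pair; apply/eqP; rewrite -normr_eq0 -sqrf_eq0; apply/eqP; lra.
Qed.

End ComplexifiedForm.

(** * Spectral measures of positive injective operators *)

Section PositiveInjective.
Context {R : realType} {HR : realHilbert R}.
Local Notation C := R[i].
Local Notation HC := (complexification HR).
Variable A : operator HR.
Hypotheses (A_sa : self_adjoint A) (A_pos : positive_operator A) (A_inj : injective_operator A).

Let A_iff z w : A z w <-> forall x y, A x y -> cip z y = cip w x.
Proof. by case: A_sa => _; apply. Qed.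

Let A_sym z w x y : A z w -> A x y -> cip z y = cip w x.
Proof. by move=> /A_iff; apply. Qed.

Let A_lin c z w z' w' : A z w -> A z' w' -> A (c *: z + z') (c *: w + w').
Proof.
move=> h h'; apply/A_iff => x y xy.
rewrite !(hfDl cip_form) !(hfZl cip_form) /=.
by rewrite (A_sym h xy) (A_sym h' xy).
Qed.

(* Cauchy-Schwarz for the form <x, A x'> makes A w orthogonal to the domain of A,
   so that A 0 (A w) holds. *)
Lemma positive_injective_null w y : A w y -> cip w y = 0 -> w = 0.
Proof.
move=> wy wy0.
have A00 : A 0 0 by have := A_lin (-1) wy wy; rewrite !scaleN1r !addNr.
have orth v a : A v a -> cip v y = 0.
  move=> va; set p := cip v y.
  have pos (t : R) : 0 <= complex.Re (cip v a) - 2 * t * normc p ^+ 2.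
    have /complex_ge0P[_] := A_pos (A_lin (- t%:C * p^*) wy va).
    rewrite cip_linearl !cip_linear wy0 (A_sym wy va) [cip y v]cip_sym -/p.
    rewrite mulr0 add0r addrA.
    have -> : (- t%:C * p^*)^* * p^* + - t%:C * p^* * p = (- (2 * t * normc p ^+ 2))%:C.
      have := mulc_conj p; case: p => p1 p2 /(congr1 (@complex.Re R)) /= <-.
      by apply: complex_ext => /=; ring.
    by rewrite ReD /= addrC.
  have [//|p0] := eqVneq p 0.
  have np : 0 < normc p ^+ 2.
    rewrite lt_neqAle sqr_ge0 andbT eq_sym sqrf_eq0; apply: contra p0 => /eqP h.
    by apply/eqP/eq0_normc.
  exfalso; pose m : R := normc p ^+ 2; rewrite -/m in np.
  (* A value of t at which the quantity in [pos] equals -1. *)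
  have := pos ((complex.Re (cip v a) + 1) / (2 * m)); rewrite -/m.
  move: (complex.Re _) => c; rewrite (_ : 2 * _ * m = c + 1); first by lra.
  by field; rewrite gt_eqF.
have y0 : y = 0.
  case: A_sa => fn _; apply: (fn 0) => //.
  by apply/A_iff => x a xa; rewrite (hf0l cip_form) /= cip_sym (orth _ _ xa) conjc0.
by apply: A_inj; rewrite -y0.
Qed.

End PositiveInjective.

Section SpectralMeasure.
Context {R : realType} {HR : realHilbert R}.
Local Notation C := R[i].
Local Notation HC := (complexification HR).
Variable E : spectral_measure HR.

Lemma smeasT (x : HC) : smeas E x setT = (complex.Re (cip x x))%:E.
Proof. by rewrite smeasE// sprojT. Qed.

Lemma smeas_fin (x : HC) : (smeas E x setT < +oo)%E.
Proof. by rewrite smeasT ltry. Qed.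

Lemma sproj_cip B (x : HC) : measurable B -> cip x (sproj E B x) = cip (sproj E B x) (sproj E B x).
Proof. by move=> mB; rewrite (sproj_sym E mB) -(sprojI E mB mB) setIid. Qed.

Lemma sproj0 (x : HC) : sproj E set0 x = 0.
Proof.
apply: cip_eq0; rewrite -sproj_cip//.
by have := smeasE E x (@measurable0 _ _); rewrite measure0 => -[].
Qed.

Lemma smeas_sproj B (x : HC) : measurable B -> smeas E (sproj E B x) (~` B) = 0.
Proof.
move=> mB; rewrite smeasE; last exact: measurableC.
by rewrite -(sprojI E)//; [rewrite setICl sproj0 (hf0r cip_form)|exact: measurableC].
Qed.

Variable A : operator HR.
Hypotheses (A_sa : self_adjoint A) (A_pos : positive_operator A) (A_inj : injective_operator A).
Hypothesis A_spec : is_spectral_measure_of A E.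

(** The vector w = E([-n, 0]) z lies in the domain of A, and <w, A w> is an integral of l over
    [-n, 0], hence nonpositive; positivity makes it 0, and [positive_injective_null] gives w = 0.
    The half-line is a countable union of such intervals. *)
Lemma smeas_nonpos (z : HC) : smeas E z (`]-oo, 0]%classic) = 0.
Proof.
have nul (n : nat) : smeas E z (`[- n%:R, 0]%classic) = 0.
  pose B : set (measurableTypeR R) := `[- n%:R, 0]%classic; rewrite -/B.
  have mB : measurable B by exact: measurable_itv.
  set w := sproj E B z; have wB : smeas E w (~` B) = 0 by exact: smeas_sproj.
  have aeB (P : measurableTypeR R -> Prop) : (forall l, B l -> P l) ->
      {ae smeas E w, forall l, P l}.
    move=> BP; exists (~` B); split => //; first exact: measurableC.
    by move=> l /= nP Bl; apply: nP; exact: BP.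
  have [domE AE] := A_spec.
  have [y wy] : exists y, A w y.
    apply/domE; apply: le_lt_trans (_ : (\int[smeas E w]_l (n%:R ^+ 2)%:E < +oo)%E).
      apply: ae_ge0_le_integral => //.
      - by move=> l _; rewrite lee_fin sqr_ge0.
      - by apply/measurable_EFinP; apply: measurable_funX; exact: measurable_id.
      apply: aeB => l; rewrite /B /= in_itv /= => /andP[l1 l2] _; rewrite lee_fin; nra.
    by rewrite integral_cst// smeasT -EFinM ltry.
  have wy0 : cip w y = 0.
    have /complex_ge0P[i0 r0] := A_pos wy; apply: complex_ext => //.
    apply/eqP; rewrite eq_le r0 andbT (AE _ _ wy) /spectral_integral /=.
    pose g (l : measurableTypeR R) : R := (l : R) * \1_B l.
    have mg : measurable_fun setT g.
      by apply: measurable_funM; [exact: measurable_id|exact: measurable_indic].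
    have lg : ae_eq (smeas E w) setT (fun l : measurableTypeR R => (l : R)%:E) (EFin \o g).
      by apply: aeB => l Bl _; rewrite /= /g indicE mem_set// mulr1.
    rewrite /Rintegral (ae_eq_integral (EFin \o g)) //; last exact/measurable_EFinP.
    have gN l : 0 <= - g l.
      rewrite /g indicE; case: (boolP (l \in B)) => [|_]; last by rewrite mulr0 oppr0.
      by rewrite inE /B /= in_itv /= mulr1 => /andP[_]; rewrite oppr_ge0.
    have := @integral_ge0N _ _ _ (smeas E w) setT (fun l => (- g l)%:E) (fun l _ => gN l).
    rewrite (eq_integral (EFin \o g)); last by move=> l _; rewrite EFinN oppeK.
    move=> ->; apply: fine_le0; rewrite oppe_le0.
    by apply: integral_ge0 => l _; rewrite lee_fin.
  have w0 : w = 0 by exact: positive_injective_null wy wy0.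
  by rewrite smeasE// -/w w0 (hf0r cip_form).
apply: measure_negligible; first exact: measurable_itv.
apply: (@negligibleS _ _ _ _ (\bigcup_n (`[- n%:R, 0]%classic : set (measurableTypeR R)))).
  move=> l; rewrite /= in_itv /= => l0; exists (Num.bound (- l)) => //=.
  rewrite in_itv /= l0 andbT lerNl; apply/ltW/archi_boundP; lra.
apply: negligible_bigcup => n; exists `[- n%:R, 0]%classic; split=> //; exact: measurable_itv.
Qed.

End SpectralMeasure.

(** * Comparison of the deformed norm with the original one *)

Section DeformedNorm.
Context {R : realType} {HR : realHilbert R} {U : R -> HR -> HR}.
Local Notation C := R[i].
Local Notation HC := (complexification HR).
Variable K : deformed_space U.
Local Notation E := (generator_spec K).
Local Notation emb := (deformed_emb K).

Let weight (l : measurableTypeR R) : R := 2 * l / (1 + l).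

Let weight_measurable : measurable_fun setT weight.
Proof.
have inv_measurable :
    measurable_fun [set: measurableTypeR R] (fun l : measurableTypeR R => (l : R)^-1).
  have -> : [set: measurableTypeR R] = [set 0] `|` [set~ 0] by rewrite setUv.
  apply/measurable_funU => //; first exact: measurableC.
  split; first exact: measurable_fun_set1.
  apply: open_continuous_measurable_fun.
    by apply: closed_openC; apply: accessible_closed_set1; exact: hausdorff_accessible.
  by move=> x /set_mem /= /eqP x0; exact: inv_continuous.
apply: measurable_funM; first by apply: measurable_funM => //; exact: measurable_id.
apply: (measurableT_comp inv_measurable).
by apply: measurable_funD => //; exact: measurable_id.
Qed.

Let pos : set (measurableTypeR R) := `]0, +oo[%classic.

Let generator_nonpos (z : HC) : smeas E z (`]-oo, 0]%classic) = 0.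
Proof.
apply: smeas_nonpos (generator_sa K) _ _ (generator_specP K) z.
  exact: generator_pos.
exact: generator_inj.
Qed.

(** The weight is unbounded near l = -1; the cut-off to l > 0, where it lies between 0 and 2,
    changes it on a null set only. *)
Let deformed_integral (z : HC) : complex.Re (ip (emb z) (emb z)) =
  \int[smeas E z]_l (weight l * \1_pos l).
Proof.
have mp : measurable pos by exact: measurable_itv.
have [_ DE] := deformationP K.
have -> : complex.Re (ip (emb z) (emb z)) = complex.Re (cip z (deformation K z)).
  by rewrite deformed_ip cip_sym Re_conjc.
rewrite DE /spectral_integral /= /Rintegral; congr fine.
apply: ae_eq_integral => //.
- by apply/measurable_EFinP; exact: weight_measurable.
- apply/measurable_EFinP.
  by apply: measurable_funM; [exact: weight_measurable|exact: measurable_indic].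
exists (`]-oo, 0]%classic : set (measurableTypeR R)); split.
- exact: measurable_itv.
- exact: generator_nonpos.
move=> l /= nl; rewrite in_itv /= leNgt; apply/negP => l0; apply: nl => _.
by rewrite /weight indicE mem_set ?mulr1// /pos /= in_itv /= l0.
Qed.

Let weight_integrable (z : HC) :
  (smeas E z).-integrable setT (EFin \o (fun l => weight l * \1_pos l)).
Proof.
have mp : measurable pos by exact: measurable_itv.
apply: (@bounded_integrable _ _ (smeas_fin E z) _ 2).
  by apply: measurable_funM; [exact: weight_measurable|exact: measurable_indic].
move=> l; rewrite indicE; case: (boolP (l \in pos)) => [|_]; last by rewrite mulr0 normr0.
rewrite inE /pos /= in_itv /= andbT mulr1 => l0.
have l1 : 0 < 1 + l by lra.
by rewrite /weight ger0_norm ?ler_pdivrMr// ?divr_ge0//; lra.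
Qed.

Let weight_pos_bound (l : measurableTypeR R) : 0 <= weight l * \1_pos l <= 2.
Proof.
rewrite indicE; case: (boolP (l \in pos)) => [|_]; last by rewrite mulr0 lexx /=.
rewrite inE /pos /= in_itv /= andbT mulr1 => l0; have l1 : 0 < 1 + l by lra.
by rewrite /weight ler_pdivrMr// divr_ge0 ?andTb//; lra.
Qed.

Lemma deformed_le (z : HC) : nrm (emb z) ^+ 2 <= 2 * complex.Re (cip z z).
Proof.
rewrite hnorm_sqr [X in X <= _]deformed_integral.
have := @le_Rintegral _ _ _ (smeas E z) setT (fun l => weight l * \1_pos l) (fun=> 2)
  measurableT (weight_integrable z) _ _.
rewrite Rintegral_cst// smeasT /=; apply.
- by apply: (@bounded_integrable _ _ (smeas_fin E z) _ 2) => // l; rewrite ger0_norm.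
- by move=> l _; case/andP: (weight_pos_bound l).
Qed.

(* Markov's inequality, l / (1 + l) being increasing. *)
Lemma deformed_markov (z : HC) (a : R) : 0 < a ->
  2 * a / (1 + a) * fine (smeas E z `[a, +oo[%classic) <= nrm (emb z) ^+ 2.
Proof.
move=> a0; rewrite hnorm_sqr [X in _ <= X]deformed_integral.
pose I : set (measurableTypeR R) := `[a, +oo[%classic; rewrite -/I.
have mI : measurable I by exact: measurable_itv.
have iI : (smeas E z).-integrable setT (EFin \o (\1_I : measurableTypeR R -> R)).
  apply: (@bounded_integrable _ _ (smeas_fin E z) _ 1); first exact: measurable_indic.
  by move=> l; rewrite indicE; case: (_ \in _); rewrite ?normr1 ?normr0.
rewrite -Rintegral_indicator// -RintegralZl//.
apply: le_Rintegral => //.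
  apply: (@bounded_integrable _ _ (smeas_fin E z) _ `|2 * a / (1 + a)|).
    by apply: measurable_funM => //; exact: measurable_indic.
  by move=> l; rewrite indicE; case: (_ \in _); rewrite ?mulr1 ?mulr0 ?normr0.
move=> l _; rewrite indicE; case: (boolP (l \in I)) => [|_]; last first.
  by rewrite mulr0; case/andP: (weight_pos_bound l).
rewrite inE /I /= in_itv /= andbT mulr1 => al.
rewrite indicE mem_set ?mulr1; last by rewrite /pos /= in_itv /= andbT; lra.
have l1 : 0 < 1 + (l : R) by lra.
have a1 : 0 < 1 + a by lra.
by rewrite /weight ler_pdivrMr// mulrAC ler_pdivlMr//; lra.
Qed.

(** Markov's inequality leaves no mass on [a, +oo[ for a > 0, and ]-oo, 0] carries none either, so
    the total mass |z|^2 vanishes. *)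
Lemma deformed_emb_eq0 (z : HC) : emb z = 0 -> z = 0.
Proof.
move=> z0; apply: cip_eq0.
have nul (a : R) : 0 < a -> smeas E z `[a, +oo[%classic = 0.
  move=> a0; have := deformed_markov z a0.
  have mI : measurable (`[a, +oo[%classic : set (measurableTypeR R)) by exact: measurable_itv.
  rewrite z0 hnorm0 expr0n /= smeasE// => h.
  congr _%:E; apply/eqP; rewrite eq_le; apply/andP; split.
    by move: h; rewrite pmulr_rle0// divr_gt0//; lra.
  by rewrite sproj_cip//; exact: cip_ge0.
suff : smeas E z setT = 0 by rewrite smeasT => -[].
apply: measure_negligible => //.
apply: (@negligibleS _ _ _ _ ((`]-oo, 0]%classic : set (measurableTypeR R)) `|`
    \bigcup_n (`[n.+1%:R^-1, +oo[%classic : set (measurableTypeR R)))).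
  move=> l _ /=; rewrite in_itv /=; have [l0|l0] := leP l 0; [by left|right].
  have [N /(_ N (leqnn N)) hN] := natS_inv_lt l0.
  by exists N => //=; rewrite in_itv /= andbT ltW.
apply: negligibleU.
  exists (`]-oo, 0]%classic : set (measurableTypeR R)); split=> //.
  exact: generator_nonpos.
apply: negligible_bigcup => n; exists (`[n.+1%:R^-1, +oo[%classic); split=> //.
by apply: nul; rewrite invr_gt0.
Qed.

Hypothesis U_og : orthogonal_group U.

(* The spectral measure of a real vector gives mean 0 to every sin (t ln l), so it
   is not concentrated near l = 0. *)
Lemma deformed_ge (x : HR) :
  expR (-2) / (1 + expR (-2)) * `|x| ^+ 2 <= 2 * nrm (emb (of_real x)) ^+ 2.
Proof.
set mu := smeas E (of_real x).
(* The complexified U_t maps (x, 0) to (U_t x, 0), so <x, A^(it) x> is real. *)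
have sine_mean (t : R) : \int[mu]_l sin (t * ln l) = 0.
  have [_ /(_ (of_real x)) /(congr1 (@complex.Im R))] := generator_ipow K t.
  rewrite /= => <-; have := og_linear U_og t (-1) 0 0.
  rewrite scaler0 addr0 scaleN1r addNr => ->.
  by rewrite rip0 [ip 0 _]rip_sym rip0 subrr.
(* These half-lines decrease to ]-oo, 0], a null set. *)
have small (e : R) : 0 < e ->
    exists2 n : nat, (2 < n)%N & fine (mu `]-oo, expR (- n%:R)]%classic) < e.
  pose F (n : nat) : set (measurableTypeR R) := `]-oo, expR (- n%:R)]%classic.
  have mF n : measurable (F n) by exact: measurable_itv.
  have FE : \bigcap_n F n = `]-oo, 0]%classic.
    apply/seteqP; split=> l /=.
      move=> h; rewrite in_itv /= leNgt; apply/negP => l0.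
      have := h (Num.bound `|- ln l|) Logic.I; rewrite /F /= in_itv /= leNgt => /negP; apply.
      rewrite -[ltRHS]lnK// ltr_expR ltrNl.
      apply: le_lt_trans (ler_norm _) _; apply: archi_boundP; exact: normr_ge0.
    by rewrite in_itv /= => l0 n _; rewrite /F /= in_itv /= (le_trans l0)// expR_ge0.
  have := @nonincreasing_cvg_mu _ _ _ mu F.
  rewrite FE generator_nonpos.
  move=> /(_ _ mF (measurable_itv _) _)/fine_cvg cv e0.
  have F0 : (mu (F 0%N) < +oo)%E.
    by apply: le_lt_trans (smeas_fin E (of_real x)); apply: le_measure; rewrite ?inE.
  have Fle : {homo F : n m / (n <= m)%N >-> (m <= n)%O}.
    move=> n m nm; rewrite subsetEset /F => l /=; rewrite !in_itv /= => /le_trans; apply.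
    by rewrite ler_expR lerN2 ler_nat.
  have [N _ hN] := (cvgrPdist_lt _ _).1 (cv F0 Fle) e e0.
  exists (maxn N 3); first by rewrite leq_max orbT.
  have := hN (maxn N 3) (leq_maxl _ _); rewrite /= sub0r normrN => /(le_lt_trans (ler_norm _)).
  by [].
have [a0 mA] : 0 < expR (-2) :> R /\
    measurable (`[expR (-2), +oo[%classic : set (measurableTypeR R)).
  by split; [exact: expR_gt0|exact: measurable_itv].
have markov := deformed_markov (of_real x) a0; rewrite -/mu in markov.
have mass : `|x| ^+ 2 <= 3 * fine (mu `[expR (-2), +oo[%classic).
  apply: le_eps => e e0; have [n n2 hn] := small (e / 3) (divr_gt0 e0 (ltr0Sn R 2)).
  have := sine_mean_mass (smeas_fin E (of_real x)) sine_mean n2.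
  rewrite -/mu {1}/mu smeasT /= rip0 addr0 ripxx.
  by move: hn; move: (fine (mu _)) (fine (mu _)) => a b; lra.
have v0 := sqr_ge0 (nrm (emb (of_real x))).
have c0 : 0 < expR (-2) / (1 + expR (-2)) :> R by rewrite divr_gt0 ?addr_gt0.
rewrite -[2 * _ / _]mulrA -mulrA in markov; move: (expR (-2) / _) c0 markov => c c0 markov.
have := ler_wpM2l (ltW c0) mass; rewrite mulrCA => h.
by apply: le_trans h _; lra.
Qed.

End DeformedNorm.

(** * The real subspace H_R is closed, and its dual is total *)

Section RealSubspace.
Context {R : realType} {HR : realHilbert R} {U : R -> HR -> HR}.
Local Notation C := R[i].
Variables (K : deformed_space U) (U_og : orthogonal_group U).
Local Notation emb := (deformed_emb K).

Definition real_vectors : set K := [set emb (of_real x) | x in [set: HR]].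

(** Equivalently, the orthogonal of i H_R for the real part of the inner product. *)
Definition real_dual : set K := [set h | forall x : HR, complex.Im (ip (emb (of_real x)) h) = 0].

Let embB (x y : HR) : emb (of_real x) - emb (of_real y) = emb (of_real (x - y)).
Proof. by rewrite -linearB; congr (emb _); congr pair => /=; rewrite subrr. Qed.

(** By [deformed_ge] a Cauchy sequence for the deformed norm is Cauchy in HR, and [deformed_le]
    carries its limit back. *)
Let real_vectors_complete : hcomplete (ip_form K) real_vectors.
Proof.
move=> u Su uc.
have /choice[x hx] : forall n, exists a, u n = emb (of_real a).
  by move=> n; case: (Su n) => a _ <-; exists a.
pose k : R := expR (-2) / (1 + expR (-2)) / 2.
have k0 : 0 < k by rewrite !divr_gt0 ?addr_gt0 ?expR_gt0.
have kle (y : HR) : k * `|y| ^+ 2 <= nrm (emb (of_real y)) ^+ 2.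
  by have := deformed_ge K U_og y; rewrite /k; move: (_ / (1 + _)) => a; lra.
have cx : cvg (x @ \oo).
  apply: cauchy_cvg; apply/cauchy_ballP => e e0.
  have [|N hN] := uc (Num.sqrt k * e); first by rewrite mulr_gt0 ?sqrtr_gt0.
  exists ([set x n | n in [set n | (N <= n)%N]], [set x n | n in [set n | (N <= n)%N]]).
    by split; exists N => // n /= hn; exists n.
  move=> [_ _] [[m hm <-] [n hn <-]] /=; rewrite -ball_normE /ball_ /=.
  have := hN m n hm hn; rewrite !hx embB => h.
  have := kle (x m - x n).
  have sk := sqr_sqrtr (ltW k0); rewrite -(@ltr_pXn2r _ 2) ?nnegrE ?hnorm_ge0// in h; last first.
    by rewrite mulr_ge0 ?sqrtr_ge0 ?ltW.
  rewrite exprMn sk in h => /le_lt_trans/(_ h).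
  by rewrite ltr_pM2l// ltr_pXn2r ?nnegrE ?normr_ge0 ?(ltW e0).
exists (emb (of_real (lim (x @ \oo)))); first by exists (lim (x @ \oo)).
move=> e e0; have [|N _ hN] := (cvgrPdist_lt _ _).1 cx (e / 2); first by lra.
exists N => n /hN /=; rewrite hx embB distrC => h.
have := deformed_le K (of_real (x n - lim (x @ \oo))); rewrite /= rip0 addr0 ripxx => h2.
rewrite -(@ltr_pXn2r _ 2) ?nnegrE ?hnorm_ge0 ?(ltW e0)//; apply: le_lt_trans h2 _.
rewrite -(@ltr_pXn2r _ 2) ?nnegrE ?normr_ge0// in h; last by lra.
by move: h; rewrite exprMn; nra.
Qed.

(** A vector z orthogonal to the dual lies in H_R: the component r of z orthogonal to H_R, for real
    parts, has i r in the dual, so <r, z> = 0 and r = 0. Applied to y and i y, this puts both in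
    H_R, hence y = 0 by injectivity of the embedding. *)
Lemma real_dual_total (y : K) : (forall h, real_dual h -> ip h y = 0) -> y = 0.
Proof.
have mem (z : K) : (forall h, real_dual h -> ip h z = 0) -> real_vectors z.
  move=> hz; have [||||p [x _ <-] hp] := @orthogonal_projection _ _ (ip_form K) real_vectors z.
  - by exists 0 => //; rewrite -[RHS](linear0 emb).
  - move=> _ _ [a _ <-] [b _ <-]; exists (a + b) => //.
    by rewrite -linearD; congr (emb _); congr pair => /=; rewrite addr0.
  - move=> r _ [a _ <-]; exists (r *: a) => //; rewrite -linearZ; congr (emb _).
    by congr pair => /=; rewrite ?scaler0 ?scale0r ?subr0 ?addr0.
  - exact: real_vectors_complete.
  set r := z - emb (of_real x) in hp.
  have ir : real_dual ('i *: r).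
    move=> a; rewrite hfZr Im_iM (Re_hf_sym (ip_form K)) /=.
    by apply: hp; exists a.
  exists x => //; apply/eqP; rewrite eq_sym -subr_eq0 -/r; apply/eqP/nrm_eq0/eqP.
  have rz : ip r z = 0.
    have : ('i : C)^* * ip r z = 0.
      by rewrite -[LHS]/(_ * ip_form K r z) -hfZl; exact: hz.
    case: (ip r z) => a b e.
    have := congr1 (@complex.Re R) e; have := congr1 (@complex.Im R) e.
    by rewrite /= => h1 h2; apply: complex_ext => /=; lra.
  rewrite -sqrf_eq0 hnorm_sqr /=.
  have -> : ip r r = ip r z - ip r (emb (of_real x)) by rewrite -hfBr.
  by rewrite rz sub0r ReN; apply/eqP/oppr_inj; rewrite opprK oppr0; apply: hp; exists x.
move=> hy; have [x _ ey] := mem y hy.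
have [|x' _ ey'] := mem ('i *: y); first by move=> h /hy e; rewrite hfZr /= e mulr0.
have := @deformed_emb_eq0 _ _ _ K (of_real x' - 'i *: of_real x).
rewrite linearB linearZ /= ey ey' subrr => /(_ erefl) /(congr1 snd) /=.
move=> x0.
move: x0; rewrite scale1r scaler0 addr0 sub0r => /eqP; rewrite oppr_eq0 => /eqP x0.
by rewrite -ey x0 -[RHS](linear0 emb).
Qed.

End RealSubspace.
Arguments real_vectors {R HR U} K _.

(** * Right fields commute with left fields; the vacuum is separating *)

Section Separating.
Context {R : realType}.
Local Notation C := R[i].
Context {H F : complexHilbert R}.
Variables (q : R) (t : seq H -> F).
Hypotheses (q0 : -1 < q) (q1 : q < 1).
Hypothesis t_ip : forall v w, ip (t v) (t w) = qwords q (@ip _ _ H) 0 v w.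
Hypothesis tt : total t.

Let kp : psd_kernel (@ip _ _ H) := psd_hform (ip_form H) idfun.

Local Notation cr := (cre q0 q1 kp t_ip tt).
Local Notation an := (ann q0 q1 kp t_ip tt).
Local Notation rc := (rcre q0 q1 kp t_ip tt).
Local Notation ra := (rann q0 q1 kp t_ip tt).

Let cb x : bounded (cr x). Proof. exact: cre_bounded. Qed.
Let ab x : bounded (an x). Proof. exact: ann_bounded. Qed.
Let rcb x : bounded (rc x). Proof. exact: rcre_bounded. Qed.
Let rab x : bounded (ra x). Proof. exact: rann_bounded. Qed.

Lemma ann_rann e h u : an e (ra h u) = ra h (an e u).
Proof.
have a1 := adjoint_comp (cre_ann q0 q1 kp t_ip tt e) (rcre_rann q0 q1 kp t_ip tt h).
have a2 := adjoint_comp (rcre_rann q0 q1 kp t_ip tt h) (cre_ann q0 q1 kp t_ip tt e).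
have e1 : cr e \o rc h = rc h \o cr e by apply/funext => w; exact: cre_rcre.
by rewrite -e1 in a2; have := adjoint_uniq a1 a2 => /(congr1 (fun f => f u)) /= <-.
Qed.

Let comm e h u := an e (rc h u) - rc h (an e u).

Let comm_bounded e h : bounded (comm e h).
Proof.
have := bounded_add (bounded_comp (ab e) (rcb h))
  (bounded_scale (-1) (bounded_comp (rcb h) (ab e))).
by congr bounded; apply/funext => u; rewrite scaleN1r.
Qed.

Let comm_t e h v : comm e h (t v) = ((q ^+ size v)%:C * ip e h) *: t v.
Proof. by rewrite /comm ann_rcre_t addrC addKr. Qed.

(* The commutator of a right creation operator and an annihilation operator is
   diagonal, with real eigenvalues when <e, h> is real. *)
Let comm_adjoint e h : complex.Im (ip e h) = 0 -> adjoint (comm e h) (comm e h).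
Proof.
move=> eh; have [g hg] := adjoint_exists (comm_bounded e h).
have gE : comm e h = g.
  apply/funext; apply: (bounded_by_eq_on tt) => // [|v]; first exact: adjoint_bounded hg.
  apply: (total_ext tt) => w; rewrite -hg !comm_t hfZr hfZl /=.
  have [vw|vw] := eqVneq (size w) (size v); last by rewrite t_ip qwords_size// !mulr0.
  have -> : ip e h = (complex.Re (ip e h))%:C by apply: complex_ext.
  by rewrite vw -rmorphM conjR.
by move=> u v; rewrite hg gE.
Qed.

(** The commutator of the two fields is [comm e h] minus its adjoint: creation commutes with right
    creation, annihilation with right annihilation, and the mixed commutators are these two terms,
    which cancel when <e, h> is real. *)
Lemma field_right_field e h u : complex.Im (ip e h) = 0 ->
  cr e (rc h u + ra h u) + an e (rc h u + ra h u) =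
  rc h (cr e u + an e u) + ra h (cr e u + an e u).
Proof.
move=> eh; rewrite (linD (bounded_lin (cb e))) (linD (bounded_lin (ab e))).
rewrite (linD (bounded_lin (rcb h))) (linD (bounded_lin (rab h))).
rewrite cre_rcre ann_rann -!addrA; congr (_ + _); rewrite !addrA; congr (_ + _).
have comm_ra : comm e h u = ra h (cr e u) - cr e (ra h u).
  apply: ip_ext => w; rewrite -(comm_adjoint eh) hfBl hfBr /= -!rcre_rann.
  by rewrite [ip (rc h (an e w)) u]rcre_rann !(adjoint_sym (cre_ann _ _ _ _ _ _)).
by rewrite -[an e (rc h u)](subrK (rc h (an e u))) -/(comm e h u) comm_ra addrA subrKC addrC.
Qed.

(** Linearity in the letter is read off the inner products, by density of the words. *)
Lemma cre_linear_letter a h h' u : cr (a *: h + h') u = a *: cr h u + cr h' u.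
Proof.
have := bounded_by_eq_on tt (cb (a *: h + h')) (bounded_add (bounded_scale a (cb h)) (cb h')).
apply=> v; apply: (total_ext tt) => w.
rewrite hfDr hfZr /= -!(adjoint_sym (cre_ann _ _ _ _ _ _)) !ann_t /ann_word !hf_suml.
rewrite mulr_sumr -big_split; apply: eq_bigr => d _.
rewrite (hfZl (ip_form F)) (hfDl (ip_form H)) (hfZl (ip_form H)) !(hfZl (ip_form F)) /=.
by rewrite !conjM rmorphD /= !conjM conjcK; ring.
Qed.

Lemma cre_norm_letter : exists2 c : R, 0 <= c & forall h u, nrm (cr h u) <= c * nrm h * nrm u.
Proof.
have q' : 0 < 1 - `|q| by rewrite subr_gt0 ltr_norml q0 q1.
exists (Num.sqrt (1 - `|q|)^-1); first exact: sqrtr_ge0.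
move=> h u; have [_ /(_ u)] := cre_bounded_by q0 q1 kp t_ip tt h.
rewrite /cre_const -[complex.Re (ip h h)]/(complex.Re (ip_form H h h)) -hnorm_sqr mulrC.
by rewrite sqrtrM ?sqr_ge0// sqrtr_sqr ger0_norm ?hnorm_ge0// mulrC [nrm h * _]mulrC.
Qed.

Variables (S D : set H).
Hypothesis D_total : forall y, (forall h, D h -> ip h y = 0) -> y = 0.
Hypothesis D_real : forall e h, S e -> D h -> complex.Im (ip e h) = 0.

Definition fields : set (F -> F) := [set s | exists2 e, S e & s = cr e + an e].

(** By induction on words: x commutes with the right field of h in D, and x kills t v, so x kills
    the word v h, as the other terms are shorter words. The functional sending h to <u, x t(v h)> is
    bounded and vanishes on D, which is total; so it vanishes for every letter h. *)
Lemma vacuum_separating x : commutant (commutant fields) x -> x (t [::]) = 0 -> forall u, x u = 0.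
Proof.
move=> /commutantP[xb xc] x0.
have z0 : bounded (fun _ : F => 0 : F).
  by have := bounded_scale 0 (@bounded_id _ F); congr bounded; apply/funext => w; rewrite scale0r.
apply: (bounded_by_eq_on tt) => // v.
have [n] := ubnP (size v); elim: n v => // n IHn v; case/lastP: v => [//|v h0].
rewrite size_rcons ltnS => vn; apply: ip_ext => u; rewrite hf0r /=.
pose y := x \o flip t_ip tt; have yb : bounded y.
  by apply: bounded_comp => //; exact: flip_bounded.
(* Written so that h enters through [cr h], whose linearity and bound in h are known. *)
pose f h := ip u (y (cr h (t (rev v)))).
have fE h : f h = ip u (x (rc h (t v))) by rewrite /f /y /rcre /= flip_t.
have [c c0 hc] := cre_norm_letter; have [b b0 [yl hb]] := yb.
have [k hk] : exists k, forall h, f h = ip k h.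
  apply: (@riesz _ _ _ (nrm u * (b * (c * nrm (t (rev v)))))) => [a h h'|h].
    by rewrite /f cre_linear_letter yl hfDr hfZr.
  apply: le_trans (cauchy_schwarz (ip_form F) _ _) _; rewrite -!mulrA ler_wpM2l ?hnorm_ge0//.
  apply: le_trans (hb _) _; rewrite ler_wpM2l//.
  by rewrite [_ * nrm h]mulrC mulrA.
rewrite -(rcre_t q0 q1 kp t_ip tt) -(fE h0) hk [k]D_total ?hf0l// => h Dh.
rewrite ip_conj -hk fE.
suff -> : x (rc h (t v)) = 0 by rewrite hf0r conjc0.
have rS : commutant fields (fun u => rc h u + ra h u).
  apply/commutantP; split; first exact: bounded_add.
  move=> _ [e Se ->]; apply/funext => w /=.
  by have /= := field_right_field w (D_real Se Dh).
have := congr1 (fun f => f (t v)) (xc _ rS).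
rewrite /= linD ?IHn//; last exact: bounded_lin.
rewrite (lin0 (bounded_lin (rcb h))) (lin0 (bounded_lin (rab h))) addr0.
suff -> : x (ra h (t v)) = 0 by rewrite addr0.
rewrite rann_t (delsE (0 : H)) big_map (lin_sum (bounded_lin xb)) big1_seq// => i /andP[_].
rewrite mem_iota add0n size_rev => /= iv; rewrite (linZ (bounded_lin xb)) IHn ?scaler0//.
by rewrite size_rev size_cat size_take size_drop size_rev iv; lia.
Qed.

End Separating.

(** * The q-Araki-Woods algebra and its Wick words *)

Section ArakiWoods.
Context {R : realType} {q : R} {HR : realHilbert R} {U : R -> HR -> HR}.
Local Notation C := R[i].
Context {H : deformed_space U} (F : q_fock_space q H).
Hypotheses (q0 : -1 < q) (q1 : q < 1) (U_og : orthogonal_group U).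

Lemma tens_qwords v w : ip (tens F v) (tens F w) = qwords q (@ip _ _ H) 0 v w.
Proof. exact: tens_ip. Qed.

Lemma tens_total : total (tens F).
Proof.
move=> x e e0; have [_ [n [c [v ->]]] h] := dense_approx (@tens_dense _ _ _ F) x e0.
exists [seq (c i, v i) | i <- enum 'I_n]; apply: le_lt_trans h.
by rewrite /comb big_map big_enum.
Qed.

Local Notation cr := (cre q0 q1 (psd_hform (ip_form H) idfun) tens_qwords tens_total).
Local Notation an := (ann q0 q1 (psd_hform (ip_form H) idfun) tens_qwords tens_total).

Lemma field_operatorsE : @field_operators R q HR U H F =
  fields q0 q1 tens_qwords tens_total (real_vectors H).
Proof.
apply/seteqP; split=> s.
  move=> [h [a [a' [[ab at_] aa' ->]]]].
  exists (deformed_emb H (of_real h)); first by exists h.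
  have ca : cr (deformed_emb H (of_real h)) = a.
    apply/funext; apply: (bounded_by_eq_on tens_total); first exact: cre_bounded.
      exact/bounded_opP.
    by move=> v; rewrite cre_t at_.
  rewrite ca; congr (_ + _); apply: adjoint_uniq aa' _.
  by rewrite -ca; exact: cre_ann.
move=> [_ [h _ <-] ->].
exists h, (cr (deformed_emb H (of_real h))), (an (deformed_emb H (of_real h))).
split=> //; last exact: cre_ann.
by split; [apply/bounded_opP; exact: cre_bounded|move=> v; rewrite cre_t].
Qed.

Lemma fields_selfadjoint s : fields q0 q1 tens_qwords tens_total (real_vectors H) s ->
  bounded s /\ adjoint s s.
Proof.
move=> [e _ ->]; split; first by apply: bounded_add; [exact: cre_bounded|exact: ann_bounded].
move=> u v; rewrite -[LHS]/(ip (cr e u + an e u) v) -[RHS]/(ip u (cr e v + an e v)).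
by rewrite hfDl hfDr addrC /= cre_ann (adjoint_sym (cre_ann _ _ _ _ _ _)).
Qed.

Lemma araki_woodsE : araki_woods F =
  commutant (commutant (fields q0 q1 tens_qwords tens_total (real_vectors H))).
Proof.
by rewrite /araki_woods field_operatorsE; exact: smallest_von_neumann fields_selfadjoint.
Qed.

Lemma araki_woods_bounded x : araki_woods F x -> bounded x.
Proof. by rewrite araki_woodsE => /commutantP[]. Qed.

Lemma araki_woods_lin c x y : araki_woods F x -> araki_woods F y -> araki_woods F (c *: x + y).
Proof.
rewrite araki_woodsE; apply: commutant_lin => s /commutantP[sb _].
exact: bounded_lin.
Qed.

Lemma araki_woods_eq x y : araki_woods F x -> araki_woods F y ->
  x (vacuum F) = y (vacuum F) -> x = y.
Proof.
move=> Mx My xy; have Mz := araki_woods_lin (-1) Mx My; rewrite araki_woodsE in Mz.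
have z0 : (-1 *: x + y) (tens F [::]) = 0.
  by rewrite scaleN1r -[LHS]/(- x (vacuum F) + y (vacuum F)) xy addNr.
apply/funext => u; apply/eqP; rewrite eq_sym -subr_eq0; apply/eqP.
have := vacuum_separating (real_dual_total U_og) _ Mz z0 u.
rewrite scaleN1r -[(_ + _) u]/(- x u + y u) addrC; apply.
by move=> _ h [e _ <-]; apply.
Qed.

Section Words.
Context {Z : Type}.
Variables em em' : Z -> H.
Hypothesis em_split : forall z, exists2 a, real_vectors H a & exists2 b, real_vectors H b &
  em z = a + 'i *: b /\ em' z = a - 'i *: b.

Local Notation field :=
  (field_op q0 q1 (psd_hform (ip_form H) idfun) tens_qwords tens_total em em').
Local Notation word :=
  (wick_op q0 q1 (psd_hform (ip_form H) idfun) tens_qwords tens_total em em').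

Lemma araki_woods_field z : araki_woods F (field z).
Proof.
have [a Sa [b Sb [ea eb]]] := em_split z.
have Sm s : fields q0 q1 tens_qwords tens_total (real_vectors H) s -> araki_woods F s.
  rewrite araki_woodsE; apply: commutant2_sub => {}s /fields_selfadjoint[].
  by [].
have -> : field z = 'i *: (cr b + an b) + (cr a + an a).
  apply/funext => u; rewrite /field_op ea eb.
  rewrite -[LHS]/(cr (a + 'i *: b) u + an (a - 'i *: b) u).
  rewrite -[RHS]/('i *: (cr b u + an b u) + (cr a u + an a u)).
  have anE : an (a - 'i *: b) u = an a u + 'i *: an b u.
    apply: ip_ext => w; rewrite hfDr hfZr /= -!cre_ann.
    rewrite (_ : a - 'i *: b = (- 'i) *: b + a); last by rewrite scaleNr addrC.
    rewrite cre_linear_letter hfDl hfZl addrC; congr (_ + _ * _).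
    by apply: complex_ext; rewrite /= ?oppr0 ?opprK.
  by rewrite anE [a + _]addrC cre_linear_letter [an a u + _]addrC scalerDr addrACA.
by apply: araki_woods_lin; apply: Sm; [exists b|exists a].
Qed.

Lemma araki_woods_word v : araki_woods F (word v).
Proof.
apply: wick_ind.
- by rewrite araki_woodsE; exact: commutant_id.
- by move=> c a b; exact: araki_woods_lin.
- move=> z a Ma; have := araki_woods_field z; move: Ma; rewrite araki_woodsE => Ma Mf.
  exact: commutant_comp.
Qed.

(** The operator chosen by [wick] is the explicit Wick operator because the vacuum is separating.
    With abstract letters, this applies to K through the embedding and to H through its composite
    with T. *)
Lemma wick_tens v : wick (tens F (map em v)) = word v.
Proof.
apply: xget_unique; first by split; [exact: araki_woods_word|exact: wick_vacuum].
move=> y [My yE]; apply: araki_woods_eq => //; first exact: araki_woods_word.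
by rewrite yE; apply/esym; exact: wick_vacuum.
Qed.

End Words.
End ArakiWoods.

Lemma commutant4 (R : realType) (F : complexHilbert R) (S : set (F -> F)) :
  (forall s, S s -> bounded s) ->
  commutant (commutant (commutant (commutant S))) = commutant (commutant S).
Proof.
move=> Sb; have cb (X : set (F -> F)) s : commutant X s -> bounded s by move=> /commutantP[].
apply/seteqP; split; last by apply: commutant2_sub => s; exact: cb.
by apply: commutant_mono; apply: commutant2_sub => s; exact: cb.
Qed.

Lemma complexification_split (R : realType) (HR : realHilbert R) (z : complexification HR) :
  z = of_real z.1 + 'i *: of_real z.2 /\
  (z.1, - z.2) = of_real z.1 - 'i *: of_real z.2 :> complexification HR.
Proof.
case: z => a b; split; congr pair => /=.
- by rewrite scale0r scaler0 subrr addr0.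
- by rewrite scale1r scaler0 addr0 add0r.
- by rewrite scale0r scaler0 subrr oppr0 addr0.
- by rewrite scale1r scaler0 addr0 add0r.
Qed.

(** * Construction of Gamma_q(T) *)

Local Notation kip X := (psd_hform (ip_form X) idfun).
Local Notation tot F := (@tens_total _ _ _ _ _ F).

Theorem theorem3p4 (R : realType) (q : R) (q_gtN1 : -1 < q) (q_lt1 : q < 1)
    (KR HR : realHilbert R)
    (KR_sep : separable KR) (HR_sep : separable HR)
    (U : R -> KR -> KR) (V : R -> HR -> HR)
    (U_og : orthogonal_group U) (V_og : orthogonal_group V)
    (K : deformed_space U) (H : deformed_space V)
    (FK : q_fock_space q K) (FH : q_fock_space q H)
    (T : {linear K -> H})
    (T_contraction : forall x : K, `|T x| <= `|x|)
    (T_real : forall x : KR, exists y : HR,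
        T (deformed_emb K (of_real x)) = deformed_emb H (of_real y)) :
  exists Phi : (FK -> FK) -> (FH -> FH),
    [/\ (forall x, araki_woods FK x -> araki_woods FH (Phi x)),
        linear_on (araki_woods FK) Phi,
        normal_map (araki_woods FK) (araki_woods FH) Phi,
        Phi idfun = idfun &
        completely_positive (araki_woods FK) Phi] /\
    (forall e : seq (complexification KR),
        Phi (wick (tens FK [seq deformed_emb K x | x <- e])) =
        wick (tens FH [seq T (deformed_emb K x) | x <- e])) /\
    (forall x, araki_woods FK x ->
        ip (vacuum FH) (Phi x (vacuum FH)) = ip (vacuum FK) (x (vacuum FK))).
Proof.
have T_contr : bounded_by 1 T.
  split=> [a u v|u]; first exact: linearP.
  by have := T_contraction u; rewrite !normE lecR mul1r.
have [Ts T_adj] : exists Ts, adjoint T Ts by apply: adjoint_exists; exists 1.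
have [L [tL [tL_ip tL_tot]]] :=
  kernel_hilbert (psd_qwords (inl 0) (ltW q_gtN1) (ltW q_lt1) (psd_dkernel T_adj T_contr)).
pose Phi := phi q_gtN1 q_lt1 T_adj T_contr (tens_qwords FK) (tens_qwords FH) tL_ip
  (tot FK) (tot FH) tL_tot.
have Phi_lin c a b : bounded a -> bounded b -> Phi (c *: a + b) = c *: Phi a + Phi b.
  exact: phi_lin.
have Kb x : araki_woods FK x -> bounded x by exact: araki_woods_bounded.
pose em (z : complexification KR) : K := deformed_emb K z.
pose sw (z : complexification KR) : complexification KR := (z.1, - z.2).
pose em' z := em (sw z).
have swK z : sw (sw z) = z by case: z => a b; rewrite /sw /= opprK.
have em_split z : em z = em (of_real z.1) + 'i *: em (of_real z.2) /\
    em' z = em (of_real z.1) - 'i *: em (of_real z.2).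
  have [e1 e2] := complexification_split z.
  by split; [rewrite /em {1}e1 linearD linearZ|rewrite /em' /em /sw e2 linearB linearZ].
have K_split z : exists2 a, real_vectors K a & exists2 b, real_vectors K b &
    em z = a + 'i *: b /\ em' z = a - 'i *: b.
  by exists (em (of_real z.1)); [exists z.1|exists (em (of_real z.2)); [exists z.2|]].
(* Here the reality of T enters: T (em z) and T (em' z) are again conjugate to each other, so the
   Wick operators they define belong to the algebra of H. *)
have H_split z : exists2 a, real_vectors H a & exists2 b, real_vectors H b &
    (T \o em) z = a + 'i *: b /\ (T \o em') z = a - 'i *: b.
  have mem x : real_vectors H (T (em (of_real x))).
    by have [y ->] := T_real x; exists y.
  exists (T (em (of_real z.1))) => //; exists (T (em (of_real z.2))) => //.
  by have [e1 e2] := em_split z; rewrite /= e1 e2 linearB linearD linearZ.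
pose wordK := wick_op q_gtN1 q_lt1 (kip K) (tens_qwords FK) (tot FK) em em'.
pose wordH :=
  wick_op q_gtN1 q_lt1 (kip H) (tens_qwords FH) (tot FH) (T \o em) (T \o em').
(* Phi is linear and applies T to the letters of each normally ordered word, so it can be taken
   under the normal ordering. *)
have Phi_word v : Phi (wordK v) = wordH v.
  have h := @normal_order_operator _ q _ _ em em' _ _ Phi v
    (fun r s => op_word (cre q_gtN1 q_lt1 (kip K) (tens_qwords FK) (tot FK)) r \o
      op_word (ann q_gtN1 q_lt1 (kip K) (tens_qwords FK) (tot FK)) s) Phi_lin.
  rewrite [LHS]h; last first.
    move=> r s; apply: bounded_comp; apply: op_word_bounded => x; first exact: cre_bounded.
    exact: ann_bounded.
  apply/funext => u; rewrite /wordH /wick_op (normal_order_map q T em em').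
  by apply: normal_order_ext => r s; rewrite /Phi phi_normal_word.
pose A := wick_span q_gtN1 q_lt1 (kip K) (tens_qwords FK) (tot FK) em em'.
pose SK := fields q_gtN1 q_lt1 (tens_qwords FK) (tot FK) (real_vectors K).
pose SH := fields q_gtN1 q_lt1 (tens_qwords FH) (tot FH) (real_vectors H).
(* The inclusion on the algebra spanned by Wick operators, which [Phi_M] extends to the
   bicommutant. *)
have Phi_A a : A a -> araki_woods FH (Phi a).
  elim=> [v|c x y Ax Mx Ay My].
    by rewrite -/(wordK v) Phi_word; exact: araki_woods_word.
  rewrite Phi_lin; first exact: araki_woods_lin q_gtN1 q_lt1 _ _ _ Mx My.
    exact: wick_span_bounded Ax.
  exact: wick_span_bounded Ay.
have Phi_M x : araki_woods FK x -> araki_woods FH (Phi x).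
  rewrite (araki_woodsE FK q_gtN1 q_lt1) (araki_woodsE FH q_gtN1 q_lt1) => Mx.
  have tt := theta_total q_gtN1 q_lt1 T_adj T_contr (tens_qwords FK) tL_ip (tot FK) tL_tot.
  pose p := dilate q_gtN1 q_lt1 T_adj T_contr (tens_qwords FK) tL_ip (tot FK) tL_tot.
  have h := @compression_bicommutant _ _ _ _ _ _ p
    (J (tens_qwords FH) tL_ip (tot FH)) (Js (tens_qwords FH) tL_ip (tot FH))
    _ tt _ _ _ _ _ _ _ _ A SK SH.
  apply: h Mx => //.
  - exact: theta_bounded.
  - by move=> y n e yb; exact: dilate_theta.
  - by move=> y yb; exact: dilate_bounded.
  - exact: dilate_id.
  - by move=> c a b ab bb; exact: dilate_lin.
  - by move=> a b ab bb; exact: dilate_comp.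
  - by move=> a b ab ab'; exact: dilate_adjoint.
  - exact: J_bounded.
  - exact: Js_bounded.
  - move=> _ [_ [y _ <-] ->]; have := wick_span_field q_gtN1 q_lt1 (kip K)
      (tens_qwords FK) (tot FK) em em' (of_real y).
    by rewrite /field_op /em' /sw /em /= oppr0.
  - by move=> a; exact: wick_span_bounded.
  - exact: (wick_span_word q_gtN1 q_lt1 (kip K) (tens_qwords FK) (tot FK) em em' [::]).
  - by move=> c a b; exact: wick_span_lin.
  - by move=> a b; exact: wick_span_comp.
  - move=> a; apply: (@wick_span_adjoint _ _ _ _ _ _ _ _ _ _ _ _ _ _ _ sw) => z;
      by rewrite /em' ?swK.
  - by move=> a /Phi_A; rewrite (araki_woodsE FH q_gtN1 q_lt1).
exists Phi; split; last split.
- split=> //.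
  + by move=> c x y Mx My; apply: Phi_lin; exact: Kb.
  + apply: normal_of_small => //.
    * by rewrite (araki_woodsE FK q_gtN1 q_lt1) commutant4// => s /fields_selfadjoint[].
    * move=> x xb xp u.
      (* Positivity of Phi is the case n = 1 of complete positivity. *)
      have := @phi_cp _ q q_gtN1 q_lt1 _ _ _ _ T_adj T_contr _ _ _ _ _ _ (tens_qwords FK)
        (tens_qwords FH) tL_ip (tot FK) (tot FH) tL_tot 1 (fun _ _ => x) (fun _ _ => xb).
      move=> /(_ _ (fun=> u)); rewrite !big_ord1; apply.
      by move=> w; rewrite !big_ord1.
    * by move=> c u e c0 e0; exact: phi_small.
  + exact: phi_id.
  + by move=> n X MX; apply: phi_cp => i j; exact: Kb.
- move=> e; rewrite (wick_tens FK q_gtN1 q_lt1 U_og K_split) -/(wordK e) Phi_word.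
  by rewrite /wordH -(wick_tens FH q_gtN1 q_lt1 V_og H_split).
- by move=> x Mx; apply: phi_vacuum; exact: Kb.
Qed.
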